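(* Let $G$ be a partial cube of VC-dimension at most $2$, isometrically embedded in the hypercube $Q_m$. Then $G$ can be completed to an ample partial cube of VC-dimension at most $2$: the graph $G^{\top}:=(G\urcorner)\ulcorner$, obtained from the canonical 1-completion $G\urcorner$ of $G$ by recursively performing cycle completions along gated cycles of length at least $6$ until none is left, is a subgraph of $Q_m$ containing $G$, is an ample partial cube, and has VC-dimension at most $2$.
   Context: All graphs are finite, connected and simple. The hypercube $Q_m$ has as vertices the subsets of $\{1,\dots,m\}$, two subsets being adjacent iff their symmetric difference has size $1$. An induced subgraph $H$ of a graph $G$ is isometric if distances in $H$ equal those in $G$. A partial cube is a graph isometrically embeddable in some hypercube; it is identified with the induced subgraph of $Q_m$ that is its image, and hence with a set family. For a set family $\mathcal S\subseteq 2^{\{1,\dots,m\}}$, a set $X$ is shattered if $\{X\cap S: S\in\mathcal S\}=2^X$, and strongly shattered if there is $Y$ disjoint from $X$ with $Y\cup X'\in\mathcal S$ for all $X'\subseteq X$; the VC-dimension is the maximum size of a shattered set. $\mathcal S$ (and the induced subgraph of $Q_m$ on $\mathcal S$) is ample if every shattered set is strongly shattered; induced subgraphs on ample families are partial cubes. The $\Theta$-classes of a partial cube in $Q_m$ are the nonempty sets of its edges in a given coordinate direction; a $\Theta$-class crosses a subgraph if it contains an edge of it. Partial cubes of VC-dimension at most $2$ are called two-dimensional. A set $S$ of vertices of $G$ (or the induced subgraph) is convex if it contains all shortest paths of $G$ between its vertices, and gated if for every vertex $x\notin S$ there is $x'\in S$ such that every $y\in S$ is joined to $x$ by a shortest path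 through $x'$. $SK_n$ (a full subdivision) is obtained from the complete graph $K_n$ by subdividing each edge once; the vertices of $K_n$ are its original vertices. 1-extension: given a two-dimensional partial cube $G$ in $Q_m$ and an inclusion-maximal convex full subdivision $H=SK_n$, $n\ge 4$, of $G$, add to $G$ the unique vertex of $Q_m$ adjacent to all original vertices of $H$ (and all edges of $Q_m$ from it to $G$). The canonical 1-completion $G\urcorner$ is obtained from $G$ by performing 1-extensions successively as long as possible. Cycle completion: let $C=(v_1,\dots,v_{2k})$, $k\ge3$, be a gated cycle of a partial cube $G$ and $E_j$ a $\Theta$-class crossing $C$, with $v_{2k}v_1,\ v_kv_{k+1}\in E_j$. $G_{C,E_j}$ is obtained from $G$ by adding new vertices $v'_2,\dots,v'_{k-1}$, the path $v_{2k}=v'_1,v'_2,\dots,v'_{k-1},v'_k=v_{k+1}$ and the edges $v_iv'_i$, $2\le i\le k-1$ (in $Q_m$, $v'_i$ is the neighbor of $v_i$ in direction $j$). The construction is then applied recursively to the cycle $C'=(v'_1,\dots,v'_k,v_{k+2},\dots,v_{2k-1})$ as long as its length is at least $6$; the result is a cycle completion of $G$ along $C$. *)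

(* Defs.v *)
From Stdlib Require Import Relations.
From mathcomp Require Import all_boot.

Set Implicit Arguments.
Unset Strict Implicit.
Unset Printing Implicit Defensive.

(* A finite simple graph whose vertices form a subset of a finite type. *)
Record sgraph (T : finType) := SGraph {
  vset : {set T};
  adj : rel T;
  adj_sym : symmetric adj;
  adj_irr : irreflexive adj;
  adj_vset : forall x y, adj x y -> x \in vset
}.

Section Graphs.
Variable T : finType.
Implicit Types (G H : sgraph T) (S : {set T}) (x y : T) (p c : seq T).

Definition subgraph H G : Prop :=
  vset H \subset vset G /\ (forall x y, adj H x y -> adj G x y).

Definition induced_subgraph H G : Prop :=
  vset H \subset vset G /\
  {in vset H &, forall x y, adj H x y = adj G x y}.

Definition walk G x p y : Prop :=
  [/\ x \in vset G, path (adj G) x p & last x p = y].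

Definition shortest_path G x p y : Prop :=
  walk G x p y /\ (forall q, walk G x q y -> size p <= size q).

Definition is_dist G x y (d : nat) : Prop :=
  exists2 p, shortest_path G x p y & size p = d.

Definition isometric H G : Prop :=
  induced_subgraph H G /\
  {in vset H &, forall x y d, is_dist H x y d <-> is_dist G x y d}.

Definition convex G S : Prop :=
  S \subset vset G /\
  {in S &, forall x y p, shortest_path G x p y -> {subset p <= S}}.

Definition gated G S : Prop :=
  S \subset vset G /\
  forall x, x \in vset G -> x \notin S ->
    exists2 x', x' \in S &
      forall y, y \in S -> exists2 p, shortest_path G x p y & x' \in p.

(* The induced subgraph on the vertices listed in [c] is the cycle [c]. *)
Definition induced_cycle G c : Prop :=
  [/\ 3 <= size c, uniq c, {subset c <= vset G} &
      {in c &, forall x y, adj G x y = (next c x == y) || (next c y == x)}].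

Definition gated_cycle G c : Prop :=
  induced_cycle G c /\ gated G [set x in c].

(* Two listings of the same cycle: they differ by the choice of the first
   vertex and of the orientation. *)
Definition same_cycle c d : Prop :=
  exists i, d = rot i c \/ d = rot i (rev c).

End Graphs.

Section FullSubdivision.
Variable n : nat.

(* SK_n is the incidence graph of K_n: [inl i] is an original vertex and
   [inr e], with e a 2-subset, is the vertex subdividing the edge e. *)
Definition SK_vset : {set 'I_n + {set 'I_n}} :=
  [set a : 'I_n + {set 'I_n} | if a is inr e then #|e| == 2 else true].

Definition SK_adj (a b : 'I_n + {set 'I_n}) : bool :=
  match a, b with
  | inl i, inr e | inr e, inl i => (#|e| == 2) && (i \in e)
  | _, _ => false
  end.

Lemma SK_sym : symmetric SK_adj.
Proof. by case=> [i|e] [j|f]. Qed.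

Lemma SK_irr : irreflexive SK_adj.
Proof. by case. Qed.

Lemma SK_adj_vset a b : SK_adj a b -> a \in SK_vset.
Proof. by rewrite inE; case: a b => [i|e] [j|f] //= /andP[]. Qed.

Definition SK := SGraph SK_sym SK_irr SK_adj_vset.

End FullSubdivision.

(* f is an isomorphism from SK_n onto the subgraph of G induced by S. *)
Definition full_subdivision_by (T : finType) (G : sgraph T) (S : {set T})
    (n : nat) (f : 'I_n + {set 'I_n} -> T) : Prop :=
  [/\ S \subset vset G,
      {in vset (SK n) &, injective f},
      f @: vset (SK n) = S &
      {in vset (SK n) &, forall a b, adj G (f a) (f b) = adj (SK n) a b}].

Definition full_subdivision (T : finType) (G : sgraph T) (S : {set T}) : Prop :=
  exists n (f : 'I_n + {set 'I_n} -> T), full_subdivision_by G S f.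

Section Cube.
Variable m : nat.
Local Notation cubevertex := {set 'I_m}.
Implicit Types (A B X Y : cubevertex) (F : {set cubevertex}).
Implicit Types (G : sgraph cubevertex).

Definition symdiff A B : cubevertex := (A :\: B) :|: (B :\: A).

Definition cube_adj A B : bool := #|symdiff A B| == 1.

Lemma cube_sym : symmetric cube_adj.
Proof. by move=> A B; rewrite /cube_adj /symdiff setUC. Qed.

Lemma cube_irr : irreflexive cube_adj.
Proof. by move=> A; rewrite /cube_adj /symdiff setDv setU0 cards0. Qed.

Lemma cube_adj_vset A B : cube_adj A B -> A \in [set: cubevertex].
Proof. by rewrite inE. Qed.

Definition cube : sgraph cubevertex := SGraph cube_sym cube_irr cube_adj_vset.

(* The neighbour of A in direction j. *)
Definition flip (j : 'I_m) A : cubevertex := symdiff A [set j].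

(* A partial cube, identified with its image in Q_m; connectedness follows
   from isometricity, and the null graph is excluded. *)
Definition partial_cube G : Prop :=
  vset G != set0 /\ isometric G cube.

Definition shattered F X : bool := [set X :&: A | A in F] == powerset X.

Definition strongly_shattered F X : bool :=
  [exists Y : cubevertex, [disjoint Y & X] &&
    [forall X' : cubevertex, (X' \subset X) ==> (Y :|: X' \in F)]].

Definition VCdim F : nat := \max_(X : cubevertex | shattered F X) #|X|.

Definition ample F : Prop := forall X, shattered F X -> strongly_shattered F X.

(* The edge AB belongs to the Theta-class of direction j. *)
Definition Theta G (j : 'I_m) A B : bool := adj G A B && (symdiff A B == [set j]).

(* G' is the 1-extension of G with respect to some inclusion-maximal convex
   SK_n of G; v is the added vertex. *)
Definition one_extension G G' : Prop :=
  exists n (f : 'I_n + {set 'I_n} -> cubevertex) (S : {set cubevertex}) v,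
    [/\ 4 <= n,
        convex G S /\ full_subdivision_by G S f,
        forall S', convex G S' -> full_subdivision G S' ->
          S \subset S' -> S' = S,
        forall i : 'I_n, cube_adj v (f (inl i)) &
        vset G' = v |: vset G /\
        (forall A B, adj G' A B =
           [|| adj G A B, [&& A == v, B \in vset G & cube_adj A B]
             | [&& B == v, A \in vset G & cube_adj A B]])].

Definition canonical_one_completion G G' : Prop :=
  clos_refl_trans _ one_extension G G' /\
  ~ (exists G'', one_extension G' G'').

(* For c = (v_1, ..., v_2k): the path (v'_1, ..., v'_k). *)
Definition primed (c : seq cubevertex) (j : 'I_m) : seq cubevertex :=
  [seq flip j A | A <- take (size c)./2 c].

(* The cycle (v'_1, ..., v'_k, v_{k+2}, ..., v_{2k-1}). *)
Definition residual_cycle (c : seq cubevertex) (j : 'I_m) : seq cubevertex :=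
  primed c j ++ take ((size c)./2 - 2) (drop (size c)./2.+1 c).

(* G' = G_{C,E_j} for the gated cycle C = c = (v_1, ..., v_2k), where v_2k v_1
   and v_k v_{k+1} are in E_j.  The vertices v'_1 = v_2k and v'_k = v_{k+1} and
   the edges v_1 v'_1 and v_k v'_k, already in G, are included for uniformity. *)
Definition cycle_extension G (c : seq cubevertex) (j : 'I_m) G' : Prop :=
  exists k,
    [/\ 3 <= k /\ size c = k.*2,
        gated_cycle G c,
        Theta G j (nth set0 c k.*2.-1) (nth set0 c 0) /\
        Theta G j (nth set0 c k.-1) (nth set0 c k),
        vset G' = vset G :|: [set A in primed c j] &
        forall A B, adj G' A B =
          [|| adj G A B,
              infix [:: A; B] (primed c j), infix [:: B; A] (primed c j)
            | (B == flip j A) && ((A \in take k c) || (B \in take k c))]].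

(* G' is a cycle completion of G along the cycle c. *)
Inductive cycle_completion :
    sgraph cubevertex -> seq cubevertex -> sgraph cubevertex -> Prop :=
| CycleDone G c : size c < 6 -> cycle_completion G c G
| CycleStep G c d j G1 G2 :
    6 <= size c -> same_cycle c d -> cycle_extension G d j G1 ->
    cycle_completion G1 (residual_cycle d j) G2 ->
    cycle_completion G c G2.

Definition cycle_completion_step G G' : Prop :=
  exists c, [/\ 6 <= size c, gated_cycle G c & cycle_completion G c G'].

Definition full_cycle_completion G G' : Prop :=
  clos_refl_trans _ cycle_completion_step G G' /\
  ~ (exists c, 6 <= size c /\ gated_cycle G' c).

End Cube.

(* Main.v *)
From Stdlib Require Import Relations Classical.
Require Import Defs.
From mathcomp Require Import all_boot zify.

(* Work in the family F of vertices and in coordinates relative to a base point y.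

   Gates. Let C be a convex cycle of length 2k >= 6 spanning a subcube of directions D,
   and suppose that some vertex of F projects outside of C.  Take one, lying over y, at a
   minimal distance #|O| from the subcube, and let W be the set of points of the subcube
   whose translate by O is in F.  Since C shatters all pairs in D and no triple is
   shattered, W shatters no pair; as F is isometric, every point of W outside of C
   branches towards C in three directions, which is impossible for k >= 4.  For k = 3, y
   is the missing universal vertex of a convex SK_3, and comparing the geodesics from y + i
   to y + O + i, for i in D, gives #|O| = 1, hence a convex SK_4 containing C.

   The same argument on geodesics, applied to a maximal convex SK_n missing y, shows that
   every vertex of F differs from y in one of the n directions: hence F with y added is
   isometric, and it shatters no new triple since n >= 4.

   After the 1-completion there is no convex SK_4, so all convex cycles of length >= 6
   are gated.  A cycle completion adds vertices all of whose neighbours are explicitly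
   known, and thus creates no convex SK_4.  Finally, if a shattered pair {e, f} is not
   strongly shattered, two f-edges on the two sides of e at a minimal distance bound a
   convex cycle of length >= 6, which is gated. *)

Set Implicit Arguments.
Unset Strict Implicit.
Unset Printing Implicit Defensive.

(** The order of the two completions is forced by the 6-cycles. A convex 6-cycle is an SK_3 with two
    possible centres, antipodal in its 3-cube, and inside a convex SK_4 with centre y it is not
    gated: the fourth original vertex projects to y, which is missing. In fact SK_4 itself has no
    gated cycle of length at least 6 and is not ample, so cycle completions alone would stop too
    early. For n >= 4 the centre is unique, and adding it is harmless.

    What is carried along the cycle completions is only the absence of stars with four directions, a
    condition on the neighbours of few vertices. Gatedness of all convex cycles is not carried
    along: it is recovered at the end, by [gate_or_star], for the one cycle on which ampleness
    depends.

    Both completions are relations with many possible outcomes. Each step is therefore analysed for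
    an arbitrary outcome, and the existence of outcomes is separate: it rests on the number of
    vertices of Q_m still missing. *)

Local Notation "A :+: B" := (symdiff A B) (at level 52, left associativity).

(** * Symmetric differences, geodesics and isometric families in the hypercube *)

Section CubeBasics.
Variable m : nat.
Local Notation point := {set 'I_m}.
Implicit Types (x y z u v w A B D : point) (F : {set point}) (e f i j : 'I_m).

Lemma in_symdiff A B e : (e \in A :+: B) = (e \in A) (+) (e \in B).
Proof. by rewrite !inE; case: (e \in A); case: (e \in B). Qed.

Lemma in_flip j A e : (e \in flip j A) = (e \in A) (+) (e == j).
Proof. by rewrite in_symdiff inE. Qed.

Lemma flipE j A : flip j A = A :+: [set j].
Proof. by []. Qed.

Lemma cube_adjE A B : cube_adj A B = (#|A :+: B| == 1).
Proof. by []. Qed.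

Lemma card_symdiff A B : #|A :+: B| + #|A :&: B|.*2 = #|A| + #|B|.
Proof.
rewrite -(cardsID B A) -(cardsID A B) (setIC B A) /symdiff cardsU.
have -> : (A :\: B) :&: (B :\: A) = set0.
  by apply/setP=> e; rewrite !inE; case: (e \in A); case: (e \in B).
by rewrite cards0 subn0; lia.
Qed.

Lemma in_setlist (s : seq 'I_m) e : (e \in [set f in s]) = (e \in s).
Proof. by rewrite inE. Qed.

Definition inSD := (in_flip, in_symdiff, inE).

Lemma symdiffC A B : A :+: B = B :+: A.
Proof. by apply/setP=> e; rewrite !in_symdiff addbC. Qed.

Lemma symdiffA A B D : A :+: (B :+: D) = A :+: B :+: D.
Proof. by apply/setP=> e; rewrite !in_symdiff addbA. Qed.

Lemma symdiffK B A : A :+: B :+: B = A.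
Proof. by apply/setP=> e; rewrite !in_symdiff addbK. Qed.

Lemma symdiffKl A B : A :+: (A :+: B) = B.
Proof. by rewrite symdiffC (symdiffC A) symdiffK. Qed.

Lemma symdiff0 A : A :+: set0 = A.
Proof. by apply/setP=> e; rewrite in_symdiff inE addbF. Qed.

Lemma symdiffv A : A :+: A = set0.
Proof. by apply/setP=> e; rewrite in_symdiff inE addbb. Qed.

Lemma symdiff_eq0 A B : (A :+: B == set0) = (A == B).
Proof.
apply/eqP/eqP=> [h|->]; last exact: symdiffv.
by rewrite -(symdiffK B A) h symdiffC symdiff0.
Qed.

Lemma flipK j A : flip j (flip j A) = A.
Proof. by rewrite !flipE symdiffK. Qed.

Lemma flipC i j A : flip i (flip j A) = flip j (flip i A).
Proof. by apply/setP=> e; rewrite !in_flip addbAC. Qed.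

Lemma flip_symdiffl j A B : flip j A :+: B = flip j (A :+: B).
Proof. by apply/setP=> e; rewrite !inSD addbAC. Qed.

Lemma flip_symdiffr j A B : A :+: flip j B = flip j (A :+: B).
Proof. by apply/setP=> e; rewrite !inSD addbA. Qed.

Lemma cube_adjP A B : reflect (exists j, B = flip j A) (cube_adj A B).
Proof.
apply: (iffP cards1P) => -[j hj]; exists j.
  by rewrite flipE -hj symdiffKl.
by rewrite hj flipE symdiffKl.
Qed.

Lemma cube_adj_flip j A : cube_adj A (flip j A).
Proof. by apply/cube_adjP; exists j. Qed.

Lemma card_flip_in j A : j \in A -> #|A| = #|flip j A|.+1.
Proof.
move=> jA; rewrite (cardsD1 j A) jA add1n; congr _.+1.
apply: eq_card => e; rewrite !inSD.
by have [->|] := eqVneq e j; rewrite ?jA //= addbF.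
Qed.

Lemma card_flip_out j A : j \notin A -> #|flip j A| = #|A|.+1.
Proof.
by move=> jA; rewrite (@card_flip_in j) ?flipK // in_flip eqxx (negbTE jA).
Qed.

Definition between x z y : bool := x :+: z \subset x :+: y.

Lemma betweenP x z y :
  reflect (forall e, (e \in x) = (e \in y) -> (e \in z) = (e \in x))
          (between x z y).
Proof.
apply: (iffP subsetP) => h e.
  move=> he; apply/eqP; move: (h e); rewrite !inSD he.
  by case: (e \in y); case: (e \in z) => //= /(_ isT).
move: (h e); rewrite !inSD.
by case: (e \in x); case: (e \in y); case: (e \in z) => //= /(_ erefl).
Qed.

Lemma betweenxx x y : between x x y.
Proof. by apply/betweenP. Qed.

Lemma betweenxy x y : between x y y.
Proof. exact: subxx. Qed.

Lemma dist_between x z y :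
  between x z y = (#|x :+: y| == #|x :+: z| + #|z :+: y|).
Proof.
have hS : x :+: y = (x :+: z) :+: (z :+: y) by rewrite symdiffA symdiffK.
rewrite /between hS; move: (x :+: z) (z :+: y) => P Q.
have -> : (#|P :+: Q| == #|P| + #|Q|) = (#|P :&: Q| == 0) by have := card_symdiff P Q; lia.
rewrite cards_eq0; apply/subsetP/eqP=> [h|/setP h].
  apply/setP=> e; move: (h e); rewrite !inSD.
  by case: (e \in P); case: (e \in Q) => //= /(_ isT).
move=> e; move: (h e); rewrite !inSD.
by case: (e \in P); case: (e \in Q).
Qed.

Lemma dist_triangle x z y : #|x :+: y| <= #|x :+: z| + #|z :+: y|.
Proof.
have -> : x :+: y = (x :+: z) :+: (z :+: y) by rewrite symdiffA symdiffK.
by rewrite -card_symdiff leq_addr.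
Qed.

(** One-step form of isometricity: repeating the step towards [y] traces a geodesic of the cube
    inside [F]. The link with graph distances is [partial_cubeP]. *)
Definition iso F : Prop :=
  {in F &, forall x y, x != y -> exists2 e, e \in x :+: y & flip e x \in F}.

(** If [y] moves to [flip e y], the pair gets closer, and every direction from [x] to [flip e y] is
    also one from [x] to [y]. When vertices are added to a family, this lets the end whose
    neighbours are known do the moving. *)
Lemma iso_weak F :
  {in F &, forall x y, x != y ->
    exists2 e, e \in x :+: y & (flip e x \in F) || (flip e y \in F)} -> iso F.
Proof.
move=> h x y xF; have [n] := ubnP #|x :+: y|; elim: n y => // n IH y.
rewrite ltnS => hn yF xy.
have [e exy /orP[|yeF]] := h x y xF yF xy; first by exists e.
have [xe|xe] := eqVneq x (flip e y).
  by exists e => //; rewrite xe flipK.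
have hc : #|x :+: flip e y| < n.
  by rewrite flip_symdiffr; move: hn; rewrite (card_flip_in exy).
have [e' he' ?] := IH _ hc yeF xe; exists e' => //.
move: he'; rewrite flip_symdiffr in_flip.
by have [->|] := eqVneq e' e; rewrite ?exy // addbF.
Qed.

(** A geodesic from [x] with successive directions [s] visits the vertices [x :+: pre s n]; [post]
    describes the rest of it and encodes the second half of a cycle. *)
Definition pre (s : seq 'I_m) n : point := [set e in take n s].
Definition post (s : seq 'I_m) n : point := [set e in drop n s].

Lemma pre0 s : pre s 0 = set0.
Proof. by apply/setP=> e; rewrite !inE take0. Qed.

Lemma in_pre s n e : n <= size s -> (e \in pre s n) = (index e s < n).
Proof. by move=> hn; rewrite inE in_take_leq. Qed.

Lemma pre_over s n : size s <= n -> pre s n = [set e in s].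
Proof. by move=> hn; rewrite /pre take_oversize. Qed.

Lemma iso_path F x y : iso F -> x \in F -> y \in F ->
  exists s, [/\ uniq s, [set e in s] = x :+: y & forall n, x :+: pre s n \in F].
Proof.
move=> iF; have [k] := ubnP #|x :+: y|; elim: k x => // k IH x.
rewrite ltnS => hk xF yF; have [->|xy] := eqVneq x y.
  exists [::]; split=> // [|n]; first by rewrite symdiffv; apply/setP=> e; rewrite !inE.
  by rewrite pre_over // (_ : [set e in [::]] = set0 :> point) ?symdiff0 //; apply/setP=> e; rewrite !inE.
have [e exy xeF] := iF x y xF yF xy.
have hc : #|flip e x :+: y| < k by rewrite flip_symdiffl; move: hk; rewrite (card_flip_in exy).
have [s [us sE sF]] := IH _ hc xeF yF.
have es : e \notin s.
  by move/setP/(_ e): sE; rewrite flip_symdiffl in_flip exy eqxx inE => /= ->.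
exists (e :: s); split=> [||[|n]]; first by rewrite /= es.
- apply/setP=> f; move/setP/(_ f): sE; rewrite flip_symdiffl in_flip !(in_setlist, in_cons).
  by have [-> _|_ ->] := eqVneq f e; rewrite ?exy ?addbF.
- by rewrite pre0 symdiff0.
suff -> : x :+: pre (e :: s) n.+1 = flip e x :+: pre s n by [].
apply/setP=> f; rewrite !inSD -addbA; congr (_ (+) _).
have [->|] := eqVneq f e => //=.
by case hf: (e \in take n s) => //; rewrite (mem_take hf) in es.
Qed.

(** A geodesic changes [f] exactly once, and [z] is its last vertex before that. *)
Lemma iso_cross F x y f : iso F -> x \in F -> y \in F -> f \in x :+: y ->
  exists z, [/\ z \in F, between x z y, flip f z \in F & (f \in z) = (f \in x)].
Proof.
move=> iF xF yF fxy; have [s [us sE sF]] := iso_path iF xF yF.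
have fs : f \in s by move: fxy; rewrite -sE inE.
set n := index f s; have hn : n < size s by rewrite index_mem.
exists (x :+: pre s n); split; first exact: sF.
- rewrite /between symdiffKl -sE; apply/subsetP=> e; rewrite !inE; exact: mem_take.
- suff -> : flip f (x :+: pre s n) = x :+: pre s n.+1 by [].
  rewrite -flip_symdiffr; congr (_ :+: _); apply/setP=> e.
  rewrite in_flip !in_pre ?(ltnW hn) // ltnS [index e s <= n]leq_eqVlt.
  have -> : (index e s == n) = (e == f).
    apply/eqP/eqP=> [h|-> //]; rewrite -(nth_index f fs) -/n -h nth_index //.
    by rewrite -index_mem h.
  by have [->|] := eqVneq e f; rewrite ?ltnn ?addbF.
by rewrite in_symdiff in_pre ?(ltnW hn) // ltnn addbF.
Qed.

Lemma iso_cross2 F x y s t : iso F -> x \in F -> y \in F ->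
  s \in x :+: y -> t \in x :+: y -> s != t ->
  exists2 z, z \in F & between x z y /\ (s \in x :+: z) != (t \in x :+: z).
Proof.
move=> iF xF yF sxy txy st; have [l [ul lE lF]] := iso_path iF xF yF.
have sl : s \in l by move: sxy; rewrite -lE inE.
have tl : t \in l by move: txy; rewrite -lE inE.
(* The geodesic is cut right after the earlier of the two changes. *)
pose n := minn (index s l) (index t l).
have hsl : index s l < size l by rewrite index_mem.
have htl : index t l < size l by rewrite index_mem.
exists (x :+: pre l n.+1); rewrite // /between symdiffKl; split.
  rewrite -lE; apply/subsetP=> e; rewrite !inE; exact: mem_take.
have hst : index s l != index t l.
  by apply: contra st => /eqP h; rewrite -(nth_index s sl) h nth_index.
rewrite /n !in_pre; [|by rewrite gtn_min hsl..].
move: hst; have [h|h|//] := ltngtP (index s l) (index t l) => _.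
  by rewrite ltnS leqnn ltnS leqNgt h.
by rewrite !ltnS leqnn leqNgt h.
Qed.

Lemma card_pre s n : uniq s -> n <= size s -> #|pre s n| = n.
Proof.
move=> us hn; rewrite cardsE (card_uniqP _) ?take_uniq //.
by rewrite size_takel.
Qed.

Lemma iso_dist F x y n : iso F -> x \in F -> y \in F -> n <= #|x :+: y| ->
  exists2 z, z \in F & between x z y /\ #|x :+: z| = n.
Proof.
move=> iF xF yF hn; have [l [ul lE lF]] := iso_path iF xF yF.
have hl : n <= size l by rewrite -(card_uniqP ul) -cardsE lE.
exists (x :+: pre l n); rewrite // /between symdiffKl card_pre //; split=> //.
by rewrite -lE; apply/subsetP=> e; rewrite !inE; exact: mem_take.
Qed.

End CubeBasics.

(** * Shattered triples and the surroundings of a missing star centre *)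

Section VC2.
Variable m : nat.
Local Notation point := {set 'I_m}.
Implicit Types (x y z u v w A B D : point) (F : {set point}) (a b c e f i j : 'I_m).

Lemma exists_notin (A : point) (l : seq 'I_m) :
  size l < #|A| -> exists2 r, r \in A & r \notin l.
Proof.
move=> h; suff /subsetPn[r rA rl] : ~~ (A \subset l) by exists r.
apply: contraL h => /subset_leq_card h; rewrite -leqNgt.
exact: leq_trans h (card_size l).
Qed.

(** Absence of a shattered triple, which suffices since larger shattered sets contain shattered
    triples. With prescribed truth values, a contradiction is obtained by exhibiting eight
    vertices. *)
Definition vc2 F : Prop := forall a b c, uniq [:: a; b; c] ->
  ~ (forall p q r, exists2 x, x \in F &
       [/\ (a \in x) = p, (b \in x) = q & (c \in x) = r]).

Lemma VCdim_le2 F : (VCdim F <= 2) <-> vc2 F.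
Proof.
split=> [h a b c abc hs|h].
  have hX : shattered F [set e in [:: a; b; c]].
    apply/eqP/setP=> X; rewrite !inE; apply/imsetP/idP=> [[A AF ->]|sX].
      exact: subsetIl.
    have [A AF [ha hb hc]] := hs (a \in X) (b \in X) (c \in X); exists A => //.
    apply/setP=> e; rewrite inE in_setlist; apply/idP/andP=> [eX|[]].
      have := subsetP sX e eX; rewrite in_setlist => eabc; split=> //.
      by move: eX; move: eabc; rewrite !inE => /or3P[] /eqP->; rewrite ?ha ?hb ?hc.
    by rewrite !inE => /or3P[] /eqP->; rewrite ?ha ?hb ?hc.
  have := leq_trans (@leq_bigmax_cond _ (shattered F) (fun X : point => #|X|) _ hX) h.
  by rewrite cardsE (card_uniqP abc).
apply/bigmax_leqP=> X /eqP hX; rewrite leqNgt; apply/negP=> cX.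
have [a aX _] : exists2 r, r \in X & r \notin [::] by apply: exists_notin; apply: leq_trans cX.
have [b bX ba] : exists2 r, r \in X & r \notin [:: a] by apply: exists_notin; apply: leq_trans cX.
have [c cX' cab] : exists2 r, r \in X & r \notin [:: a; b] by apply: exists_notin.
have abc : uniq [:: a; b; c].
  move: ba cab; rewrite /= !inE !negb_or => ba /andP[ca cb].
  by rewrite eq_sym ba eq_sym ca eq_sym cb.
apply: (h _ _ _ abc) => p q r.
pose X' := [set e in X | (e == a) && p || (e == b) && q || (e == c) && r].
have : X' \in powerset X by rewrite inE; apply/subsetP=> e; rewrite inE => /andP[].
rewrite -hX => /imsetP[A AF /setP hA]; exists A => //.
move: abc; rewrite /= !inE negb_or andbT => /andP[/andP[ab ac] bc].
by split; [move: (hA a)|move: (hA b)|move: (hA c)];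
  rewrite !inE ?aX ?bX ?cX' ?eqxx ?(negbTE ab) ?(negbTE ac) ?(negbTE bc) /=
    1?(eq_sym b a) ?(eq_sym c a) ?(eq_sym c b)
    ?(negbTE ab) ?(negbTE ac) ?(negbTE bc) /= ?orbF => <-.
Qed.

Lemma vc2_rel F y a b c : vc2 F -> uniq [:: a; b; c] ->
  ~ (forall p q r, exists2 x, x \in F &
       [/\ (a \in x :+: y) = p, (b \in x :+: y) = q & (c \in x :+: y) = r]).
Proof.
move=> vF abc h; apply: (vF _ _ _ abc) => p q r.
have [x xF [ha hb hc]] := h (p (+) (a \in y)) (q (+) (b \in y)) (r (+) (c \in y)).
exists x => //; split; apply: (@addIb _);
  [exact: (etrans (esym (in_symdiff _ _ _)) ha)
  |exact: (etrans (esym (in_symdiff _ _ _)) hb)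
  |exact: (etrans (esym (in_symdiff _ _ _)) hc)].
Qed.

(** The two layers of a shattered 3-cube usually have different origins: a configuration inside a
    subcube, and a translate of one in a direction [c] transversal to it. *)
Lemma vc2_half F y a b c : vc2 F -> uniq [:: a; b; c] ->
  (forall p q, exists2 x, x \in F &
     [/\ (a \in x :+: y) = p, (b \in x :+: y) = q & c \notin x :+: y]) ->
  (forall p q, exists2 x, x \in F &
     [/\ (a \in x :+: y) = p, (b \in x :+: y) = q & c \in x :+: y]) -> False.
Proof.
move=> vF abc h0 h1; apply: (@vc2_rel F y a b c vF abc) => p q [].
  by have [x xF [? ? ?]] := h1 p q; exists x.
by have [x xF [? ? /negbTE ?]] := h0 p q; exists x.
Qed.

(* F induces on the subcube at y in the directions A the standard SK_n, n = #|A|: its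
   original vertices are the neighbours of y and the universal vertex y is missing. *)
Definition star F y A : Prop :=
  [/\ y \notin F, {in A, forall i, flip i y \in F},
      {in A &, forall i j, i != j -> flip i (flip j y) \in F} &
      {in A & &, forall i j l, uniq [:: i; j; l] -> flip i (flip j (flip l y)) \notin F}].

Lemma flip_rel i y : flip i y :+: y = [set i].
Proof. by rewrite flip_symdiffl symdiffv; apply/setP=> e; rewrite !inSD. Qed.

Lemma flip2_rel i j y : flip i (flip j y) :+: y = flip i [set j].
Proof. by rewrite flip_symdiffl flip_rel. Qed.

Lemma flip_sub e A : e \in A -> flip e A \subset A.
Proof.
move=> eA; apply/subsetP=> f; rewrite in_flip.
by have [->|] := eqVneq f e; rewrite ?addbF.
Qed.

Lemma flip_neq e A : flip e A != A.
Proof. by apply/eqP=> /setP/(_ e); rewrite in_flip eqxx; case: (e \in A). Qed.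

(** * A minimal set [O] of directions leading from a missing vertex [y] back into [F] *)

Section Corner.
Variables (F : {set point}) (y A O : point).
Hypotheses (iF : iso F) (vF : vc2 F) (cA : 2 < #|A|).
Hypothesis (hA1 : {in A, forall i, flip i y \in F}).
Hypothesis (hA2 : {in A &, forall i j, i != j -> flip i (flip j y) \in F}).
Hypotheses (AO : [disjoint A & O]) (O0 : O != set0) (yO : y :+: O \in F).
Hypothesis (minO : forall O' : point, O' \subset O -> O' != O -> y :+: O' \notin F).

Let notinO i : i \in A -> i \notin O.
Proof. by move=> iA; rewrite (disjointFr AO iA). Qed.

(** On the way from [y :+: O] to [flip i y], a first step in [O] would contradict the minimality of
    [O], so the first step is [i]. *)
Lemma corner_lift i : i \in A -> flip i (y :+: O) \in F.
Proof.
move=> iA; have iO := notinO iA.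
have ne : y :+: O != flip i y.
  by apply/eqP=> /setP/(_ i); rewrite !inSD eqxx (negbTE iO); case: (i \in y).
have [e he heF] := iF yO (hA1 iA) ne.
have [<- //|ei] := eqVneq e i.
have eO : e \in O.
  by move: he; rewrite !inSD (negbTE ei); case: (e \in y); case: (e \in O).
have /negP[] := minO (flip_sub eO) (flip_neq e O).
by rewrite flip_symdiffr.
Qed.

(** Otherwise [s], [t], [o] are shattered: the layer without [o] lies near [y], and the layer with
    [o] consists of [z], [y :+: O] and two of its lifts. *)
Lemma corner_no_pair o s t z : o \in O -> s \in A -> t \in A -> s != t ->
  z \in F -> o \in z :+: y -> s \in z :+: y -> t \in z :+: y -> False.
Proof.
move=> oO sA tA st zF oz sz tz.
have so : s != o by apply: contraTneq oO => <-; exact: notinO.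
have to : t != o by apply: contraTneq oO => <-; exact: notinO.
(* As [y] is missing, the pattern with none of [s], [t], [o] is realised by [flip r y] for a third
   direction [r]. *)
have [r rA] : exists2 r, r \in A & r \notin [:: s; t] by exact: exists_notin.
rewrite !inE negb_or => /andP[rs rt].
have ro : r != o by apply: contraTneq oO => <-; exact: notinO.
apply: (@vc2_half F y s t o) => //; first by rewrite /= !inE negb_or st so to.
  move=> [] [].
  - exists (flip s (flip t y)); first exact: hA2.
    by rewrite flip2_rel !inSD !eqxx (negbTE st) (eq_sym t s) (negbTE st) !(eq_sym o) (negbTE so) (negbTE to).
  - exists (flip s y); first exact: hA1.
    by rewrite flip_rel !inE eqxx (eq_sym t s) (negbTE st) (eq_sym o) so.
  - exists (flip t y); first exact: hA1.
    by rewrite flip_rel !inE eqxx (negbTE st) (eq_sym o) to.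
  - exists (flip r y); first exact: hA1.
    by rewrite flip_rel !inE !(eq_sym _ r) (negbTE rs) (negbTE rt) ro.
have hl i : flip i (y :+: O) :+: y = flip i O by rewrite flip_symdiffl (symdiffC y) symdiffK.
move=> [] [].
- by exists z.
- exists (flip s (y :+: O)); first exact: corner_lift.
  by rewrite hl !in_flip (negbTE (notinO sA)) (negbTE (notinO tA)) oO eqxx (eq_sym t s) (negbTE st) (eq_sym o) (negbTE so).
- exists (flip t (y :+: O)); first exact: corner_lift.
  by rewrite hl !in_flip (negbTE (notinO sA)) (negbTE (notinO tA)) oO eqxx (negbTE st) (eq_sym o) (negbTE to).
- exists (y :+: O) => //.
  by rewrite (symdiffC y) symdiffK (negbTE (notinO sA)) (negbTE (notinO tA)) oO.
Qed.

(* A geodesic between the two given vertices changes s and t; by corner_no_pair it passes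
   through some y + O3 with O3 below O1 :|: O2, and then O3 = O by minimality. *)
Lemma corner_cover o s t (O1 O2 : point) : s \in A -> t \in A -> s != t ->
  O1 \subset O -> O2 \subset O -> o \in O1 -> o \in O2 ->
  flip s (y :+: O1) \in F -> flip t (y :+: O2) \in F -> O \subset O1 :|: O2.
Proof.
move=> sA tA st s1 s2 o1 o2 F1 F2; have oO := subsetP s1 _ o1.
have n1 i : i \in A -> i \notin O1 by move/notinO; apply: contra; apply: (subsetP s1).
have n2 i : i \in A -> i \notin O2 by move/notinO; apply: contra; apply: (subsetP s2).
have ss : s \in flip s (y :+: O1) :+: flip t (y :+: O2).
  rewrite !inSD eqxx (negbTE st) (negbTE (n1 _ sA)) (negbTE (n2 _ sA)).
  by case: (s \in y).
have tt : t \in flip s (y :+: O1) :+: flip t (y :+: O2).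
  rewrite !inSD eqxx (eq_sym t s) (negbTE st) (negbTE (n1 _ tA)) (negbTE (n2 _ tA)).
  by case: (t \in y).
have [z zF [/betweenP bz hz]] := iso_cross2 iF F1 F2 ss tt st.
have so : o != s by apply: contraTneq oO => ->; exact: notinO.
have to : o != t by apply: contraTneq oO => ->; exact: notinO.
have oz : o \in z :+: y.
  by have := bz o; rewrite !inSD (negbTE so) (negbTE to) o1 o2 => ->; case: (o \in y).
have nz : ~~ ((s \in z :+: y) && (t \in z :+: y)).
  by apply/negP=> /andP[sz tz]; exact: (@corner_no_pair o s t z).
have {}nz : (s \notin z :+: y) && (t \notin z :+: y).
  move: nz hz; rewrite !inSD !eqxx (eq_sym t s) (negbTE st) (negbTE (n1 _ sA)) (negbTE (n1 _ tA)).
  by case: (s \in y); case: (t \in y); case: (s \in z); case: (t \in z).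
have sub : z :+: y \subset O1 :|: O2.
  apply/subsetP=> e; have [->|es] := eqVneq e s; first by case/andP: nz => /negbTE->.
  have [->|et] := eqVneq e t; first by case/andP: nz => _ /negbTE->.
  have := bz e; rewrite !inSD (negbTE es) (negbTE et).
  by case: (e \in O1); case: (e \in O2) => //= -> //; case: (e \in y).
have sub' : z :+: y \subset O by apply: subset_trans sub _; rewrite subUset s1.
have [<- //|ne] := eqVneq (z :+: y) O.
by have /negP[] := minO sub' ne; rewrite (symdiffC z) symdiffKl.
Qed.

Lemma corner_first i : i \in A -> exists2 o, o \in O & flip i (y :+: [set o]) \in F.
Proof.
move=> iA; have ne : flip i y != flip i (y :+: O).
  apply: contra O0 => /eqP/(congr1 (flip i)); rewrite !flipK => h.
  by rewrite -(symdiffKl y O) -h symdiffv.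
have [o] := iF (hA1 iA) (corner_lift iA) ne.
rewrite flip_symdiffl flip_symdiffr flipK symdiffKl => oO.
by rewrite flipC flipE -?flip_symdiffr -flipE; exists o => //; rewrite -flipE.
Qed.

Lemma corner_last i : i \in A -> exists2 o, o \in O & flip i (y :+: flip o O) \in F.
Proof.
move=> iA; have ne : flip i (y :+: O) != flip i y.
  apply: contra O0 => /eqP/(congr1 (flip i)); rewrite !flipK => h.
  by rewrite -(symdiffKl y O) h symdiffv.
have [o] := iF (corner_lift iA) (hA1 iA) ne.
rewrite flip_symdiffl flip_symdiffr flipK (symdiffC y) symdiffK => oO.
by rewrite flipC -flip_symdiffl (symdiffC _ y) ; exists o.
Qed.

(** For distinct directions of [A], the first step over the one equals the last step over the other:
    otherwise [corner_cover] would put [O] inside a union that misses this last step. Hence the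
    first steps over [s] and over [t] both equal the last step over [u], and [corner_cover] for this
    common [o] puts [O] inside [[set o]]. *)
Lemma corner_single : exists o, O = [set o].
Proof.
have [s sA _] : exists2 r, r \in A & r \notin [::] by apply: exists_notin; apply: leq_trans cA.
have [t tA] : exists2 r, r \in A & r \notin [:: s] by apply: exists_notin; apply: leq_trans cA.
rewrite inE => ts.
have [u uA] : exists2 r, r \in A & r \notin [:: s; t] by apply: exists_notin.
rewrite !inE negb_or => /andP[us ut].
have [o oO Fs] := corner_first sA.
have [//|no] := eqVneq O [set o]; first by exists o.
have lastE p q o1 o2 : p \in A -> q \in A -> p != q -> o1 \in O -> o2 \in O ->
    flip p (y :+: [set o1]) \in F -> flip q (y :+: flip o2 O) \in F -> o2 = o1.
  move=> pA qA pq O1 O2 F1 F2; apply/eqP; apply: contraT => o21.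
  have := @corner_cover o1 p q [set o1] (flip o2 O) pA qA pq.
  rewrite sub1set O1 flip_sub // in_flip set11 O1 eq_sym (negbTE o21) => /(_ isT isT isT isT F1 F2).
  by move/subsetP/(_ _ O2); rewrite in_setU in_flip in_set1 eqxx O2 (negbTE o21).
have [ot otO Ft] := corner_last tA; have [ou ouO Fu] := corner_last uA.
have et := lastE _ _ _ _ sA tA _ oO otO Fs Ft.
have eu := lastE _ _ _ _ sA uA _ oO ouO Fs Fu.
have [o' o'O Ft'] := corner_first tA.
have eu' := lastE _ _ _ _ tA uA _ o'O ouO Ft' Fu.
have oo' : o' = o by rewrite -eu' ?eu // eq_sym.
rewrite oo' in Ft'; have so : [set o] \subset O by rewrite sub1set.
have st : s != t by rewrite eq_sym.
have := corner_cover sA tA st so so (set11 o) (set11 o) Fs Ft'.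
by rewrite setUid => h; case/negP: no; rewrite eqEsubset h.
Qed.

(** The single direction of [O] behaves like those of [A]: pairs with it are provided by
    [corner_lift], and triples with it are excluded by [corner_no_pair]. *)
Lemma corner_star : star F y A -> exists2 o, O = [set o] & star F y (o |: A).
Proof.
case=> yF _ _ h3; have [o Oo] := corner_single; exists o => //.
have oO : o \in O by rewrite Oo set11.
have oF : flip o y \in F by rewrite flipE -Oo.
have lift i : i \in A -> flip i (flip o y) \in F.
  by move=> iA; rewrite [flip o y]flipE -Oo; exact: corner_lift.
have nopair i j : i \in A -> j \in A -> i != j -> flip i (flip j (flip o y)) \notin F.
  move=> iA jA ij; apply/negP=> zF.
  have io : i != o by apply: contraTneq oO => <-; exact: notinO.
  have jo : j != o by apply: contraTneq oO => <-; exact: notinO.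
  apply: (@corner_no_pair o i j _ oO iA jA ij zF);
    rewrite flip_symdiffl flip2_rel !inSD !eqxx ?(eq_sym o i) ?(eq_sym o j) ?(eq_sym j i)
      ?(negbTE ij) ?(negbTE io) ?(negbTE jo) //.
split=> // [i|i j|i j l]; rewrite ?inE.
- by case/predU1P=> [->|/hA1].
- case/predU1P=> [->|iA] /predU1P[->|jA]; rewrite ?eqxx // => ij.
  + by rewrite flipC lift.
  + exact: lift.
  + exact: hA2.
rewrite /= !inE negb_or andbT.
case/predU1P=> [->|iA] /predU1P[->|jA] /predU1P[->|lA]; rewrite ?eqxx ?andbF //=
  => /andP[/andP[ij il] jl].
- by rewrite flipC (flipC o l); exact: nopair.
- by rewrite (flipC o l); exact: nopair.
- exact: nopair.
by apply: h3; rewrite //= !inE negb_or ij il jl.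
Qed.

End Corner.
End VC2.

(** * Gates in the subcube of a cycle, or else a star with four directions *)

Section Gate.
Variable m : nat.
Local Notation point := {set 'I_m}.
Implicit Types (x y z u v w A B D : point) (F : {set point}) (a b c d e f i j l : 'I_m).

Section AwayFromGate.
Variables (F : {set point}) (y0 D O : point).
Hypotheses (iF : iso F) (vF : vc2 F) (cD : 2 < #|D|).

(* In the subcube at y0 in the directions D, the cell is the trace of F and the shadow is
   the projection of the part of F lying at the minimal distance #|O| at which F
   projects outside of the cell. *)
Definition cell z := (z :+: y0 \subset D) && (z \in F).
Definition shadow z := (z :+: y0 \subset D) && (z :+: O \in F).

Hypothesis antipodal : forall z, cell z -> cell (z :+: D).
Hypothesis pairs : forall y a b, y :+: y0 \subset D -> a \in D -> b \in D -> a != b ->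
  forall p q, exists2 z, cell z & (a \in z :+: y) = p /\ (b \in z :+: y) = q.
Hypotheses (DO : [disjoint D & O]) (y0F : y0 \notin F) (sy0 : shadow y0).
Hypothesis minO : forall z (O' : point), z :+: y0 \subset D -> [disjoint D & O'] ->
  z :+: O' \in F -> #|O'| < #|O| -> z \in F.

Lemma box_out z e : z :+: y0 \subset D -> e \notin D -> (e \in z) = (e \in y0).
Proof.
move=> zD eD; apply/eqP; apply: contraNT eD => h; apply: (subsetP zD).
by rewrite in_symdiff; case: (e \in z) h; case: (e \in y0).
Qed.

Lemma box_rel z y e : z :+: y0 \subset D -> y :+: y0 \subset D -> e \notin D -> e \in z :+: y = false.
Proof.
by move=> zD yD eD; rewrite in_symdiff (box_out zD eD) (box_out yD eD) addbb.
Qed.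

Lemma box_flip z i : z :+: y0 \subset D -> i \in D -> flip i z :+: y0 \subset D.
Proof.
move=> zD iD; rewrite flip_symdiffl; apply/subsetP=> e; rewrite in_flip.
by have [-> //|_] := eqVneq e i; rewrite addbF; apply: (subsetP zD).
Qed.

Let notinO e : e \in D -> (e \in O) = false.
Proof. by move=> eD; rewrite (disjointFr DO eD). Qed.

Let ObD o : o \in O -> o \notin D.
Proof. by move=> oO; rewrite (disjointFl DO oO). Qed.

(** Any [o] in [O] separates the cell from the translate of the shadow by [O]. The cell realises all
    patterns on [a] and [b], so the shadow must not, or [a], [b], [o] would be shattered. *)
Lemma shadow_no_pair y a b z00 z10 z01 z11 : y :+: y0 \subset D ->
  a \in D -> b \in D -> a != b ->
  shadow z00 -> a \notin z00 :+: y -> b \notin z00 :+: y ->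
  shadow z10 -> a \in z10 :+: y -> b \notin z10 :+: y ->
  shadow z01 -> a \notin z01 :+: y -> b \in z01 :+: y ->
  shadow z11 -> a \in z11 :+: y -> b \in z11 :+: y -> False.
Proof.
move=> yD aD bD ab h00 /negbTE a00 /negbTE b00 h10 a10 /negbTE b10 h01 /negbTE a01 b01 h11 a11 b11.
have [O0|[o oO]] := set_0Vmem O.
  by move: sy0; rewrite /shadow O0 symdiff0 (negbTE y0F) andbF.
have oD := ObD oO.
have ao : a != o by apply: contraNneq oD => <-.
have bo : b != o by apply: contraNneq oD => <-.
apply: (@vc2_half m F y a b o) => //; first by rewrite /= !inE negb_or ab ao bo.
  move=> p q; have [z /andP[zD zF] [ha hb]] := pairs yD aD bD ab p q.
  by exists z; rewrite // (box_rel zD yD oD).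
have sh z : shadow z -> [/\ z :+: O \in F, (a \in z :+: O :+: y) = (a \in z :+: y),
    (b \in z :+: O :+: y) = (b \in z :+: y) & o \in z :+: O :+: y].
  case/andP=> zD zF; rewrite !in_symdiff (notinO aD) (notinO bD) !addbF oO.
  by rewrite (box_out zD oD) (box_out yD oD); split => //; case: (o \in y0).
move=> [] [].
- by have [? e1 e2 ?] := sh _ h11; exists (z11 :+: O); rewrite // e1 e2 a11 b11.
- by have [? e1 e2 ?] := sh _ h10; exists (z10 :+: O); rewrite // e1 e2 a10 b10.
- by have [? e1 e2 ?] := sh _ h01; exists (z01 :+: O); rewrite // e1 e2 a01 b01.
- by have [? e1 e2 ?] := sh _ h00; exists (z00 :+: O); rewrite // e1 e2 a00 b00.
Qed.

(** The antipodes of these four vertices realise the four complementary patterns. *)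
Lemma cell_no_triple y a b c z000 z100 z010 z001 : y :+: y0 \subset D ->
  a \in D -> b \in D -> c \in D -> uniq [:: a; b; c] ->
  cell z000 -> [/\ a \notin z000 :+: y, b \notin z000 :+: y & c \notin z000 :+: y] ->
  cell z100 -> [/\ a \in z100 :+: y, b \notin z100 :+: y & c \notin z100 :+: y] ->
  cell z010 -> [/\ a \notin z010 :+: y, b \in z010 :+: y & c \notin z010 :+: y] ->
  cell z001 -> [/\ a \notin z001 :+: y, b \notin z001 :+: y & c \in z001 :+: y] -> False.
Proof.
move=> yD aD bD cD' abc c0 h0 c1 h1 c2 h2 c3 h3.
have mk z : cell z -> exists2 x, x \in F &
    [/\ (a \in x :+: y) = (a \in z :+: y), (b \in x :+: y) = (b \in z :+: y)
      & (c \in x :+: y) = (c \in z :+: y)] by case/andP=> _ zF; exists z.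
have mk' z : cell z -> exists2 x, x \in F &
    [/\ (a \in x :+: y) = (a \notin z :+: y), (b \in x :+: y) = (b \notin z :+: y)
      & (c \in x :+: y) = (c \notin z :+: y)].
  move/antipodal/andP=> [_ zF]; exists (z :+: D) => //.
  by rewrite !in_symdiff aD bD cD' !addbT !addNb.
have := (mk _ c0, mk' _ c0, (mk _ c1, mk' _ c1), (mk _ c2, mk' _ c2), (mk _ c3, mk' _ c3)).
case: h0 h1 h2 h3 => [/negbTE-> /negbTE-> /negbTE->] [-> /negbTE-> /negbTE->].
move=> [/negbTE-> -> /negbTE->] [/negbTE-> /negbTE-> ->] [[[[? ?] [? ?]] [? ?]] [? ?]].
by apply: (@vc2_rel m F y a b c vF abc) => [] [] [] [].
Qed.

(* On four coordinates a cell behaves like an isometric 8-cycle, which has no three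
   vertices at pairwise distance 2. *)
Lemma cell_no_three y a b c d z1 z2 z3 : y :+: y0 \subset D ->
  a \in D -> b \in D -> c \in D -> d \in D -> uniq [:: a; b; c; d] ->
  cell z1 -> [/\ a \in z1 :+: y, b \notin z1 :+: y, c \notin z1 :+: y & d \notin z1 :+: y] ->
  cell z2 -> [/\ a \notin z2 :+: y, b \in z2 :+: y, c \notin z2 :+: y & d \notin z2 :+: y] ->
  cell z3 -> [/\ a \notin z3 :+: y, b \notin z3 :+: y, c \in z3 :+: y & d \notin z3 :+: y] ->
  False.
Proof.
move=> yD aD bD cD' dD abcd c1 [a1 b1 d1 e1] c2 [a2 b2 d2 e2] c3 [a3 b3 d3 e3].
move: abcd; rewrite /= !inE !negb_or -!andbA andbT => /and5P[ab ac ad bc /andP[bd cd]].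
have ha : a \in z1 :+: z2.
  by move: a1 a2; rewrite !in_symdiff; case: (a \in y); case: (a \in z1); case: (a \in z2).
have hb : b \in z1 :+: z2.
  by move: b1 b2; rewrite !in_symdiff; case: (b \in y); case: (b \in z1); case: (b \in z2).
have [/andP[z1D z1F] /andP[z2D z2F]] := (c1, c2).
have [z zF [/betweenP bz nab]] := iso_cross2 iF z1F z2F ha hb ab.
have zD : z :+: y0 \subset D.
  apply/subsetP=> e; apply: contraTT => eD; rewrite in_symdiff.
  by rewrite bz (box_out z1D eD) ?(box_out z2D eD) // addbb.
have cz : cell z by rewrite /cell zD.
have dz : c \notin z :+: y /\ d \notin z :+: y.
  move: (bz c) (bz d) d1 d2 e1 e2; rewrite !in_symdiff.
  case: (c \in z1); case: (c \in z2); case: (c \in y) => //= -> //;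
  case: (d \in z1); case: (d \in z2); case: (d \in y) => //= -> //.
have abz : (a \in z :+: y) = (b \in z :+: y).
  move: nab a1 b1; rewrite !in_symdiff.
  by case: (a \in z1); case: (b \in z1); case: (a \in z); case: (b \in z); case: (a \in y); case: (b \in y).
(* With neither [a] nor [b], [z] is the empty pattern of a triple [a], [b], [c] in which [z3]
   provides [c]. With both, the antipode of [z] provides [d] in a triple [a], [b], [d] whose empty
   pattern is [z3]. *)
have [cz1 dz1] := dz; have [az|az] := boolP (a \in z :+: y); last first.
  apply: (@cell_no_triple y a b c z z1 z2 z3) => //; rewrite ?az -?abz ?az //.
  by rewrite /= !inE negb_or ab ac bc.
have bz' : b \in z :+: y by rewrite -abz.
have cz' := antipodal cz.
apply: (@cell_no_triple y a b d z3 z1 z2 (z :+: D)) => //.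
  by rewrite /= !inE negb_or ab ad bd.
by move: az bz' dz1; rewrite !in_symdiff aD bD dD !addbT !addNb => -> -> ->.
Qed.

(** Follow a geodesic from [y :+: O] to [z]. Over a vertex outside of [F] the minimality of [#|O|]
    forbids a step in [O], so the geodesic moves within the shadow until it meets the cell, at [h];
    [i] is its first direction. *)
Lemma shadow_branch y z : y :+: y0 \subset D -> shadow y -> y \notin F -> cell z ->
  exists i h, [/\ i \in D, shadow (flip i y), cell h, shadow h &
    i \in h :+: y /\ h :+: y \subset z :+: y].
Proof.
move=> + + + cz; have [n] := ubnP #|z :+: y|; elim: n y => // n IH y.
rewrite ltnS => hn yD sy yF; have /andP[zD zF] := cz; have /andP[_ yOF] := sy.
have ne : y :+: O != z.
  apply: contraNneq yF => h; suff -> : y = z by [].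
  apply/setP=> e; have [eD|eD] := boolP (e \in D); last by rewrite (box_out yD eD) (box_out zD eD).
  by rewrite -h in_symdiff notinO // addbF.
have [e ez eF] := iF yOF zF ne.
have eD : e \in D.
  apply: contraT => eD.
  have eO : e \in O.
    by move: ez; rewrite !in_symdiff (box_out yD eD) (box_out zD eD); case: (e \in y0); case: (e \in O).
  case/negP: yF; apply: (@minO y (flip e O)) => //; last 1 first.
  - by rewrite (card_flip_in eO).
  - rewrite -setI_eq0; apply/eqP/setP=> f; rewrite in_setI in_flip in_set0.
    have [->|_] := eqVneq f e; first by rewrite (negbTE eD).
    by rewrite addbF; have [fD|//] := boolP (f \in D); rewrite notinO.
  - by rewrite flip_symdiffr.
have ezy : e \in z :+: y.
  by move: ez; rewrite !in_symdiff notinO // addbF addbC.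
have sfy : shadow (flip e y) by rewrite /shadow box_flip // flip_symdiffl eF.
have [fF|fF] := boolP (flip e y \in F).
  exists e, (flip e y); split=> //; first by rewrite /cell box_flip.
  by rewrite flip_rel set11 sub1set.
have hc : #|z :+: flip e y| < n by rewrite flip_symdiffr; move: hn; rewrite (card_flip_in ezy).
have [i [h [iD si ch sh [ih hs]]]] := IH _ hc (box_flip yD eD) sfy fF.
exists e, h.
have eh : e \in h :+: y.
  move/subsetP/(_ e): hs; rewrite !flip_symdiffr !in_flip eqxx ezy /=.
  by case: (e \in h :+: y) => // /(_ isT).
split=> //; split=> //; apply/subsetP=> f.
have [->|fe] := eqVneq f e; first by rewrite ezy.
by move/subsetP/(_ f): hs; rewrite !flip_symdiffr !in_flip (negbTE fe) !addbF.
Qed.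

Let ne_of z y (a b : 'I_m) : a \in z :+: y -> b \notin z :+: y -> a != b.
Proof. by move=> ha; apply: contraNneq => <-. Qed.

(** If [flip i0 y] were not in [F], it would branch twice on its own side of [i0], in directions [i]
    and [j]. Directions used on the two sides are kept apart by [shadow_no_pair], so [h1], [h2] and
    the end [h] of the first new branch contradict [cell_no_three] on the coordinates [i1], [i2],
    [i], [j]. *)
Lemma shadow_flip_cell y i0 i1 i2 h1 h2 : y :+: y0 \subset D -> shadow y ->
  i0 \in D -> i1 \in D -> i2 \in D -> shadow (flip i0 y) ->
  cell h1 -> shadow h1 -> [/\ i0 \notin h1 :+: y, i1 \in h1 :+: y & i2 \notin h1 :+: y] ->
  cell h2 -> shadow h2 -> [/\ i0 \notin h2 :+: y, i1 \notin h2 :+: y & i2 \in h2 :+: y] ->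
  flip i0 y \in F.
Proof.
move=> yD sy i0D i1D i2D sy' ch1 sh1 [i0h1 i1h1 i2h1] ch2 sh2 [i0h2 i1h2 i2h2].
apply: contraT => yF'; set y' := flip i0 y in sy' yF' *.
have y'D : y' :+: y0 \subset D by exact: box_flip.
have i01 : i0 != i1 by rewrite eq_sym; exact: ne_of i0h1.
have i02 : i0 != i2 by rewrite eq_sym; exact: ne_of i0h2.
have i12 : i1 != i2 by exact: ne_of i2h1.
have relE z e : (e \in z :+: y') = (e \in z :+: y) (+) (e == i0).
  by rewrite flip_symdiffr in_flip.
have y0y' : (i0 \in y' :+: y) by rewrite flip_rel set11.
have yy' e : e != i0 -> e \notin y' :+: y by move=> ei; rewrite flip_rel inE.
have yy e : e \notin y :+: y by rewrite symdiffv inE.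
have [c cc [ci0 _]] := pairs y'D i0D i1D i01 false false.
have [i [h [iD siy ch sh [ih hc]]]] := shadow_branch y'D sy' yF' cc.
have i0h : i0 \notin h :+: y' by apply: contraFN ci0 => /(subsetP hc).
have ii0 : i != i0 by exact: ne_of i0h.
have i0i : i0 != i by rewrite eq_sym.
have i0h' : i0 \in h :+: y by move: i0h; rewrite relE eqxx addbT negbK.
have ih' : i \in h :+: y by move: ih; rewrite relE (negbTE ii0) addbF.
(* The second branch aims at a cell vertex agreeing with [y'] on [i0] and [i], which makes its
   direction [j] differ from both. *)
have [d cd [di0 di]] := pairs y'D i0D iD i0i false false.
have [j [g [jD sjy cg sg [jg gd]]]] := shadow_branch y'D sy' yF' cd.
have i0g : i0 \notin g :+: y' by apply: contraFN di0 => /(subsetP gd).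
have ig : i \notin g :+: y' by apply: contraFN di => /(subsetP gd).
have ji0 : j != i0 by exact: ne_of i0g.
have ji : j != i by exact: ne_of ig.
have i0g' : i0 \in g :+: y by move: i0g; rewrite relE eqxx addbT negbK.
have jg' : j \in g :+: y by move: jg; rewrite relE (negbTE ji0) addbF.
have jh : j \notin h :+: y'.
  apply/negP=> jh; apply: (@shadow_no_pair y' i j y' (flip i y') g h) => //;
    rewrite ?flip_rel ?symdiffv ?inE ?eqxx //.
  by rewrite eq_sym.
(* If [k] were used on both sides of [i0], then [y], [y'], [p] and [z] would realise all patterns on
   [i0] and [k] in the shadow. *)
have out1 z k p : k \in D -> k != i0 -> k \in p :+: y -> shadow p -> i0 \notin p :+: y ->
    i0 \in z :+: y -> shadow z -> k \notin z :+: y.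
  move=> kD ki0 kp sp i0p i0z sz; apply/negP=> kz.
  apply: (@shadow_no_pair y i0 k y y' p z) => //; last exact: yy'.
  by rewrite eq_sym.
have out2 z k p : k \in D -> k != i0 -> k \in z :+: y -> shadow p -> i0 \notin p :+: y ->
    i0 \in z :+: y -> shadow z -> k \notin p :+: y.
  by move=> kD ki0 kz sp i0p i0z sz; apply/negP=> kp; case/negP: (out1 _ _ _ kD ki0 kp sp i0p i0z sz).
have i10 : i1 != i0 by rewrite eq_sym.
have i20 : i2 != i0 by rewrite eq_sym.
have i1h := out1 _ _ _ i1D i10 i1h1 sh1 i0h1 i0h' sh.
have i2h := out1 _ _ _ i2D i20 i2h2 sh2 i0h2 i0h' sh.
have i1g := out1 _ _ _ i1D i10 i1h1 sh1 i0h1 i0g' sg.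
have i2g := out1 _ _ _ i2D i20 i2h2 sh2 i0h2 i0g' sg.
have ih1 := out2 _ _ _ iD ii0 ih' sh1 i0h1 i0h' sh.
have ih2 := out2 _ _ _ iD ii0 ih' sh2 i0h2 i0h' sh.
have jh1 := out2 _ _ _ jD ji0 jg' sh1 i0h1 i0g' sg.
have jh2 := out2 _ _ _ jD ji0 jg' sh2 i0h2 i0g' sg.
have jh' : j \notin h :+: y by move: jh; rewrite relE (negbTE ji0) addbF.
exfalso; apply: (@cell_no_three y i1 i2 i j h1 h2 h) => //.
rewrite /= !inE !negb_or i12 (eq_sym i j) ji.
by rewrite (ne_of i1h1 ih1) (ne_of i1h1 jh1) (ne_of i2h2 ih2) (ne_of i2h2 jh2).
Qed.

(** With a fourth direction in [D], the three neighbours of [y0] contradict [cell_no_three]. In a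
    3-cube the antipodes of these neighbours are the vertices at distance 2 from [y0], and the
    antipode of [y0] is missing because [y0] is. *)
Lemma star_of_three_flips i0 i1 i2 : i0 \in D -> i1 \in D -> i2 \in D -> uniq [:: i0; i1; i2] ->
  flip i0 y0 \in F -> flip i1 y0 \in F -> flip i2 y0 \in F ->
  #|D| = 3 /\ star F y0 D.
Proof.
move=> D0 D1 D2 u F0 F1 F2.
have cf i : i \in D -> flip i y0 \in F -> cell (flip i y0).
  by move=> iD iFF; rewrite /cell iFF flip_rel sub1set iD.
have yD : y0 :+: y0 \subset D by rewrite symdiffv sub0set.
have allD : {in D, forall l, l \in [:: i0; i1; i2]}.
  move=> l lD; apply: contraT => lu; exfalso.
  move: (u) (lu); rewrite /= !inE !negb_or !andbT.
  move=> /andP[/andP[u1 u2] u3] /and3P[l1 l2 l3].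
  apply: (@cell_no_three y0 i0 i1 i2 l _ _ _ yD) (cf _ D0 F0) _ (cf _ D1 F1) _ (cf _ D2 F2) _ => //;
    rewrite ?flip_rel /= ?inE ?negb_or ?eqxx ?u1 ?u2 ?u3 ?l1 ?l2 ?l3 ?(eq_sym i0 l)
      ?(eq_sym i1 l) ?(eq_sym i2 l) ?(eq_sym i1 i0) ?(eq_sym i2 i0) ?(eq_sym i2 i1)
      ?u1 ?u2 ?u3 ?l1 ?l2 ?l3 //.
have c3 : #|D| = 3.
  apply/eqP; rewrite eqn_leq cD andbT.
  have <- : #|[:: i0; i1; i2]| = 3 := card_uniqP u.
  by apply/subset_leq_card/subsetP.
have flipF : {in D, forall i, flip i y0 \in F}.
  by move=> i /allD; rewrite !inE => /or3P[] /eqP->.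
have full i j l : i \in D -> j \in D -> l \in D -> uniq [:: i; j; l] ->
    flip i (flip j (flip l y0)) = y0 :+: D.
  move=> iD jD lD ijl; have DE : D = [set e in [:: i; j; l]].
    apply/eqP; rewrite eq_sym eqEcard c3 cardsE (card_uniqP ijl) leqnn andbT.
    by apply/subsetP=> e; rewrite !inE => /or3P[] /eqP->.
  apply/setP=> e; rewrite !in_flip in_symdiff DE !inE.
  move: ijl; rewrite /= !inE negb_or andbT => /andP[/andP[ij il] jl].
  have [->|_] := eqVneq e i; first by rewrite (negbTE ij) (negbTE il) !addbF.
  have [->|_] := eqVneq e j; first by rewrite (negbTE jl) !addbF.
  by rewrite !addbF.
have antiF z : cell (z :+: D) -> cell z by move/antipodal; rewrite symdiffK.
split=> //; split=> // [i j iD jD ij|i j l iD jD lD ijl].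
  have [r rD] : exists2 r, r \in D & r \notin [:: i; j] by exact: exists_notin.
  rewrite !inE negb_or => /andP[ri rj].
  have : cell (flip i (flip j y0) :+: D).
    have -> : flip i (flip j y0) :+: D = flip r y0; last by apply: cf => //; exact: flipF.
    rewrite -(flipK r (flip i _ :+: D)) -flip_symdiffl full ?symdiffK //.
    by rewrite /= !inE negb_or ri rj ij.
  by case/antiF/andP.
rewrite full //; apply: contra y0F => zF.
suff /antiF/andP[_ //] : cell (y0 :+: D).
by rewrite /cell zF (symdiffC y0) symdiffK subxx.
Qed.

Lemma star_of_ungated_point : exists A : point, 3 < #|A| /\ star F y0 A.
Proof.
have yD : y0 :+: y0 \subset D by rewrite symdiffv sub0set.
have [a aD _] : exists2 r, r \in D & r \notin [::] by apply: exists_notin; apply: leq_trans cD.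
have [b bD] : exists2 r, r \in D & r \notin [:: a] by apply: exists_notin; apply: leq_trans cD.
rewrite inE eq_sym => ab.
have [c cc _] := pairs yD aD bD ab false false.
have [i0 [h0 [D0 s0 ch0 sh0 [i0h0 _]]]] := shadow_branch yD sy0 y0F cc.
(* Aiming at the antipode of [h0] makes the directions of the second branch disjoint from those of
   the first. *)
have [i1 [h1 [D1 s1 ch1 sh1 [i1h1 h1c]]]] := shadow_branch yD sy0 y0F (antipodal ch0).
have disj e : e \in h1 :+: y0 -> e \in h0 :+: y0 -> False.
  move=> e1 e0; have eD : e \in D by apply: (subsetP _ e e0); case/andP: ch0.
  have := subsetP h1c e e1; move: e0; rewrite !in_symdiff eD.
  by case: (e \in h0); case: (e \in y0).
have i0h1 : i0 \notin h1 :+: y0 by apply/negP=> h; exact: disj h i0h0.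
have i1h0 : i1 \notin h0 :+: y0 by apply/negP=> h; exact: disj i1h1 h.
have i01 : i0 != i1 by exact: ne_of i0h0 i1h0.
(* The third branch aims at a cell vertex agreeing with [y0] on [i0] and [i1]; [far] then keeps [i2]
   out of the first two. *)
have [d cd [di0 di1]] := pairs yD D0 D1 i01 false false.
have [i2 [h2 [D2 s2 ch2 sh2 [i2h2 h2d]]]] := shadow_branch yD sy0 y0F cd.
have i0h2 : i0 \notin h2 :+: y0 by apply: contraFN di0 => /(subsetP h2d).
have i1h2 : i1 \notin h2 :+: y0 by apply: contraFN di1 => /(subsetP h2d).
have i20 := ne_of i2h2 i0h2; have i21 := ne_of i2h2 i1h2.
have yy e : e \notin y0 :+: y0 by rewrite symdiffv inE.
have far i h : i \in D -> shadow (flip i y0) -> shadow h -> i \in h :+: y0 ->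
    i2 != i -> i \notin h2 :+: y0 -> i2 \notin h :+: y0.
  move=> iD si sh ih ne ih2; apply/negP=> i2h.
  apply: (@shadow_no_pair y0 i i2 y0 (flip i y0) h2 h) => //;
    by rewrite ?flip_rel ?inE // eq_sym.
have i2h0 := far _ _ D0 s0 sh0 i0h0 i20 i0h2.
have i2h1 := far _ _ D1 s1 sh1 i1h1 i21 i1h2.
have [] : #|D| = 3 /\ star F y0 D.
  apply: (@star_of_three_flips i0 i1 i2) => //.
  - by rewrite /= !inE negb_or i01 eq_sym i20 eq_sym i21.
  - exact: (@shadow_flip_cell y0 i0 i1 i2 h1 h2).
  - exact: (@shadow_flip_cell y0 i1 i0 i2 h0 h2).
  - exact: (@shadow_flip_cell y0 i2 i0 i1 h0 h1).
move=> c3 st; have [_ st1 st2 _] := st.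
have [||O' sO neO|o OE so] := corner_star iF vF cD st1 st2 DO _ _ _ st.
- by apply: contraNneq y0F => O0; case/andP: sy0; rewrite O0 symdiff0.
- by case/andP: sy0.
- apply/negP=> zF; case/negP: y0F; apply: (@minO y0 O') => //.
  + by apply: disjointWr DO.
  + by apply: proper_card; rewrite properEneq neO.
exists (o |: D); split=> //.
by rewrite cardsU1 c3 (ObD _) // OE set11.
Qed.
End AwayFromGate.

(** Among the vertices of [F] with a missing projection [r x], one nearest to the subcube is chosen,
    and the base point moves from [v] to [r x], which spans the same subcube. The required
    minimality holds because [z :+: O'] projects to [z]. *)
Lemma gate_or_star F v D : iso F -> vc2 F -> 2 < #|D| ->
  (forall z, z \in F -> z :+: v \subset D -> z :+: D \in F) ->
  (forall a b, a \in D -> b \in D -> a != b -> forall p q, exists2 z, z \in F &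
    [/\ z :+: v \subset D, (a \in z :+: v) = p & (b \in z :+: v) = q]) ->
  (forall x, x \in F -> v :+: ((x :+: v) :&: D) \in F) \/
  (exists y A, 3 < #|A| /\ star F y A).
Proof.
move=> iF vF cD anti pair.
pose r x := v :+: ((x :+: v) :&: D).
have [/forall_inP|] := boolP [forall x in F, r x \in F]; first by left.
rewrite negb_forall => /existsP[x0]; rewrite negb_imply => hx0; right.
case: (@arg_minnP _ x0 (fun x => (x \in F) && (r x \notin F)) (fun x => #|(x :+: v) :\: D|) hx0).
move=> x /andP[xF rF] minx.
set O := (x :+: v) :\: D.
have rD z : r z :+: v \subset D by rewrite /r (symdiffC v) symdiffK subsetIr.
have yO : r x :+: O = x.
  by apply/setP=> e; rewrite !inSD; case: (e \in x); case: (e \in v); case: (e \in D).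
have relD z : (z :+: r x \subset D) = (z :+: v \subset D).
  move: (r x) (rD x) => y h; apply/subsetP/subsetP=> hz e ez; apply: contraT => eD.
  - have h1 : e \notin y :+: v by apply: contra eD; apply: (subsetP h).
    case/negP: eD; apply: hz; move: ez h1; rewrite !in_symdiff.
    by case: (e \in z); case: (e \in v); case: (e \in y).
  - have h1 : e \notin y :+: v by apply: contra eD; apply: (subsetP h).
    case/negP: eD; apply: hz; move: ez h1; rewrite !in_symdiff.
    by case: (e \in z); case: (e \in v); case: (e \in y).
exists (r x); apply: (@star_of_ungated_point F (r x) D O) => //.
- move=> z /andP[]; rewrite relD => zv zF; rewrite /cell relD anti // andbT.
  apply/subsetP=> e; rewrite !in_symdiff => he; move/subsetP/(_ e): zv; rewrite in_symdiff.
  by move: he; case: (e \in z); case: (e \in D); case: (e \in v) => //= _; apply.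
- move=> y a b _ aD bD ab p q.
  have [z zF [zv za zb]] := pair a b aD bD ab
     (p (+) (a \in y) (+) (a \in v)) (q (+) (b \in y) (+) (b \in v)).
  exists z; first by rewrite /cell relD zv.
  move: za zb; rewrite !in_symdiff.
  by case: (a \in z); case: (a \in y); case: (a \in v); case: p => //= _;
    case: (b \in z); case: (b \in y); case: (b \in v); case: q.
- by rewrite -setI_eq0; apply/eqP/setP=> e; rewrite !inE; case: (e \in D); rewrite ?andbF.
- by rewrite /shadow relD yO rD.
move=> z O'; rewrite relD => zv DO' zF hO'; apply: contraT => zF'.
have e1 : r (z :+: O') = z.
  apply/setP=> e; have [eD|eD] := boolP (e \in D).
    by rewrite /r !(in_symdiff, in_setI) eD (disjointFr DO' eD) andbT; case: (e \in z); case: (e \in v).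
  have : e \notin z :+: v by apply: contra eD; apply: (subsetP zv).
  by rewrite /r !(in_symdiff, in_setI) (negbTE eD) andbF; case: (e \in z); case: (e \in v).
have := minx (z :+: O'); rewrite zF e1 zF' => /(_ isT); rewrite -/O.
have -> : (z :+: O' :+: v) :\: D = O'; last by rewrite leqNgt hO'.
apply/setP=> e; rewrite in_setD !in_symdiff.
have [eD|eD] := boolP (e \in D); first by rewrite (disjointFr DO' eD).
have : e \notin z :+: v by apply: contra eD; apply: (subsetP zv).
by rewrite in_symdiff; case: (e \in z); case: (e \in v); case: (e \in O').
Qed.
End Gate.

(** * Partial cubes as isometric set families *)

Section CubeGraphs.
Variable m : nat.
Local Notation point := {set 'I_m}.
Implicit Types (x y z u v w A B D : point) (F S : {set point}) (a b c e f i j l : 'I_m).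
Implicit Types (G H : sgraph point) (p q : seq point).

Definition cubical G : Prop :=
  forall x y, adj G x y = [&& x \in vset G, y \in vset G & cube_adj x y].

Lemma induced_adj_sym F : symmetric (fun x y => [&& x \in F, y \in F & cube_adj x y]).
Proof. by move=> x y; rewrite cube_sym andbCA. Qed.

Lemma induced_adj_irr F : irreflexive (fun x y => [&& x \in F, y \in F & cube_adj x y]).
Proof. by move=> x; rewrite cube_irr !andbF. Qed.

Lemma induced_adj_vset F x y : [&& x \in F, y \in F & cube_adj x y] -> x \in F.
Proof. by case/and3P. Qed.

Definition induced F : sgraph point :=
  SGraph (induced_adj_sym F) (induced_adj_irr F) (@induced_adj_vset F).

Lemma cube_path_dist (r : rel point) x p y : subrel r (@cube_adj m) ->
  path r x p -> last x p = y -> #|x :+: y| <= size p.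
Proof.
move=> sub; elim: p x => [|z p IH] x /=; first by move=> _ ->; rewrite symdiffv cards0.
case/andP=> /sub xz /IH{}IH /IH hp; apply: leq_trans (dist_triangle x z y) _.
by move: xz; rewrite cube_adjE => /eqP->; rewrite add1n ltnS.
Qed.

Lemma iso_walk G x y : cubical G -> iso (vset G) -> x \in vset G -> y \in vset G ->
  exists2 p, walk G x p y & size p = #|x :+: y|.
Proof.
move=> cG iG; have [n] := ubnP #|x :+: y|; elim: n x => // n IH x.
rewrite ltnS => hn xG yG; have [->|xy] := eqVneq x y.
  by exists [::]; rewrite ?symdiffv ?cards0.
have [e exy eG] := iG x y xG yG xy.
have hc : #|flip e x :+: y| < n by rewrite flip_symdiffl; move: hn; rewrite (card_flip_in exy).
have [p [_ pp pl] sp] := IH _ hc eG yG; exists (flip e x :: p).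
  by split=> //=; rewrite cG xG eG cube_adj_flip.
by rewrite /= sp flip_symdiffl (card_flip_in exy).
Qed.

Lemma cubical_sub G : cubical G -> subrel (adj G) (@cube_adj m).
Proof. by move=> cG x y; rewrite cG => /and3P[]. Qed.

Lemma shortest_pathP G x p y : cubical G -> iso (vset G) -> y \in vset G ->
  shortest_path G x p y <-> walk G x p y /\ size p = #|x :+: y|.
Proof.
move=> cG iG yG; split=> [[w s]|[w s]]; split=> //.
  apply/eqP; rewrite eqn_leq; have [xG pp pl] := w.
  rewrite (cube_path_dist (cubical_sub cG) pp pl) andbT.
  by have [q wq <-] := iso_walk cG iG xG yG; apply: s.
by move=> q [_ qp ql]; rewrite s; exact: cube_path_dist (cubical_sub cG) qp ql.
Qed.

Lemma cube_cubical : cubical (cube m).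
Proof. by move=> x y; rewrite !inE. Qed.

Lemma cube_iso : iso (vset (cube m)).
Proof.
move=> x y _ _; rewrite -symdiff_eq0 => /set0Pn[e exy].
by exists e; rewrite // inE.
Qed.

Lemma is_distP G x y d : cubical G -> iso (vset G) -> x \in vset G -> y \in vset G ->
  is_dist G x y d <-> #|x :+: y| = d.
Proof.
move=> cG iG xG yG; split=> [[p /(shortest_pathP _ _ cG iG yG)[_ ->]] //|<-].
by have [p w s] := iso_walk cG iG xG yG; exists p => //; apply/shortest_pathP.
Qed.

(** The bridge between the metric definition and [iso]: the first edge of a shortest path must
    reduce the Hamming distance, or the rest of the path would be too short. *)
Lemma partial_cubeP G : partial_cube G <-> [/\ vset G != set0, cubical G & iso (vset G)].
Proof.
split=> [[G0 [[_ ind] dist]]|[G0 cG iG]].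
  have cG : cubical G.
    move=> x y; apply/idP/idP=> [xy|/and3P[xG yG xy]].
      have xG := adj_vset xy; have yG : y \in vset G by apply: (@adj_vset _ G y x); rewrite adj_sym.
      by rewrite xG yG -[cube_adj x y]/(adj (cube m) x y) -ind.
    by rewrite ind.
  split=> // x y xG yG xy.
  have [p [[_ pp pl] _] sp] : is_dist G x y #|x :+: y|.
    have [_] := dist x y xG yG #|x :+: y|; apply.
    have [_ h] := is_distP #|x :+: y| cube_cubical cube_iso (in_setT x) (in_setT y).
    exact: h.
  case: p pp pl sp => [_ /= h|z p /= /andP[xz pp] pl sp]; first by rewrite h eqxx in xy.
  move: xz; rewrite cG => /and3P[_ zG /cube_adjP[e ze]]; exists e; last by rewrite -ze.
  have := cube_path_dist (cubical_sub cG) pp pl; rewrite ze flip_symdiffl.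
  by apply: contraLR => he; rewrite (card_flip_out he) -sp -ltnNge; lia.
split=> //; split; first by split=> [|x y xG yG]; [exact: subsetT | rewrite cG xG yG].
move=> x y xG yG d; apply: (iff_trans (is_distP _ cG iG xG yG)); apply: iff_sym.
exact: is_distP _ cube_cubical cube_iso (in_setT x) (in_setT y).
Qed.

Lemma walk_cat G x p y q z : walk G x p y -> walk G y q z -> walk G x (p ++ q) z.
Proof.
move=> [xG pp pl] [_ qp ql]; split=> //; first by rewrite cat_path pp pl.
by rewrite last_cat pl.
Qed.

Lemma walk_last G x p y : walk G x p y -> x != y -> y \in p.
Proof.
move=> [_ _ <-]; case: p => [|z p]; first by rewrite eqxx.
by rewrite /= mem_last.
Qed.

Lemma geodesic_through G x z y : cubical G -> iso (vset G) ->
  x \in vset G -> z \in vset G -> y \in vset G -> between x z y -> x != z ->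
  exists2 p, shortest_path G x p y & z \in p.
Proof.
move=> cG iG xG zG yG; rewrite dist_between => /eqP b xz.
have [p wp sp] := iso_walk cG iG xG zG; have [q wq sq] := iso_walk cG iG zG yG.
exists (p ++ q); last by rewrite mem_cat (walk_last wp xz).
apply/shortest_pathP=> //; split; first exact: walk_cat wq.
by rewrite size_cat sp sq.
Qed.

Lemma shortest_path_mem G x p y z : cubical G -> iso (vset G) -> y \in vset G ->
  shortest_path G x p y -> z \in p -> z \in vset G /\ between x z y.
Proof.
move=> cG iG yG /(shortest_pathP _ _ cG iG yG) [[xG pp pl] sp] zp.
case/splitPr: zp pp pl sp => p1 p2.
rewrite cat_path last_cat size_cat /= => /and3P[h1 h2 h3] pl sp.
split; first by move: h2; rewrite cG => /and3P[].
rewrite dist_between eqn_leq dist_triangle /= -sp.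
have := cube_path_dist (cubical_sub cG) h3 pl.
have h4 : path (adj G) x (rcons p1 z) by rewrite rcons_path h1.
have := cube_path_dist (cubical_sub cG) h4 (last_rcons _ _ _).
rewrite size_rcons => h h'; apply: leq_trans (leq_add h h') _; lia.
Qed.

Lemma convexP G S : cubical G -> iso (vset G) ->
  convex G S <-> S \subset vset G /\
    {in S &, forall x y z, z \in vset G -> between x z y -> z \in S}.
Proof.
move=> cG iG; split=> -[sS h]; split=> // x y xS yS.
  move=> z zG b; have [xz|xz] := eqVneq x z; first by rewrite -xz.
  have [p sp zp] := geodesic_through cG iG (subsetP sS _ xS) zG (subsetP sS _ yS) b xz.
  exact: (h x y xS yS p sp z zp).
move=> p sp z zp; have yG := subsetP sS _ yS.
by have [zG b] := shortest_path_mem cG iG yG sp zp; exact: h b.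
Qed.

End CubeGraphs.

(** * Stars span convex subgraphs *)

Section Star.
Variable m : nat.
Local Notation point := {set 'I_m}.
Implicit Types (x y z u v w A B X : point) (F S : {set point}) (a b c e i j l : 'I_m).
Implicit Types (G H : sgraph point).

Lemma card_flip_ex n X : #|X| = n.+1 -> exists2 a, a \in X & #|flip a X| = n.
Proof.
move=> hX; have /set0Pn[a aX] : X != set0 by rewrite -card_gt0 hX.
by exists a => //; apply: eq_add_S; rewrite -hX (card_flip_in aX).
Qed.

Lemma dist2_flip x y : #|x :+: y| = 2 ->
  exists a b, [/\ a \in x :+: y, b \in x :+: y, a != b & x = flip a (flip b y)].
Proof.
case/card_flip_ex=> a ax /card_flip_ex[b bx /cards0_eq h].
have ba : b != a by apply: contraTneq bx => ->; rewrite in_flip eqxx ax.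
exists a, b; split=> //; last 2 first.
- by rewrite eq_sym.
- have hX : x :+: y = flip a (flip b set0) by rewrite -h !flipK.
  by rewrite -[LHS](symdiffK y) hX !flip_symdiffl symdiffC symdiff0.
by move: bx; rewrite in_flip (negbTE ba) addbF.
Qed.

Lemma dist3_flip x y : #|x :+: y| = 3 ->
  exists a b c, [/\ [/\ a \in x :+: y, b \in x :+: y & c \in x :+: y],
    uniq [:: a; b; c] & x = flip a (flip b (flip c y))].
Proof.
case/card_flip_ex=> a ax; rewrite -flip_symdiffl => /dist2_flip[b [c [bx cx bc xE]]].
move: bx cx; rewrite !flip_symdiffl !in_flip => bx cx.
have ba : b != a by apply: contraTneq bx => ->; rewrite eqxx ax.
have ca : c != a by apply: contraTneq cx => ->; rewrite eqxx ax.
exists a, b, c; split.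
- by move: bx cx; rewrite (negbTE ba) (negbTE ca) !addbF.
- by rewrite /= !inE negb_or eq_sym ba eq_sym ca bc.
by rewrite -xE flipK.
Qed.

(** Vertex set of the full subdivision around [y]: original vertices at distance 1, subdividing
    vertices at distance 2. *)
Definition starset y A : {set point} :=
  [set x | (x :+: y \subset A) && (0 < #|x :+: y| <= 2)].

Lemma starset1 y A i : (flip i y \in starset y A) = (i \in A).
Proof. by rewrite inE flip_rel sub1set cards1 andbT. Qed.

Lemma starset2 y A i j : i \in A -> j \in A -> i != j -> flip i (flip j y) \in starset y A.
Proof.
move=> iA jA ij; rewrite inE flip2_rel card_flip_out ?inE // cards1 andbT.
apply/subsetP=> e; rewrite in_flip inE.
by have [-> //|_] := eqVneq e i; have [-> //|] := eqVneq e j.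
Qed.

Lemma starsetP y A x : x \in starset y A ->
  (exists2 i, i \in A & x = flip i y) \/
  (exists i j, [/\ i \in A, j \in A, i != j & x = flip i (flip j y)]).
Proof.
rewrite inE => /andP[/subsetP xA]; case hX: #|x :+: y| => [|[|[|]]] //= _.
  left; have [i ix] := card_flip_ex hX; move/cards0_eq=> h; exists i; first exact: xA.
  have hX' : x :+: y = flip i set0 by rewrite -h flipK.
  by rewrite -[LHS](symdiffK y) hX' flip_symdiffl symdiffC symdiff0.
have [i [j [ix jx ij xE]]] := dist2_flip hX; right; exists i, j.
by split=> //; exact: xA.
Qed.

Lemma starset_sub F y A : star F y A -> starset y A \subset F.
Proof.
case=> _ h1 h2 _; apply/subsetP=> x /starsetP[[i iA ->]|[i [j [iA jA ij ->]]]].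
  exact: h1.
exact: h2.
Qed.

Lemma star_box F y A x : iso F -> star F y A -> x \in F -> x :+: y \subset A ->
  x \in starset y A.
Proof.
move=> iF [yF h1 _ h3] xF xA; rewrite inE xA /= card_gt0 symdiff_eq0.
have -> /= : x != y by apply: contraNneq yF => <-.
rewrite leqNgt; apply/negP=> cx.
have /set0Pn[i ix] : x :+: y != set0 by rewrite -card_gt0 (leq_trans _ cx).
have iA := subsetP xA i ix.
have dxi : #|x :+: y| = #|x :+: flip i y|.+1 by rewrite flip_symdiffr; exact: card_flip_in.
(* As [i] is in [x :+: y], a geodesic from [x] to [flip i y] never changes [i]. Its vertex [z] two
   steps before the end is thus at distance 3 from [y], where a star has no vertex. *)
have [z zF [/[dup] bz /betweenP hz nz]] := iso_dist (n := #|x :+: y| - 3) iF xF (h1 i iA) ltac:(lia).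
have iz : i \in z :+: y.
  have := hz i; move: ix; rewrite in_flip eqxx !in_symdiff.
  by case: (i \in y); case: (i \in x) => //= _ ->.
have : #|z :+: y| = 3.
  rewrite (card_flip_in iz) -flip_symdiffr.
  move: bz cx; rewrite dist_between nz dxi.
  by move: #|x :+: flip i y| #|z :+: flip i y| => p q /eqP; lia.
case/dist3_flip=> a [b [c [[az bz' cz] u zE]]].
have zA : z :+: y \subset A.
  apply/subsetP=> e ez; apply: contraT => eA.
  have ex : e \notin x :+: y by apply: contra eA; exact: (subsetP xA).
  have ei : e != i by apply: contraNneq eA => ->.
  have := hz e; move: ex ez; rewrite in_flip (negbTE ei) addbF !in_symdiff.
  by case: (e \in x); case: (e \in y) => //= _ ez' /(_ erefl) h; rewrite h in ez'.
have := h3 a b c (subsetP zA _ az) (subsetP zA _ bz') (subsetP zA _ cz) u.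
by rewrite -zE zF.
Qed.

(** By [star_box] the set is the trace of a subcube on [vset G], and subcubes are convex. *)
Lemma star_convex G y A : cubical G -> iso (vset G) -> star (vset G) y A ->
  convex G (starset y A).
Proof.
move=> cG iG st; apply/convexP=> //; split; first exact: starset_sub.
move=> x x' xS x'S z zG /betweenP bz; apply: star_box iG st zG _.
apply/subsetP=> e; apply: contraTT => eA.
have ex : e \notin x :+: y by apply: contra eA; move: xS; rewrite inE => /andP[/subsetP + _]; apply.
have ex' : e \notin x' :+: y by apply: contra eA; move: x'S; rewrite inE => /andP[/subsetP + _]; apply.
have := bz e; move: ex ex'; rewrite !in_symdiff.
by case: (e \in x); case: (e \in y); case: (e \in x') => //= _ _ ->.
Qed.

End Star.

(** * The isomorphism between a star and SK_n *)

Section StarSubdivision.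
Variable m : nat.
Local Notation point := {set 'I_m}.
Implicit Types (G : sgraph point).

Lemma imset_symdiff n (g : 'I_n -> 'I_m) (X Y : {set 'I_n}) : injective g ->
  g @: (X :+: Y) = (g @: X) :+: (g @: Y).
Proof.
move=> ig; apply/setP=> e; rewrite in_symdiff.
have [/existsP[i /eqP->]|/existsPn h] := boolP [exists i, e == g i].
  by rewrite !mem_imset // in_symdiff.
have no (Z : {set 'I_n}) : e \in g @: Z = false.
  by apply/imsetP=> -[i _ ei]; have /eqP := h i.
by rewrite !no.
Qed.

(** The standard embedding of SK_n in Q_n by singletons and pairs, for which adjacency is distance
    1. *)
Definition SK_set n (t : 'I_n + {set 'I_n}) : {set 'I_n} :=
  match t with inl i => [set i] | inr e => e end.

Lemma SK_adj_dist n (a b : 'I_n + {set 'I_n}) : a \in SK_vset n -> b \in SK_vset n ->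
  SK_adj a b = (#|SK_set a :+: SK_set b| == 1).
Proof.
have mixed i (f : {set 'I_n}) : #|f| == 2 -> (i \in f) = (#|[set i] :+: f| == 1).
  move=> /eqP f2; have := card_symdiff [set i] f; rewrite cards1 f2.
  have [jf|jf] := boolP (i \in f).
    rewrite (setIidPl _) ?sub1set // cards1.
    by move: #|_ :+: _| => k h; apply/esym/eqP; lia.
  have -> : [set i] :&: f = set0.
    by apply/setP=> l; rewrite !inE; case: eqP => // ->; exact: negbTE.
  by rewrite cards0; move: #|_ :+: _| => k h; apply/esym/eqP; lia.
rewrite !inE; case: a b => [i|e] [j|f] /= ha hb.
- have := card_symdiff [set i] [set j]; rewrite !cards1.
  by move: #|_ :+: _| => k h; apply/esym/eqP; lia.
- by rewrite hb /=; exact: mixed.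
- by rewrite ha /= symdiffC; exact: mixed.
have := card_symdiff e f; rewrite (eqP ha) (eqP hb).
by move: #|_ :+: _| => k h; apply/esym/eqP; lia.
Qed.

Lemma star_full_subdivision G (y A : point) : cubical G -> star (vset G) y A ->
  full_subdivision G (starset y A).
Proof.
move=> cG st; exists #|A|.
pose g := @enum_val _ (mem A); have ig : injective g by exact: enum_val_inj.
have gA (X : {set 'I_#|A|}) : g @: X \subset A.
  by apply/subsetP=> e /imsetP[i _ ->]; exact: enum_valP.
pose f t := y :+: (g @: SK_set t).
have fS t : t \in vset (SK #|A|) -> f t \in starset y A.
  rewrite inE => ht; rewrite inE /f (symdiffC y) symdiffK gA card_imset //=.
  by case: t ht => [i _|e /eqP->] /=; rewrite ?cards1.
exists f; split; first exact: starset_sub.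
- move=> s t hs ht /(congr1 (fun X => y :+: X)); rewrite /f !symdiffKl => /(imset_inj ig).
  move: hs ht; rewrite !inE; case: s t => [i|e] [j|e'] /= hs ht.
  + by move/set1_inj->.
  + by move=> h; rewrite -h cards1 in ht.
  + by move=> h; rewrite h cards1 in hs.
  + by move->.
- apply/setP=> x; apply/imsetP/idP=> [[t ht ->]|xS]; first exact: fS.
  pose e := g @^-1: (x :+: y).
  have ge : g @: e = x :+: y.
    apply/setP=> j; apply/imsetP/idP=> [[i ie ->]|jx]; first by move: ie; rewrite [i \in e]in_set.
    have jA : j \in A by move: xS; rewrite inE => /andP[/subsetP + _]; apply.
    by exists (enum_rank_in jA j); rewrite ?[_ \in e]in_set /g enum_rankK_in.
  have ce : #|x :+: y| = #|e| by rewrite -ge card_imset.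
  move: xS; rewrite inE ce => /andP[_].
  case he: #|e| => [|[|[|]]] // _.
    have /eqP/cards1P[i ei] := he.
    by exists (inl i); rewrite ?inE // /f /= -ei ge symdiffC symdiffK.
  by exists (inr e); rewrite ?inE ?he // /f /= ge symdiffC symdiffK.
move=> s t hs ht; rewrite cG !(subsetP (starset_sub st) _ (fS _ _)) //= SK_adj_dist //.
rewrite cube_adjE /f (_ : y :+: _ :+: _ = g @: SK_set s :+: g @: SK_set t).
  by rewrite -imset_symdiff // card_imset.
by rewrite (symdiffC y) symdiffA symdiffK.
Qed.

End StarSubdivision.

(** * 1-extensions and the centres of maximal stars *)

Section OneExtension.
Variable m : nat.
Local Notation point := {set 'I_m}.
Implicit Types (G H : sgraph point) (x y z u v w A B X : point) (F S : {set point}).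

Lemma flip_inj i j (x : point) : flip i x = flip j x -> i = j.
Proof.
move=> h; have : flip i x :+: x = flip j x :+: x by rewrite h.
by rewrite !flip_rel => /set1_inj.
Qed.

Lemma common_nbr v (a b : 'I_m) w : a != b -> cube_adj w (flip a v) -> cube_adj w (flip b v) ->
  w = v \/ w = flip a (flip b v).
Proof.
move=> ab; rewrite cube_sym => /cube_adjP[c ->]; rewrite cube_sym => /cube_adjP[d].
have [->|ca] := eqVneq c a; first by left; rewrite flipK.
move=> h; right; rewrite flipC; have [->|cb] := eqVneq c b; first by rewrite flipC.
exfalso; have : flip c (flip a v) :+: v = flip d (flip b v) :+: v by rewrite h.
rewrite !flip2_rel => /setP hh; move: (hh a) (hh c); rewrite !in_flip !inE !eqxx.
rewrite (eq_sym a c) (negbTE ca) (negbTE ab) (negbTE cb) /= => /esym/eqP <-.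
by rewrite (negbTE ca).
Qed.

(** First, [v] is not in [S]: an original vertex is adjacent to no original one, and a subdividing
    vertex to only two. Two original vertices have just one common neighbour besides [v], which must
    therefore be the vertex subdividing their edge. Convexity keeps [v] out of [G], as well as the
    vertices at distance 3 in these directions. *)
Lemma SK_star G S v n (f : 'I_n + {set 'I_n} -> point) :
  cubical G -> iso (vset G) -> convex G S -> full_subdivision_by G S f -> 4 <= n ->
  (forall i, cube_adj v (f (inl i))) ->
  exists A, [/\ 3 < #|A|, star (vset G) v A & S = starset v A].
Proof.
move=> cG iG /(convexP _ cG iG)[sS conv] [_ finj fS fadj] n4 vadj.
have [d dE] : exists d : {ffun 'I_n -> 'I_m}, forall i, f (inl i) = flip (d i) v.
  have := fin_all_exists (fun i => elimT (cube_adjP v (f (inl i))) (vadj i)).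
  by case=> d hd; exists [ffun i => d i] => i; rewrite ffunE.
have inSK i : inl i \in vset (SK n) by rewrite inE.
have dinj : injective d.
  move=> i j dij; have : f (inl i) = f (inl j) by rewrite !dE dij.
  by move/(finj _ _ (inSK i) (inSK j)) => -[].
have fSin t : t \in vset (SK n) -> f t \in S by move=> ht; rewrite -fS imset_f.
have card2 (i j : 'I_n) : i != j -> #|[set i; j]| == 2 by move=> ij; rewrite cards2 ij.
have adjS s t : s \in vset (SK n) -> t \in vset (SK n) -> cube_adj (f s) (f t) = SK_adj s t.
  move=> hs ht; rewrite -[RHS]/(adj (SK n) s t) -fadj // cG.
  by rewrite !(subsetP sS _ (fSin _ _)).
pose A := [set d i | i : 'I_n].
have cA : #|A| = n by rewrite card_imset // card_ord.
have [i0 [i1 i01]] : exists i0 i1 : 'I_n, i0 != i1.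
  by exists (Ordinal (leq_trans (isT : 0 < 4) n4)), (Ordinal (leq_trans (isT : 1 < 4) n4)).
have fF t : t \in vset (SK n) -> f t \in vset G by move/fSin/(subsetP sS).
have dF i : flip (d i) v \in vset G by rewrite -dE fF.
have vS : v \notin S.
  rewrite -fS; apply/imsetP=> -[t ht vt].
  case: t ht vt => [j|e] he vt.
    by move: (vadj i0); rewrite vt adjS.
  have allin : [set: 'I_n] \subset e.
    apply/subsetP=> i _; have := vadj i; rewrite vt adjS //= => /andP[] //.
  have := subset_leq_card allin; rewrite cardsT card_ord.
  by move: he; rewrite inE => /eqP->; lia.
have vF : v \notin vset G.
  apply: contra vS => vG; apply: (conv _ _ (fSin _ (inSK i0)) (fSin _ (inSK i1))) => //.
  apply/betweenP=> e; rewrite !dE !in_flip.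
  have [->|_] := eqVneq e (d i0); last by rewrite addbF.
  by rewrite (inj_eq dinj) (negbTE i01); case: (_ \in v).
have f2 i j : i != j -> f (inr [set i; j]) = flip (d i) (flip (d j) v).
  move=> ij; have hij : inr [set i; j] \in vset (SK n) by rewrite inE card2.
  have dij : d i != d j by rewrite (inj_eq dinj).
  have [] := @common_nbr v (d i) (d j) (f (inr [set i; j])) dij; rewrite -?dE ?adjS //=.
  - by rewrite card2 // !inE eqxx.
  - by rewrite card2 // !inE eqxx orbT.
  - by move=> h; case/negP: vS; rewrite -h fSin.
have SE : S = starset v A.
  apply/setP=> x; apply/idP/idP.
    rewrite -fS => /imsetP[[i|e] ht ->]; first by rewrite dE starset1 imset_f.
    move: (ht); rewrite inE => /cards2P[i [j [ij eE]]]; rewrite eE f2 //.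
    by apply: starset2; rewrite ?imset_f // (inj_eq dinj).
  case/starsetP=> [[_ /imsetP[i _ ->] ->]|[_ [_ [/imsetP[i _ ->] /imsetP[j _ ->] ij ->]]]].
    by rewrite -dE fSin.
  have {}ij : i != j by apply: contraNneq ij => ->.
  by rewrite -f2 // fSin // inE card2.
exists A; rewrite cA; split=> //; split=> //.
- by move=> _ /imsetP[i _ ->].
- move=> _ _ /imsetP[i _ ->] /imsetP[j _ ->] ij.
  have {}ij : i != j by apply: contraNneq ij => ->.
  by rewrite -f2 // fF // inE card2.
move=> a b c aA bA cA' abc; apply/negP=> zG.
move: (abc); rewrite /= !inE negb_or andbT => /andP[/andP[ab ac] bc].
have h1 : flip a (flip b v) \in S by rewrite SE starset2.
have h2 : flip b (flip c v) \in S by rewrite SE starset2.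
have : flip a (flip b (flip c v)) \in S.
  apply: (conv _ _ h1 h2) => //; apply/betweenP=> e; rewrite !in_flip.
  have [->|ea] := eqVneq e a; first by rewrite (negbTE ab) (negbTE ac); case: (a \in v).
  have [->|eb] := eqVneq e b; first by rewrite (negbTE bc); case: (b \in v).
  by have [->|ec] := eqVneq e c; rewrite ?addbF //; case: (c \in v).
rewrite SE inE => /and3P[_ _].
rewrite flip_symdiffl flip2_rel !card_flip_out ?cards1 // ?in_flip ?inE ?(negbTE bc) //.
by rewrite (negbTE ac) (negbTE ab).
Qed.

(** Among the vertices agreeing with [v] on [A], one nearest to [v] gives a set [O] that is minimal
    as [corner_star] requires, and the larger star contradicts [max]. *)
Lemma star_hits F v A : iso F -> vc2 F -> 2 < #|A| -> star F v A ->
  (forall o, o \notin A -> ~ star F v (o |: A)) ->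
  {in F, forall x, exists2 e, e \in A & e \in x :+: v}.
Proof.
move=> iF vF cA st max x xF.
have [/existsP[e /andP[eA ex]]|/existsPn hx] := boolP [exists e, (e \in A) && (e \in x :+: v)].
  by exists e.
exfalso; pose P z := (z \in F) && [disjoint A & z :+: v].
have Px : P x.
  rewrite /P xF -setI_eq0; apply/eqP/setP=> e; rewrite in_setI in_set0.
  exact/negbTE/hx.
have [z /andP[zF Az] minz] := arg_minnP (fun z => #|z :+: v|) Px.
pose O := z :+: v; have vO : v :+: O = z by rewrite /O (symdiffC z v) symdiffKl.
have [vF' st1 st2 _] := st.
have [||O' sO neO|o OE so] := corner_star iF vF cA st1 st2 Az _ _ _ st.
- by apply: contraNneq vF' => /eqP; rewrite symdiff_eq0 => /eqP <-.
- by rewrite vO.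
- apply/negP=> zF'; have := minz (v :+: O').
  rewrite /P zF' (symdiffC v) symdiffK (disjointWr sO Az) => /(_ isT).
  by rewrite leqNgt proper_card // properEneq neO.
apply: max so; apply: contraL (Az) => oA; rewrite -setI_eq0; apply/set0Pn; exists o.
by rewrite in_setI oA OE set11.
Qed.

Lemma one_extension_step G G' : partial_cube G -> vc2 (vset G) -> one_extension G G' ->
  [/\ partial_cube G', vc2 (vset G'), subgraph G G' & #|vset G| < #|vset G'|].
Proof.
move=> pG vG [n [f [S [v [n4 [convS subS] max vadj [vE aE]]]]]].
have [G0 cG iG] := (iffLR (partial_cubeP G) pG).
have [A [cA st SE]] := SK_star cG iG convS subS n4 vadj.
have [vF st1 st2 _] := st.
have hits : {in vset G, forall x, exists2 e, e \in A & e \in x :+: v}.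
  apply: star_hits => //; first exact: ltnW.
  move=> o oA so; have eS : starset v (o |: A) = S.
    apply: max; [exact: star_convex | exact: star_full_subdivision |].
    rewrite SE; apply/subsetP=> x; rewrite !in_set => /andP[xA ->]; rewrite andbT.
    exact: subset_trans xA (subsetUr _ _).
  have := starset1 v (o |: A) o; rewrite eS SE starset1 (negbTE oA).
  by rewrite inE set11.
have cG' : cubical G'.
  move=> x y; rewrite aE cG vE !inE; have [->|xv] := eqVneq x v.
    have [->|yv] := eqVneq y v; rewrite ?(negbTE vF) ?cube_irr ?andbF //= ?orbF.
    by [].
  have [->|yv] := eqVneq y v; rewrite ?(negbTE vF) ?andbF //= ?orbF //.
have iG' : iso (vset G').
  apply: iso_weak; rewrite vE => x y /setU1P[->|xG] /setU1P[->|yG] xy.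
  - by rewrite eqxx in xy.
  - have [e eA ey] := hits y yG; exists e; first by rewrite symdiffC.
    by rewrite in_setU1 st1 // orbT.
  - have [e eA ex] := hits x xG; exists e => //.
    by rewrite [flip e v \in _]in_setU1 st1 // !orbT.
  - by have [e exy eG] := iG x y xG yG xy; exists e; rewrite // in_setU1 eG orbT.
split.
- apply/partial_cubeP; split=> //; rewrite vE; apply/set0Pn; exists v; exact: setU11.
- move=> a b c abc sh; apply: (vG a b c abc) => p q r.
  have [x + hx] := sh p q r; rewrite vE => /setU1P[xv|]; last by exists x.
  (* On [a], [b], [c] the new vertex has the pattern of its neighbour in a fourth direction of [A],
     an old vertex. *)
  have [i iA] : exists2 i, i \in A & i \notin [:: a; b; c] by exact: exists_notin.
  rewrite !inE !negb_or => /and3P[ia ib ic]; exists (flip i v); first exact: st1.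
  by rewrite !in_flip !(eq_sym _ i) (negbTE ia) (negbTE ib) (negbTE ic) !addbF -xv.
- by split=> [|x y]; rewrite ?vE ?subsetUr // aE => ->.
by rewrite vE cardsU1 vF.
Qed.

Lemma canonical_exists G : partial_cube G -> vc2 (vset G) ->
  exists G1, canonical_one_completion G G1.
Proof.
have [n] := ubnP #|~: vset G|; elim: n G => // n IH G.
rewrite ltnS => hn pG vG.
have [[G' e]|h] := classic (exists G', one_extension G G'); last first.
  by exists G; split=> //; exact: rt_refl.
have [pG' vG' _ lt] := one_extension_step pG vG e.
have [|G1 [r1 m1]] := IH G' _ pG' vG'.
  have := cardsC (vset G); have := cardsC (vset G'); lia.
by exists G1; split=> //; apply: rt_trans r1; exact: rt_step.
Qed.

Lemma one_extensions_step G G1 : partial_cube G -> vc2 (vset G) ->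
  clos_refl_trans _ (@one_extension m) G G1 ->
  [/\ partial_cube G1, vc2 (vset G1) & subgraph G G1].
Proof.
move=> pG vG /(clos_rt_rt1n _ _ _ _) r; elim: r pG vG => {G G1} [G|G G' G1 e _ IH] pG vG.
  by split=> //; split.
have [pG' vG' [s1 s2] _] := one_extension_step pG vG e.
have [p1 v1 [t1 t2]] := IH pG' vG'.
by split=> //; split=> [|x y /s2/t2 //]; exact: subset_trans t1.
Qed.

(** The subdivision of the star need not be inclusion-maximal. The induction climbs to a maximal
    one, and the point is that [y] is still adjacent to all of its original vertices, so that a
    1-extension is possible. *)
Lemma no_star_of_complete G : partial_cube G -> vc2 (vset G) ->
  ~ (exists G', one_extension G G') -> forall y A, 3 < #|A| -> ~ star (vset G) y A.
Proof.
move=> pG vG no y A cA st; have [_ cG iG] := iffLR (partial_cubeP G) pG.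
have [yF st1 st2 _] := st.
suff max n S : #|~: S| < n -> starset y A \subset S -> convex G S -> full_subdivision G S -> False.
  apply: (max _ (starset y A) (ltnSn _)) => //; [exact: star_convex | exact: star_full_subdivision].
elim: n S => // n IH S; rewrite ltnS => hn AS cS [k [f fS]].
have maxS : forall S', convex G S' -> full_subdivision G S' -> S \subset S' -> S' = S.
  move=> S' cS' fS' SS'; apply/eqP; rewrite eq_sym; apply: contraT => ne; exfalso.
  apply: (IH S') => //; last exact: subset_trans SS'.
  apply: leq_trans hn; apply: proper_card; rewrite properEneq setCS SS' andbT.
  by apply: contra ne => /eqP/(congr1 (@setC _)); rewrite !setCK => ->.
have [sS finj fE fadj] := fS.
have adjS s t : s \in vset (SK k) -> t \in vset (SK k) -> cube_adj (f s) (f t) = SK_adj s t.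
  move=> hs ht; rewrite -[RHS]/(adj (SK k) s t) -fadj // cG.
  by rewrite !(subsetP sS) // -fE imset_f.
(* A vertex [flip a y] has at least three neighbours in [S], hence it does not subdivide an edge. *)
have orig a : a \in A -> exists i, f (inl i) = flip a y.
  move=> aA; have : flip a y \in S by rewrite (subsetP AS) // starset1.
  rewrite -fE => /imsetP[[i|e] he fa]; first by exists i.
  exfalso; have nb b : b \in A :\ a -> exists i, i \in e /\ f (inl i) = flip b (flip a y).
    rewrite !inE => /andP[ba bA].
    have : flip b (flip a y) \in S by rewrite (subsetP AS) // starset2.
    rewrite -fE => /imsetP[t ht ft]; have := adjS _ _ he ht.
    rewrite -fa -ft cube_adj_flip; case: t ht ft => [i|e'] // _ -> /esym /= /andP[_ ie].
    by exists i.
  have [g gE] : exists g : 'I_m -> 'I_k, {in A :\ a, forall b, g b \in e /\ f (inl (g b)) = flip b (flip a y)}.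
    have [i0 _] : exists i, i \in e.
      by move: he; rewrite inE => /eqP he; apply/set0Pn; rewrite -card_gt0 he.
    have hg b : exists i, b \in A :\ a -> i \in e /\ f (inl i) = flip b (flip a y).
      have [hb|hb] := boolP (b \in A :\ a); last by exists i0.
      by have [i hi] := nb b hb; exists i.
    by have [g hg'] := fin_all_exists hg; exists g.
  have ginj : {in A :\ a &, injective g}.
    by move=> b c hb hc gbc; apply: (@flip_inj _ _ (flip a y)); rewrite -(gE b hb).2 -(gE c hc).2 gbc.
  have : g @: (A :\ a) \subset e.
    by apply/subsetP=> _ /imsetP[b hb ->]; exact: (gE b hb).1.
  move/subset_leq_card; rewrite card_in_imset //.
  by move: he; rewrite inE => /eqP->; move=> h; move: cA; rewrite (cardsD1 a A) aA add1n ltnS ltnNge h.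
have k4 : 4 <= k.
  have [a0 a0A _] : exists2 r, r \in A & r \notin [::] by apply: exists_notin; apply: leq_trans cA.
  have [i0 _] := orig a0 a0A.
  have hg b : exists i, b \in A -> f (inl i) = flip b y.
    have [hb|hb] := boolP (b \in A); last by exists i0.
    by have [i hi] := orig b hb; exists i.
  have [g hg'] := fin_all_exists hg.
  have ginj : {in A &, injective g}.
    by move=> b c hb hc gbc; apply: (@flip_inj _ _ y); rewrite -hg' // -hg' // gbc.
  by apply: leq_trans cA _; rewrite -(card_in_imset ginj) -[k in _ <= k]card_ord max_card.
have vadj i : cube_adj y (f (inl i)).
  have d2 a : a \in A -> f (inl i) != flip a y -> #|f (inl i) :+: y :+: [set a]| = 2.
    move=> aA ne; have [j fj] := orig a aA.
    have ij : i != j by apply: contraNneq ne => ->; rewrite fj.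
    have c2 : #|[set i; j]| == 2 by rewrite cards2 ij.
    have hij : inr [set i; j] \in vset (SK k) by rewrite inE.
    have : cube_adj (f (inl i)) (f (inr [set i; j])) by rewrite adjS ?inE //= c2 !inE eqxx.
    case/cube_adjP=> c fc.
    have : cube_adj (f (inr [set i; j])) (f (inl j)) by rewrite adjS ?inE //= c2 !inE eqxx orbT.
    case/cube_adjP=> d; rewrite fc fj => ay.
    have -> : f (inl i) :+: y :+: [set a] = f (inl i) :+: flip a y by rewrite flip_symdiffr flipE.
    rewrite ay !flip_symdiffr symdiffv card_flip_out; first by rewrite card_flip_out ?cards0 // inE.
    rewrite in_flip inE /=; apply/negP=> /eqP dc.
    by case/negP: ne; rewrite ay dc flipK.
  have [/existsP[a /andP[aA /eqP->]]|/existsPn hno] := boolP [exists a, (a \in A) && (f (inl i) == flip a y)].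
    exact: cube_adj_flip.
  have {}d2 a : a \in A -> #|f (inl i) :+: y :+: [set a]| = 2.
    by move=> aA; apply: d2 => //; have := hno a; rewrite aA.
  (* Now [flip a X] has size 2 for all [a] in [A]. If [A] were inside [X], then [#|X|] would be 3,
     less than [#|A|]; so some [a] is outside, and [#|X|] is 1. *)
  set X := f (inl i) :+: y in d2.
  have [a aA aX] : exists2 a, a \in A & a \notin X.
    apply/subsetPn/negP=> /[dup] sub /subset_leq_card cX.
    have /set0Pn[a aA] : A != set0 by rewrite -card_gt0; apply: leq_trans cA.
    have := d2 a aA; rewrite -flipE => h; have := card_flip_in (subsetP sub _ aA).
    by rewrite h => h'; rewrite h' in cX; have := leq_trans cA cX.
  have := d2 a aA; rewrite -flipE card_flip_out // => -[X1].
  by rewrite cube_adjE symdiffC -/X X1.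
apply: no; exists (induced (y |: vset G)), k, f, S, y; split=> //; split=> // x z.
rewrite cG /= !in_setU1.
have [->|xv] := eqVneq x y.
  by have [->|yv] := eqVneq z y; rewrite ?(negbTE yF) ?cube_irr ?andbF //= ?orbF.
by have [->|yv] := eqVneq z y; rewrite ?(negbTE yF) ?andbF //= ?orbF.
Qed.

End OneExtension.

(** * Isometric cycles in standard coordinates *)

Lemma next_nth_mod (T : eqType) (x0 : T) (c : seq T) i : uniq c -> i < size c ->
  next c (nth x0 c i) = nth x0 c (i.+1 %% size c).
Proof.
move=> uc hi; case: c uc hi => // y c uc hi.
rewrite next_nth mem_nth // index_uniq //.
have [hi'|hi'] := ltnP i.+1 (size (y :: c)).
  by rewrite modn_small //= (set_nth_default x0).
have -> : i.+1 = size (y :: c) by apply/eqP; rewrite eqn_leq hi hi'.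
have ic : i = size c by move: hi hi' => /=; lia.
by rewrite modnn /= nth_default // ic.
Qed.

Section StandardCycle.
Variable m : nat.
Local Notation point := {set 'I_m}.
Implicit Types (x y z u v w : point) (F S : {set point}) (e f : 'I_m) (es : seq 'I_m).
Implicit Types (G H : sgraph point).

Lemma in_post es n e : uniq es -> (e \in post es n) = (e \in es) && (n <= index e es).
Proof.
move=> ues; rewrite in_setlist; have [ees|ees] := boolP (e \in es); last first.
  by apply: contraNF ees; exact: mem_drop.
have : (e \in take n es) + (e \in drop n es) = 1.
  have := count_uniq_mem e ues; rewrite ees -{1}(cat_take_drop n es) count_cat.
  by rewrite !count_uniq_mem ?take_uniq ?drop_uniq.
have -> : (e \in take n es) = (index e es < n) by rewrite in_take.
by rewrite /= [n <= _]leqNgt; case: (index e es < n); case: (e \in drop n es).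
Qed.

Lemma mem_pre es n e : (e \in pre es n) = (e \in es) && (index e es < n).
Proof.
rewrite in_setlist; have [ees|ees] := boolP (e \in es); first by rewrite in_take.
by apply: contraNF ees; exact: mem_take.
Qed.

Lemma postE es n : uniq es -> post es n = pre es n :+: [set e in es].
Proof.
move=> ues; apply/setP=> e; rewrite in_symdiff in_post // mem_pre in_setlist.
by case: (e \in es); rewrite ?addbT //= [n <= _]leqNgt.
Qed.

Lemma card_es es : uniq es -> #|[set e in es]| = size es.
Proof. by move=> ues; rewrite cardsE (card_uniqP ues). Qed.

(** Subtraction being truncated, [(a - b) + (b - a)] is the absolute difference. *)
Lemma pre_dist es a b : uniq es -> a <= size es -> b <= size es ->
  #|pre es a :+: pre es b| = (a - b) + (b - a).
Proof.
wlog ab : a b / a <= b.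
  move=> h ues ha hb; have [ab|/ltnW ab] := leqP a b; first exact: h.
  by rewrite symdiffC addnC; exact: h.
move=> ues ha hb; have := card_symdiff (pre es a) (pre es b).
rewrite (setIidPl _); last first.
  by apply/subsetP=> e; rewrite !mem_pre => /andP[-> /leq_trans]; apply.
by rewrite !card_pre //; move: #|_ :+: _| => d; lia.
Qed.

Lemma pre_sub es n : pre es n \subset [set e in es].
Proof. by apply/subsetP=> e; rewrite mem_pre in_setlist => /andP[]. Qed.

Lemma pre_post_dist es a b : uniq es -> a <= size es -> b <= size es ->
  #|pre es a :+: post es b| + ((a - b) + (b - a)) = size es.
Proof.
move=> ues ha hb; rewrite postE // symdiffA.
have := card_symdiff (pre es a :+: pre es b) [set e in es].
rewrite (setIidPl _); last first.
  apply/subsetP=> e; rewrite in_symdiff.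
  by have := subsetP (pre_sub es a) e; have := subsetP (pre_sub es b) e;
    case: (e \in pre es a) => [_ /(_ isT) //|]; case: (e \in pre es b) => // /(_ isT).
by rewrite pre_dist // card_es //; move: #|_ :+: _| => d; lia.
Qed.

(* In an isometric 2k-cycle antipodal edges are parallel, so the cycle is determined by a
   vertex u and the directions es of its next k edges. *)
Definition stdcyc u es : seq point :=
  [seq u :+: pre es i | i <- iota 0 (size es)] ++ [seq u :+: post es i | i <- iota 0 (size es)].

Definition cyc u es i : point :=
  if i < size es then u :+: pre es i else u :+: post es (i - size es).

Lemma size_stdcyc u es : size (stdcyc u es) = (size es).*2.
Proof. by rewrite size_cat !size_map !size_iota addnn. Qed.

Lemma nth_stdcyc x0 u es i : i < (size es).*2 -> nth x0 (stdcyc u es) i = cyc u es i.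
Proof.
move=> hi; rewrite nth_cat size_map size_iota /cyc; case: ltnP => h.
  by rewrite (nth_map 0) ?size_iota // nth_iota.
have hi' : i - size es < size es by lia.
by rewrite (nth_map 0) ?size_iota // nth_iota.
Qed.

Lemma cyc_dist u es i j : uniq es -> i < (size es).*2 -> j < (size es).*2 ->
  #|cyc u es i :+: cyc u es j| =
    minn ((i - j) + (j - i)) ((size es).*2 - ((i - j) + (j - i))).
Proof.
move=> ues hi hj; rewrite /cyc.
have cancel (x y : point) : u :+: x :+: (u :+: y) = x :+: y.
  by rewrite (symdiffC u x) symdiffA symdiffK.
have [hik|hik] := ltnP i (size es); have [hjk|hjk] := ltnP j (size es); rewrite cancel.
- by rewrite pre_dist ?(ltnW hik) ?(ltnW hjk) //; lia.
- have := @pre_post_dist es i (j - size es) ues (ltnW hik) ltac:(lia).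
  by move: #|_ :+: _| => d; lia.
- have := @pre_post_dist es j (i - size es) ues (ltnW hjk) ltac:(lia).
  by rewrite symdiffC; move: #|_ :+: _| => d; lia.
have -> : post es (i - size es) :+: post es (j - size es) =
    pre es (i - size es) :+: pre es (j - size es).
  by rewrite !postE //; apply/setP=> e; rewrite !in_symdiff; case: (e \in [set e in es]);
    rewrite ?addbT ?addbF ?addbN ?addNb ?negbK.
by rewrite pre_dist //; lia.
Qed.

Lemma cyc_adj u es i j : uniq es -> 1 < size es -> i < (size es).*2 -> j < (size es).*2 ->
  cube_adj (cyc u es i) (cyc u es j) =
    (i.+1 %% (size es).*2 == j) || (j.+1 %% (size es).*2 == i).
Proof.
move=> ues h1 hi hj; rewrite cube_adjE cyc_dist //.
have modS a : a < (size es).*2 ->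
    a.+1 %% (size es).*2 = if a.+1 == (size es).*2 then 0 else a.+1.
  move=> ha; case: eqP => [->|?]; first by rewrite modnn.
  by rewrite modn_small //; lia.
rewrite !modS //; do 2!case: ifP; lia.
Qed.

Lemma uniq_stdcyc u es : uniq es -> uniq (stdcyc u es).
Proof.
move=> ues; apply/(uniqP set0) => i j; rewrite !inE !size_stdcyc => hi hj.
rewrite !nth_stdcyc // => h; have := cyc_dist u ues hi hj.
by rewrite h symdiffv cards0; lia.
Qed.

Lemma mem_stdcyc u es x : x \in stdcyc u es ->
  exists2 i, i < size es & x = u :+: pre es i \/ x = u :+: post es i.
Proof.
by rewrite mem_cat => /orP[] /mapP[i]; rewrite mem_iota => /= hi ->; exists i => //;
  [left|right].
Qed.

Lemma pre_stdcyc u es i : i < size es -> u :+: pre es i \in stdcyc u es.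
Proof. by move=> hi; rewrite mem_cat; apply/orP; left; apply/mapP; exists i; rewrite ?mem_iota. Qed.

Lemma post_stdcyc u es i : i < size es -> u :+: post es i \in stdcyc u es.
Proof. by move=> hi; rewrite mem_cat; apply/orP; right; apply/mapP; exists i; rewrite ?mem_iota. Qed.

(* The last condition is gatedness: the gate of x in the subcube spanned by the cycle is
   a vertex of the cycle. *)
Definition goodcycle F u es : Prop :=
  [/\ uniq es, {subset stdcyc u es <= F} &
      {in F, forall x, exists2 i, i < size es &
        (x :+: u) :&: [set e in es] = pre es i \/ (x :+: u) :&: [set e in es] = post es i}].

Lemma good_gated G u es : cubical G -> iso (vset G) -> goodcycle (vset G) u es ->
  1 < size es -> gated_cycle G (stdcyc u es).
Proof.
move=> cG iG [ues sub proj] h1; split.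
  split; rewrite ?uniq_stdcyc ?size_stdcyc //; first lia.
  move=> x y xc yc; rewrite cG (sub _ xc) (sub _ yc) /=.
  have [/(nthP set0)[i hi <-] /(nthP set0)[j hj <-]] := (xc, yc).
  have c0 : 0 < size (stdcyc u es) by exact: leq_ltn_trans hi.
  rewrite !next_nth_mod ?uniq_stdcyc // !(nth_uniq set0) ?uniq_stdcyc ?ltn_mod //.
  by move: hi hj; rewrite size_stdcyc => hi hj; rewrite !nth_stdcyc // cyc_adj.
split; first by apply/subsetP=> x; rewrite inE => /sub.
move=> x xG; rewrite inE => xc.
pose x' := u :+: ((x :+: u) :&: [set e in es]).
have x'c : x' \in stdcyc u es.
  by have [i hi [h|h]] := proj x xG; rewrite /x' h; [exact: pre_stdcyc|exact: post_stdcyc].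
exists x'; first by rewrite inE.
move=> y; rewrite inE => yc; apply: geodesic_through => //; try exact: sub.
  apply/betweenP=> e xy; rewrite /x' in_symdiff in_setI in_symdiff in_setlist.
  have [ees|ees] := boolP (e \in es).
    by rewrite andbT; case: (e \in x); case: (e \in u).
  rewrite andbF addbF xy; have [i _ [->|->]] := mem_stdcyc yc; rewrite in_symdiff.
    by rewrite mem_pre (negbTE ees) addbF.
  by rewrite in_post // (negbTE ees) addbF.
by apply: contraNneq xc => ->.
Qed.

End StandardCycle.

(** Meant for the distances [d] from a fixed vertex along a cycle of length [n]. Without interior
    local minima, [d] keeps descending once it has started to. *)
Lemma unimodal (d : nat -> nat) n : 0 < n -> d 0 = 0 -> d n = 0 ->
  (forall j, j < n -> d j.+1 = (d j).+1 \/ d j = (d j.+1).+1) ->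
  (forall j, j.+1 < n -> d j.+2 < d j.+1 \/ d j < d j.+1) ->
  (exists k, n = k.*2) /\ forall j, j <= n -> d j = minn j (n - j).
Proof.
move=> n0 d0 dn step nomin.
have lip1 j : j <= n -> d j <= j.
  by elim: j => [|j IH] hj; [rewrite d0|have := IH (ltnW hj); have := step j hj; lia].
have lip2 i : i <= n -> d (n - i) <= i.
  elim: i => [|i IH] hi; first by rewrite subn0 dn.
  have := IH (ltnW hi); have := step (n - i.+1) ltac:(lia).
  have -> : (n - i.+1).+1 = n - i by lia.
  lia.
have desc i j : j + i < n -> d j = (d j.+1).+1 -> d (j + i) = (d (j + i).+1).+1.
  elim: i => [|i IH] hi hd; first by rewrite addn0.
  have := IH ltac:(lia) hd; have := nomin (j + i) ltac:(lia).
  have := step (j + i).+1 ltac:(lia); rewrite addnS; lia.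
have descn j : j < n -> d j = (d j.+1).+1 -> d j = n - j.
  move=> hj hd; have h i : j + i <= n -> d (j + i) + i = d j.
    elim: i => [|i IH] hi; first by rewrite !addn0.
    by have := IH ltac:(lia); have := @desc i j ltac:(lia) hd; rewrite !addnS; lia.
  by have := h (n - j) ltac:(lia); rewrite subnKC ?(ltnW hj) // dn.
have main j : j <= n -> d j = j \/ d j = n - j.
  elim: j => [|j IH] hj; first by left.
  have hl := lip2 (n - j.+1) ltac:(lia); rewrite subKn // in hl.
  have := IH (ltnW hj); have := step j hj; have := @descn j hj; lia.
have min j : j <= n -> d j = minn j (n - j).
  move=> hj; have := lip2 (n - j) ltac:(lia); rewrite subKn // => h.
  have := lip1 j hj; have := main j hj; lia.
split=> //; exists n./2.
have := odd_double_half n; case: (odd n) => h; last by rewrite -{1}h add0n.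
have := min n./2 ltac:(lia); have := min n./2.+1 ltac:(lia).
by have := step n./2 ltac:(lia); lia.
Qed.

(** * Every gated cycle is a standard one *)

Section GatedCycles.
Variable m : nat.
Local Notation point := {set 'I_m}.
Implicit Types (x y z u v w : point) (F S : {set point}) (e f : 'I_m) (es : seq 'I_m).
Implicit Types (G H : sgraph point).

Lemma gatedP G S : cubical G -> iso (vset G) -> gated G S ->
  S \subset vset G /\ forall x, x \in vset G ->
    exists2 x', x' \in S & forall y, y \in S -> between x x' y.
Proof.
move=> cG iG [sS h]; split=> // x xG.
have [xS|xS] := boolP (x \in S); first by exists x => // y _; exact: betweenxx.
have [x' x'S hx'] := h x xG xS; exists x' => // y yS.
have [p sp x'p] := hx' y yS.
by have [_] := shortest_path_mem cG iG (subsetP sS _ yS) sp x'p.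
Qed.

(** In each coordinate [z] agrees with [x] or with [y], and its gate, being between [z] and both,
    then agrees with [z]. *)
Lemma gated_convex G S : cubical G -> iso (vset G) -> gated G S ->
  {in S &, forall x y z, z \in vset G -> between x z y -> z \in S}.
Proof.
move=> cG iG /(gatedP cG iG)[sS h] x y xS yS z zG /betweenP b.
have [z' z'S hz] := h z zG; suff -> : z = z' by [].
have /betweenP bx := hz x xS; have /betweenP by' := hz y yS.
apply/setP=> e; move: (b e) (bx e) (by' e).
case: (e \in x); case: (e \in y); case: (e \in z); case: (e \in z') => //=.
all: try by move=> h1 h2 h3; move: (h1 erefl).
all: try by move=> h1 h2 h3; move: (h2 erefl).
all: try by move=> h1 h2 h3; move: (h3 erefl).
Qed.

(** By convexity, the first step of a geodesic between vertices of the cycle follows the cycle.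
    Distances along the cycle thus have no interior local minimum, and [unimodal] makes the cycle
    even and isometric. *)
Lemma gated_cycle_std G c : cubical G -> iso (vset G) -> gated_cycle G c ->
  exists u es, c = stdcyc u es /\ goodcycle (vset G) u es.
Proof.
move=> cG iG [[c3 uc subc adjc] gc].
have conv := gated_convex cG iG gc.
have [_ gates] := gatedP cG iG gc.
set n := size c in c3 *; have n0 : 0 < n by exact: ltn_trans c3.
pose p i := nth set0 c (i %% n).
have pc i : p i \in c by rewrite mem_nth // ltn_mod.
have pG i : p i \in vset G by exact: subc.
have pn i : p (i + n) = p i by rewrite /p modnDr.
have nextp i : next c (p i) = p i.+1.
  by rewrite /p next_nth_mod // ?ltn_mod // -/n -addn1 modnDml addn1.
have padj i : cube_adj (p i) (p i.+1).
  have := adjc _ _ (pc i) (pc i.+1); rewrite nextp eqxx /= cG => /and3P[] //.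
have peq i j : p i = p j -> i = j %[mod n].
  by move/eqP; rewrite /p nth_uniq // ?ltn_mod // => /eqP.
have memp x : x \in c -> exists t, x = p t.
  by case/(nthP set0) => t ht <-; exists t; rewrite /p modn_small.
have nomin i s : p i.+1 != p s ->
    #|p s :+: p i.+2| < #|p s :+: p i.+1| \/ #|p s :+: p i| < #|p s :+: p i.+1|.
  move=> ne; have [e he eG] := iG _ _ (pG i.+1) (pG s) ne.
  have lt : #|p s :+: flip e (p i.+1)| < #|p s :+: p i.+1|.
    by rewrite [X in _ < X](card_flip_in (j := e)) ?flip_symdiffr // symdiffC.
  have ec : flip e (p i.+1) \in c.
    have := conv (p i.+1) (p s); rewrite !inE => /(_ (pc _) (pc _) _ eG).
    rewrite inE; apply; rewrite /between flip_symdiffr symdiffv; apply/subsetP=> f.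
    by rewrite in_flip inE => /eqP->.
  have [t et] := memp _ ec.
  have := adjc _ _ (pc i.+1) ec; rewrite cG pG eG cube_adj_flip et !nextp /=.
  move/esym/orP=> [/eqP h|/eqP h].
    by left; rewrite h -et.
  right; suff <- : p t = p i by rewrite -et.
  have /eqP := peq _ _ h; rewrite -addn1 -(addn1 i) eqn_modDr => /eqP hm.
  by rewrite /p hm.
have uni s : (exists k, n = k.*2) /\ forall j, j <= n -> #|p s :+: p (s + j)| = minn j (n - j).
  apply: (@unimodal (fun j => #|p s :+: p (s + j)|)) => //.
  - by rewrite addn0 symdiffv cards0.
  - by rewrite pn symdiffv cards0.
  - move=> j hj; rewrite addnS; have /cube_adjP[e ->] := padj (s + j).
    rewrite flip_symdiffr; have [h|h] := boolP (e \in p s :+: p (s + j)).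
      by right; exact: card_flip_in.
    by left; exact: card_flip_out.
  move=> j hj; rewrite !addnS; apply: nomin; apply/eqP=> /peq.
  rewrite -addnS -[in RHS](addn0 s) => /eqP; rewrite eqn_modDl mod0n modn_small //.
have [[k nk] _] := uni 0.
have dist s j : j <= n -> #|p s :+: p (s + j)| = minn j (n - j) by apply: (uni s).2.
have [e0 _] := cube_adjP _ _ (padj 0).
(* The default [e0] is never returned: consecutive vertices always differ in one direction. *)
pose dr i := odflt e0 [pick e | p i.+1 == flip e (p i)].
have drE i : p i.+1 = flip (dr i) (p i).
  rewrite /dr; case: pickP => [e /eqP //|h].
  by have /cube_adjP[e he] := padj i; have := h e; rewrite he eqxx.
have drn i : dr (i + n) = dr i by rewrite /dr -addSn !pn.
have walk s j : j <= k -> uniq [seq dr i | i <- iota s j] /\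
    p (s + j) = p s :+: [set e in [seq dr i | i <- iota s j]].
  elim: j => [|j IH] hj.
    split=> //; rewrite addn0 (_ : [set e in [seq dr i | i <- iota s 0]] = set0 :> point) ?symdiff0 //; apply/setP=> e; rewrite in_setlist in_set0.
  have [u1 p1] := IH (ltnW hj).
  have new : dr (s + j) \notin [seq dr i | i <- iota s j].
    have := dist s j.+1 ltac:(lia); have := dist s j ltac:(lia).
    rewrite addnS drE flip_symdiffr p1 symdiffKl => h1 h2.
    rewrite -in_setlist; apply/negP=> /card_flip_in; rewrite h1 h2; lia.
  rewrite -addn1 iotaD map_cat cat_uniq u1 /= orbF new; split=> //.
  rewrite addn1 addnS drE p1 -flip_symdiffr; congr (_ :+: _).
  apply/setP=> e; rewrite in_flip !in_setlist mem_cat inE.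
  by have [->|_] := eqVneq e (dr (s + j)); rewrite ?(negbTE new) ?addbF ?orbF.
(* Step [k.+1] from [p s] reduces the distance, so it repeats one of the [k] directions before it;
   any [k] consecutive directions being distinct, this is the oldest one. *)
have drk s : dr (s + k) = dr s.
  have k0 : 0 < k by lia.
  have [u1 p1] := walk s k (leqnn k); have [u2 p2] := walk s.+1 k (leqnn k).
  have inX : dr (s + k) \in [seq dr i | i <- iota s k].
    rewrite -in_setlist; have := dist s k.+1 ltac:(lia); have := dist s k ltac:(lia).
    rewrite addnS drE flip_symdiffr p1 symdiffKl => h1 h2.
    by apply: contraT => /card_flip_out; rewrite h1 h2; lia.
  have kE : k = k.-1 + 1 by rewrite addn1 prednK.
  have notX : dr (s + k) \notin [seq dr i | i <- iota s.+1 k.-1].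
    move: u2; rewrite {1}kE iotaD map_cat cat_uniq /= orbF => /and3P[_ + _].
    by rewrite addSnnS prednK.
  move: inX; rewrite -(prednK k0) /= inE prednK // => /orP[/eqP //|].
  by rewrite (negbTE notX).
pose es := [seq dr i | i <- iota 0 k].
have [ues p0k] := walk 0 k (leqnn k); rewrite -/es in ues p0k.
have ses : size es = k by rewrite size_map size_iota.
have takees i : i <= k -> take i es = [seq dr j | j <- iota 0 i].
  by move=> hi; rewrite -map_take take_iota (minn_idPl hi).
have preE i : i <= k -> p i = p 0 :+: pre es i.
  by move=> hi; have [_ /=] := walk 0 i hi; rewrite /pre takees.
have postE' i : i < k -> p (k + i) = p 0 :+: post es i.
  move=> hi; have [_ ->] := walk k i (ltnW hi).
  rewrite -[k]add0n p0k add0n postE // -symdiffA (symdiffC (pre es i)); congr (_ :+: (_ :+: _)).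
  rewrite /pre takees ?(ltnW hi) //; apply/setP=> e; rewrite !in_setlist; congr (_ \in _).
  rewrite -[k]addn0 iotaDl -map_comp; apply: eq_map => j /=; by rewrite addnC drk.
have cE : c = stdcyc (p 0) es.
  apply: (@eq_from_nth _ set0); first by rewrite size_stdcyc ses -nk.
  move=> i hi; have hi' : i < (size es).*2 by rewrite ses -nk.
  rewrite nth_stdcyc // /cyc ses; have -> : nth set0 c i = p i by rewrite /p modn_small.
  case: ltnP => h; first by rewrite preE // ltnW.
  by rewrite -postE' ?subnKC //; lia.
exists (p 0), es; split=> //; split=> //; first by rewrite -cE.
move=> x xG; have [x' + gx] := gates x xG; rewrite inE => x'c.
(* The gate [x'] lies between [x] and its own antipode [y]. It differs from [y] in every direction
   of the cycle, so [x] agrees with [x'] there. *)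
have opp (y z : point) : y \in c -> x' :+: y = [set e in es] -> z = x' :+: p 0 ->
    (x :+: p 0) :&: [set e in es] = z :&: [set e in es].
  move=> yc xy ->; have /betweenP b := gx y ltac:(by rewrite inE).
  apply/setP=> e; move: xy => /setP/(_ e).
  rewrite !in_setI in_setlist !in_symdiff; have [ees h|_ _] := boolP (e \in es); last by rewrite !andbF.
  by rewrite !andbT; move: (b e) h; case: (e \in x); case: (e \in x'); case: (e \in y);
    rewrite //= => /(_ erefl).
have subp i : pre es i :&: [set e in es] = pre es i by apply/setIidPl; exact: pre_sub.
have subq i : post es i :&: [set e in es] = post es i.
  by apply/setIidPl/subsetP=> e; rewrite in_post // in_setlist => /andP[].
have can (y z : point) : p 0 :+: y :+: (p 0 :+: z) = y :+: z.
  by rewrite (symdiffC (p 0) y) symdiffA symdiffK.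
move: (x'c); rewrite cE => /mem_stdcyc[i hi [x'E|x'E]]; exists i => //; [left|right].
  rewrite (opp (p 0 :+: post es i) (pre es i)) //.
  - by rewrite cE post_stdcyc.
  - by rewrite x'E can postE // symdiffKl.
  - by rewrite x'E (symdiffC (p 0)) symdiffK.
rewrite (opp (p 0 :+: pre es i) (post es i)) //.
- by rewrite cE pre_stdcyc.
- by rewrite x'E can postE // symdiffC symdiffKl.
- by rewrite x'E (symdiffC (p 0)) symdiffK.
Qed.

End GatedCycles.

Lemma infix2P (T : eqType) (x0 a b : T) (s : seq T) :
  reflect (exists2 i, i.+1 < size s & nth x0 s i = a /\ nth x0 s i.+1 = b)
          (infix [:: a; b] s).
Proof.
apply: (iffP (@infixP T [:: a; b] s)) => [[p [s' ->]]|[i hi [<- <-]]].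
  exists (size p); first by rewrite size_cat /=; lia.
  split; first by rewrite nth_cat ltnn subnn.
  by rewrite nth_cat ltnNge leqnSn subSnn.
exists (take i s), (drop i.+2 s).
by rewrite /= -drop_nth // -drop_nth ?cat_take_drop // ltnW.
Qed.

(** * One step of a cycle completion *)

Section CycleExtension.
Variable m : nat.
Local Notation point := {set 'I_m}.
Implicit Types (x y z v w A B : point) (e f a b : 'I_m).
Implicit Types (G H : sgraph point).

Lemma pre_S (es : seq 'I_m) i e0 : uniq es -> i < size es ->
  pre es i.+1 = flip (nth e0 es i) (pre es i).
Proof.
move=> ues hi; apply/setP=> e; rewrite in_flip !mem_pre ltnS [index e es <= i]leq_eqVlt.
have [ees|ees] := boolP (e \in es) => /=; last first.
  by case: eqP => // ee; rewrite ee mem_nth in ees.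
have -> : (index e es == i) = (e == nth e0 es i).
  apply/eqP/eqP=> [<-|->]; first by rewrite nth_index.
  by rewrite index_uniq.
have [->|_] := eqVneq e (nth e0 es i); last by rewrite addbF.
by rewrite index_uniq // ltnn.
Qed.

Lemma post_S (es : seq 'I_m) i e0 : uniq es -> i < size es ->
  post es i = flip (nth e0 es i) (post es i.+1).
Proof.
by move=> ues hi; rewrite !postE // (pre_S e0) // flip_symdiffl flipK.
Qed.

Variables (F : {set point}) (u : point) (es' : seq 'I_m) (j : 'I_m).
Local Notation es := (rcons es' j).
(** Here [k] is one less than half the length of the cycle. The first vertex of the cycle is [u],
    and [j] is the last of the [k.+1] directions. Of the primed vertices [q 0], ..., [q k] below,
    the two extreme ones are already in [F]. *)
Local Notation k := (size es').
Hypotheses (iF : iso F) (vF : vc2 F) (good : goodcycle F u es) (k2 : 1 < k).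

Let nn t := nth j es t.
Definition primedv i : point := flip j (u :+: pre es i).
Local Notation q := primedv.
Definition extended : {set point} := F :|: [set x in [seq q i | i <- iota 0 k.+1]].

Let ues : uniq es. Proof. by case: good. Qed.

Let ses : size es = k.+1. Proof. by rewrite size_rcons. Qed.

Let nnk : nn k = j.
Proof. by rewrite /nn nth_rcons ltnn eqxx. Qed.

Let nn_mem t : t <= k -> nn t \in es.
Proof. by move=> ht; rewrite mem_nth // ses. Qed.

Let nn_idx t : t <= k -> index (nn t) es = t.
Proof. by move=> ht; rewrite index_uniq // ses. Qed.

Let idxj : index j es = k.
Proof. by have := nn_idx (leqnn k); rewrite nnk. Qed.

Let nn_inj s t : s <= k -> t <= k -> (nn s == nn t) = (s == t).
Proof. by move=> hs ht; rewrite nth_uniq // ses. Qed.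

Let nnj t : t < k -> nn t != j.
Proof. by move=> ht; rewrite -nnk nn_inj ?(ltnW ht) // neq_ltn ht. Qed.

Let base e x y : (e \in x :+: y) = (e \in x :+: u) (+) (e \in y :+: u).
Proof. by rewrite !in_symdiff; case: (e \in x); case: (e \in y); case: (e \in u). Qed.

Let preF i : i <= k -> u :+: pre es i \in F.
Proof. by case: good => _ sub _ hi; apply/sub/pre_stdcyc; rewrite ses. Qed.

Let postF i : i <= k -> u :+: post es i \in F.
Proof. by case: good => _ sub _ hi; apply/sub/post_stdcyc; rewrite ses. Qed.

(** On the directions of the cycle a vertex looks like its gate, a prefix or a suffix of [es]; the
    exclusions below rest on these two patterns. *)
Let relF x : x \in F -> exists2 s, s <= k &
  (forall e, e \in es -> (e \in x :+: u) = (index e es < s)) \/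
  (forall e, e \in es -> (e \in x :+: u) = (s <= index e es)).
Proof.
case: good => _ _ proj xF; have [s hs [h|h]] := proj x xF; exists s; rewrite ?ses // in hs *.
- left=> e ees; move/setP/(_ e): h; rewrite in_setI in_setlist ees andbT => ->.
  by rewrite mem_pre ees.
- right=> e ees; move/setP/(_ e): h; rewrite in_setI in_setlist ees andbT => ->.
  by rewrite in_post // ees.
Qed.

Let relq i e : (e \in q i :+: u) = (e == j) (+) ((e \in es) && (index e es < i)).
Proof. by rewrite /q flip_symdiffl (symdiffC u) symdiffK in_flip mem_pre addbC. Qed.

Let relqn i t : t <= k -> (nn t \in q i :+: u) = (t == k) (+) (t < i).
Proof. by move=> ht; rewrite relq nn_mem // nn_idx // -[X in nn t == X]nnk nn_inj. Qed.

Let relFn x : x \in F -> exists2 s, s <= k &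
  (forall t, t <= k -> (nn t \in x :+: u) = (t < s)) \/
  (forall t, t <= k -> (nn t \in x :+: u) = (s <= t)).
Proof.
by move=> /relF[s hs [h|h]]; exists s => //; [left|right] => t ht; rewrite h ?nn_mem // nn_idx.
Qed.

Let flipq i : i < k -> flip (nn i) (q i) = q i.+1.
Proof. by move=> hi; rewrite /q (pre_S j) ?ses ?ltnS ?(ltnW hi) // flip_symdiffr flipC. Qed.

Let flipqV i : i < k -> flip (nn i) (q i.+1) = q i.
Proof. by move=> hi; rewrite -flipq // flipK. Qed.

Let q0 : q 0 = u :+: post es k.
Proof.
rewrite /q pre0 symdiff0 (post_S j) ?ses // flip_symdiffr -/(nn k) nnk.
rewrite (_ : post es k.+1 = set0) ?symdiff0 //.
by apply/setP=> e; rewrite in_setlist in_set0 drop_oversize // ses.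
Qed.

Let qk : q k = u :+: post es 0.
Proof.
rewrite /q -flip_symdiffr; congr (_ :+: _).
rewrite -[X in flip X _]nnk -(pre_S j) ?ses // postE // pre0 symdiffC symdiff0.
by rewrite pre_over // ses.
Qed.

Let qF' i : i <= k -> q i \in extended.
Proof.
by move=> hi; rewrite in_setU inE map_f ?orbT // mem_iota.
Qed.

Let FF' x : x \in F -> x \in extended.
Proof. by move=> xF; rewrite in_setU xF. Qed.

Let q_notin i : 0 < i < k -> q i \notin F.
Proof.
move=> /andP[i0 ik]; apply/negP=> /relFn[s hs [h|h]].
  by have := h k (leqnn k); rewrite relqn // eqxx; lia.
have := h 0 (leq0n k); have := h i (ltnW ik); rewrite !relqn ?(ltnW ik) //; lia.
Qed.

Let extendedP x : x \in extended -> x \in F \/ exists2 i, 0 < i < k & x = q i.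
Proof.
rewrite in_setU => /orP[xF|]; first by left.
rewrite inE => /mapP[i]; rewrite mem_iota /= add0n ltnS => hi ->.
have [->|i0] := posnP i; first by left; rewrite q0 postF.
have [ik|ki] := ltnP i k; first by right; exists i; rewrite ?i0.
by left; rewrite (_ : i = k) ?qk ?postF //; lia.
Qed.

(** From a new vertex, a step towards a prefix pattern is the rung [j] down to the cycle, because
    these prefixes omit [j]; a step towards a suffix pattern follows the primed path. *)
Lemma extended_iso : iso extended.
Proof.
have new_old i y : 0 < i < k -> y \in F ->
    exists2 e, e \in q i :+: y & flip e (q i) \in extended.
  move=> /andP[i0 ik] yF; have [s hs [h|h]] := relFn yF.
  - exists j; last by rewrite /q flipK FF' // preF // ltnW.
    rewrite base; have := h k (leqnn k); have := relqn i (leqnn k).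
    rewrite nnk eqxx => -> ->.
    by rewrite (leq_gtF hs) (leq_gtF (ltnW ik)).
  - have [si|is_] := leqP s i.
      exists (nn i); last by rewrite flipq // qF'.
      by rewrite base relqn ?h ?(ltnW ik) // ltnn si (ltn_eqF ik).
    have iE := prednK i0.
    exists (nn i.-1); last by rewrite -{2}iE flipqV ?qF' //; lia.
    by rewrite base relqn ?h; lia.
have new_new i l : i < l -> l < k -> nn i \in q i :+: q l.
  move=> il lk; by rewrite base !relqn; lia.
apply: iso_weak => x y /extendedP[xF|[i hi ->]] /extendedP[yF|[l hl ->]] xy.
- by have [e exy eF] := iF xF yF xy; exists e => //; rewrite (FF' eF).
- have [e exy eF] := new_old l x hl xF; exists e; first by rewrite symdiffC.
  by rewrite eF orbT.
- by have [e exy eF] := new_old i y hi yF; exists e => //; rewrite eF.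
have /orP[il|li] : (i < l) || (l < i).
  by rewrite -neq_ltn; apply: contraNneq xy => ->.
- exists (nn i); first by apply: new_new => //; case/andP: hl.
  by rewrite flipq ?qF' //; lia.
exists (nn l); first by rewrite symdiffC new_new //; case/andP: hi.
by rewrite flipq ?qF' ?orbT //; lia.
Qed.

(** If one of three directions is off the cycle, every new vertex can be replaced by an old one with
    the same pattern on the three ([agree]). If all are on the cycle, one pattern is never
    realised. *)
Lemma extended_vc2 : vc2 extended.
Proof.
have agree i a b : i <= k -> a != b -> exists2 x, x \in F &
    [/\ (a \in x) = (a \in q i), (b \in x) = (b \in q i) &
        forall o, o \notin es -> (o \in x) = (o \in q i)].
  move=> hi; have jes : j \in es by rewrite mem_rcons mem_head.
  have oj o : o \notin es -> o != j by apply: contraNneq => ->.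
  have qE o : (o \in q i) = (o \in u) (+) ((o \in es) && (index o es < i)) (+) (o == j).
    by rewrite /q in_flip in_symdiff mem_pre.
  have ends o : o != j -> exists2 x, x \in F & [/\ (j \in x) = (j \in q i),
      (o \in x) = (o \in q i) & forall o, o \notin es -> (o \in x) = (o \in q i)].
    move=> oj'; have ji : index j es < i = false.
      by rewrite idxj ltnNge hi.
    have [oin|oin] := boolP ((o \in es) && (index o es < i)).
      exists (u :+: post es 0); first exact: postF.
      rewrite !qE (negbTE oj') oin jes ji eqxx !in_symdiff !in_post // jes leq0n.
      case/andP: oin => -> _; split; rewrite ?addbF //.
      move=> p pes; rewrite qE in_symdiff in_post // (negbTE pes) (negbTE (oj _ pes)).
      by rewrite /= !addbF.
    exists (u :+: post es k); first exact: postF.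
    rewrite !qE (negbTE oj') (negbTE oin) jes ji eqxx !in_symdiff !in_post // jes.
    rewrite idxj leqnn; split; rewrite ?addbF //.
      case oes: (o \in es) => //=; last by rewrite addbF.
      have ho : index o es < k.+1 by rewrite -ses index_mem.
      have -> : (k <= index o es) = false; last by rewrite addbF.
      apply: contraNF oj' => hko; have e1 : index o es = k by lia.
      by rewrite -(nth_index j oes) e1 -/(nn k) nnk.
    move=> p pes; rewrite qE in_symdiff in_post // (negbTE pes) (negbTE (oj _ pes)).
    by rewrite /= !addbF.
  move=> ab; have [aj|aj] := eqVneq a j.
    have [|x xF [h1 h2 h3]] := ends b; first by rewrite -aj eq_sym.
    by exists x; rewrite // aj.
  have [bj|bj] := eqVneq b j.
    by have [x xF [h1 h2 h3]] := ends a aj; exists x; rewrite // bj.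
  exists (u :+: pre es i); first exact: preF.
  rewrite !qE (negbTE aj) (negbTE bj) !in_symdiff !mem_pre !addbF; split=> // o oes.
  by rewrite qE in_symdiff mem_pre (negbTE (oj _ oes)) addbF.
move=> a b c abc sh.
have [/and3P[aes bes ces]|out] := boolP [&& a \in es, b \in es & c \in es]; last first.
  apply: (vF abc) => p q' r; have [x /extendedP[xF|[i /andP[_ hi] ->]] [ha hb hc]] := sh p q' r.
    by exists x.
  move: (abc) out; rewrite /= !inE negb_or andbT !negb_and => /andP[/andP[ab ac] bc].
  case/or3P=> oes.
  - by have [y yF [h1 h2 h3]] := agree i b c (ltnW hi) bc; exists y; rewrite // h1 h2 h3.
  - by have [y yF [h1 h2 h3]] := agree i a c (ltnW hi) ac; exists y; rewrite // h1 h2 h3.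
  - by have [y yF [h1 h2 h3]] := agree i a b (ltnW hi) ab; exists y; rewrite // h1 h2 h3.
(* For indices r < s < t no vertex contains s but neither r nor t, relative to u. *)
have pattern x : x \in extended -> exists2 s, s <= k &
    [\/ (forall e, e \in es -> (e \in x :+: u) = (index e es < s)),
        (forall e, e \in es -> (e \in x :+: u) = (s <= index e es)) |
        (forall e, e \in es -> (e \in x :+: u) = (index e es == k) (+) (index e es < s))].
  case/extendedP=> [/relF[s hs [h|h]]|[i /andP[_ hi] ->]].
  - by exists s => //; constructor 1.
  - by exists s => //; constructor 2.
  exists i; first exact: ltnW.
  constructor 3 => e ees; rewrite relq ees /=; congr (_ (+) _).
  by apply/eqP/eqP=> [->|h]; [exact: idxj | rewrite -(nth_index j ees) h -/(nn k) nnk].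
pose mid (r s t : nat) := (s < r < t) || (t < r < s).
have idx_lt e : e \in es -> index e es <= k by rewrite -index_mem ses ltnS.
have idx_ne e f : e \in es -> f \in es -> e != f -> index e es <> index f es.
  by move=> ees fes /eqP ef h; apply: ef; rewrite -(nth_index j ees) h nth_index.
move: (abc); rewrite /= !inE negb_or andbT => /andP[/andP[ab ac] bc].
have := (idx_lt a aes, idx_lt b bes, idx_lt c ces,
  (idx_ne a b aes bes ab, idx_ne a c aes ces ac, idx_ne b c bes ces bc)).
have [x xE] := sh ((a \in u) (+) mid (index a es) (index b es) (index c es))
                  ((b \in u) (+) mid (index b es) (index a es) (index c es))
                  ((c \in u) (+) mid (index c es) (index a es) (index b es)).
case=> /(congr1 (addb (a \in u))) xa /(congr1 (addb (b \in u))) xb /(congr1 (addb (c \in u))) xc.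
rewrite !addbA !addbb /= ![(_ \in u) (+) _]addbC -!in_symdiff in xa xb xc.
have [s hs [h|h|h]] := pattern x xE;
  move: xa xb xc; rewrite !h // /mid;
  move: (index a es) (index b es) (index c es) hs k2; clear=> ta tb tc hs k2'.
- by move=> h1 h2 h3 [[[? ?] ?] [[? ?] ?]]; lia.
- by move=> h1 h2 h3 [[[? ?] ?] [[? ?] ?]]; lia.
by move=> h1 h2 h3 [[[? ?] ?] [[? ?] ?]]; lia.
Qed.

(** Relative to [u], [q i] contains [nn i.-1] and [nn k] but not [nn i]. Any other direction keeps
    these three values, which exclude prefixes, suffixes and the other primed vertices. *)
Let nbrs i e : 0 < i < k -> flip e (q i) \in extended -> e \in [:: j; nn i.-1; nn i].
Proof.
move=> /andP[i0 ik] xF; apply: contraT; rewrite !inE !negb_or => /and3P[ej ea eb].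
have rel t : t <= k -> nn t != e -> (nn t \in flip e (q i) :+: u) = (t == k) (+) (t < i).
  by move=> ht ne; rewrite flip_symdiffl in_flip relqn // (negbTE ne) addbF.
have ra := rel i.-1 ltac:(lia) ltac:(by rewrite eq_sym).
have rb := rel i ltac:(lia) ltac:(by rewrite eq_sym).
have rk := rel k (leqnn k) ltac:(by rewrite nnk eq_sym).
have [/relFn[s hs [h|h]]|[l hl xE]] := extendedP xF.
- by move: rk; rewrite h // eqxx; lia.
- by move: ra rb; rewrite !h; lia.
move: ra rb; rewrite xE !relqn; try lia.
move=> h1 h2; have li : l = i by lia.
by move: (flip_neq e (q i)); rewrite xE li eqxx.
Qed.

(** A new vertex has at most the three neighbours of [nbrs]. As an original vertex of the star it
    would make [j] and [nn i.-1] star directions, yet these two lead to a vertex of [F] where the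
    star requires a missing one. As a subdividing vertex it would force the centre [w] into [F]. *)
Lemma extended_star w (A : {set 'I_m}) : 3 < #|A| -> star extended w A -> star F w A.
Proof.
move=> cA [wE st1 st2 st3].
have orig a : a \in A -> flip a w \in F.
  move=> aA; have [//|[i hi aE]] := extendedP (st1 a aA).
  have [i0 ik] := andP hi.
  have nb b : b \in A :\ a -> b \in [:: j; nn i.-1; nn i].
    by rewrite in_setD1 => /andP[ba bA]; apply: nbrs hi _; rewrite -aE st2.
  have cAa : 2 < #|A :\ a| by move: cA; rewrite (cardsD1 a A) aA.
  have jA : j \in A :\ a.
    have [r rA] : exists2 r, r \in A :\ a & r \notin [:: nn i.-1; nn i] by exact: exists_notin.
    by move: (nb r rA); rewrite inE => /predU1P[<- //|->].
  have nA : nn i.-1 \in A :\ a.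
    have [r rA rN] : exists2 r, r \in A :\ a & r \notin [:: j; nn i] by exact: exists_notin.
    move: (nb r rA) rN (rA); rewrite !(in_cons, in_nil, orbF).
    by case/or3P=> /eqP->; rewrite ?eqxx ?orbT.
  move: jA nA; rewrite !in_setD1 => /andP[ja jA] /andP[na nA].
  have nj : nn i.-1 != j by apply: nnj; lia.
  have := st3 j (nn i.-1) a jA nA aA; rewrite /= !inE negb_or ja na (eq_sym j) nj => /(_ isT).
  by rewrite aE -{2}(prednK i0) flipqV ?FF' ?flipK ?preF //; lia.
have pairE a b i : a \in A -> b \in A -> a != b -> 0 < i < k -> flip a (flip b w) = q i -> False.
  move=> aA bA ab hi abE; have [i0 ik] := andP hi.
  have ha : flip a (q i) = flip b w by rewrite -abE flipK.
  have hb : flip b (q i) = flip a w by rewrite -abE flipC flipK.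
  have aN : a \in [:: j; nn i.-1; nn i] by apply: nbrs hi _; rewrite ha st1.
  have bN : b \in [:: j; nn i.-1; nn i] by apply: nbrs hi _; rewrite hb st1.
  have wq : w = flip b (flip a (q i)) by rewrite ha flipK.
  have wq' : w = flip a (flip b (q i)) by rewrite hb flipK.
  have iE := prednK i0.
  have fm : flip (nn i.-1) (q i) = q i.-1 by rewrite -{2}iE flipqV //; lia.
  have fp : flip (nn i) (q i) = q i.+1 by rewrite flipq.
  have jm : flip j (flip (nn i.-1) (q i)) \in extended by rewrite fm /q flipK FF' // preF; lia.
  have jp : flip j (flip (nn i) (q i)) \in extended by rewrite fp /q flipK FF' // preF; lia.
  (* Both neighbours of [q i] on the primed path are in [F], hence are its two ends. So the cycle
     has length 6, and [w] is its vertex [u :+: post es 1]. *)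
  have mp : flip (nn i.-1) (q i) \in F -> flip (nn i) (q i) \in F -> w = flip (nn i) (q i.-1) -> False.
    rewrite fm fp => hm hp wE'.
    have i1 : i = 1.
      by apply: contraTeq hm => h; apply: q_notin; move: h i0 ik; clear; lia.
    have kE : k = 2.
      by apply: contraTeq hp => h; apply: q_notin; move: h i0 ik i1; clear; lia.
    case/negP: wE; rewrite wE' i1 /= q0 kE; apply: FF'.
    by rewrite -flip_symdiffr -(post_S j) // ?ses ?postF ?kE.
  move: aN bN; rewrite !inE => /or3P[] /eqP aX /or3P[] /eqP bX.
  - by rewrite aX bX eqxx in ab.
  - by move: wE; rewrite wq' aX bX jm.
  - by move: wE; rewrite wq' aX bX jp.
  - by move: wE; rewrite wq aX bX jm.
  - by rewrite aX bX eqxx in ab.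
  - apply: mp; first by rewrite -aX ha orig.
      by rewrite -bX hb orig.
    by rewrite wq aX bX fm.
  - by move: wE; rewrite wq aX bX jp.
  - apply: mp; first by rewrite -bX hb orig.
      by rewrite -aX ha orig.
    by rewrite wq' aX bX fm.
  - by rewrite aX bX eqxx in ab.
split=> //.
- by apply: contra wE => /FF'.
- move=> a b aA bA ab; have [//|[i hi E]] := extendedP (st2 a b aA bA ab).
  by case: (pairE a b i aA bA ab hi E).
by move=> a b c aA bA cA' abc; apply: contra (st3 a b c aA bA cA' abc) => /FF'.
Qed.

Let ues' : uniq es'.
Proof. by move: ues; rewrite rcons_uniq => /andP[]. Qed.

Let jes' : j \notin es'.
Proof. by move: ues; rewrite rcons_uniq => /andP[]. Qed.

Let preE i : i <= k -> pre es i = pre es' i.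
Proof. by move=> hi; rewrite /pre -cats1 takel_cat. Qed.

Let postE2 i : i <= k -> flip j (post es' i) = post es i.
Proof.
move=> hi; apply/setP=> e; rewrite in_flip !in_post // mem_rcons in_cons.
have [->|ej] /= := eqVneq e j; first by rewrite (negbTE jes') idxj hi.
rewrite addbF; case ees: (e \in es') => //=.
by rewrite -cats1 index_cat ees.
Qed.

Lemma extended_good : goodcycle extended (flip j u) es'.
Proof.
split=> //.
  move=> x /mem_stdcyc[i hi [->|->]].
    by rewrite flip_symdiffl -preE ?(ltnW hi) // qF' // ltnW.
  by rewrite flip_symdiffl -flip_symdiffr postE2 ?(ltnW hi) // FF' // postF // ltnW.
have rel x e : e \in es' -> (e \in x :+: flip j u) = (e \in x :+: u).
  move=> ees; rewrite flip_symdiffr in_flip; case: eqP => [ej|_]; last by rewrite addbF.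
  by case/negP: jes'; rewrite -ej.
have idx e : e \in es' -> index e es = index e es' by move=> ees; rewrite -cats1 index_cat ees.
have sub e : e \in es' -> e \in es by move=> ees; rewrite mem_rcons in_cons ees orbT.
have lt e : e \in es' -> index e es' < k by rewrite index_mem.
move=> x /extendedP[/relF[s hs [h|h]]|[i /andP[i0 ik] ->]].
- have [sk|sk] := ltnP s k.
    exists s => //; left; apply/setP=> e; rewrite in_setI in_setlist mem_pre.
    by have [ees|ees] := boolP (e \in es'); rewrite ?andbF // andbT rel // h ?sub // idx.
  (* The index [k] is out of range for [es']; its full prefix is its suffix from 0. *)
  exists 0; first exact: ltnW; right; apply/setP=> e; rewrite in_setI in_setlist in_post //.
  have [ees|ees] := boolP (e \in es'); rewrite ?andbF // andbT rel // h ?sub // idx //.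
  by have := lt e ees; lia.
- have [sk|sk] := ltnP s k.
    exists s => //; right; apply/setP=> e; rewrite in_setI in_setlist in_post //.
    by have [ees|ees] := boolP (e \in es'); rewrite ?andbF // andbT rel // h ?sub // idx.
  exists 0; first exact: ltnW; left; apply/setP=> e; rewrite in_setI in_setlist mem_pre.
  have [ees|ees] := boolP (e \in es'); rewrite ?andbF // andbT rel // h ?sub // idx //.
  by have := lt e ees; lia.
exists i => //; left; apply/setP=> e; rewrite in_setI in_setlist mem_pre.
have [ees|ees] := boolP (e \in es'); rewrite ?andbF // andbT rel // relq sub // idx //.
by case: eqP => // ej; case/negP: jes'; rewrite -ej.
Qed.

Lemma extended_card : #|F| < #|extended|.
Proof.
apply: proper_card; rewrite properE subsetUl /=; apply/subsetPn.
by exists (q 1); [apply: qF'; exact: ltnW | exact: q_notin].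
Qed.

Let takec : take k.+1 (stdcyc u es) = [seq u :+: pre es i | i <- iota 0 k.+1].
Proof. by rewrite /stdcyc ses take_size_cat // size_map size_iota. Qed.

Lemma primedE : primed (stdcyc u es) j = [seq q i | i <- iota 0 k.+1].
Proof. by rewrite /primed size_stdcyc doubleK ses takec -map_comp. Qed.

(** The path edges and rungs of the definition are, by [nbrs], all edges of the cube at new
    vertices; so the extension is again an induced subgraph. *)
Lemma extended_adj A B :
  [|| [&& A \in F, B \in F & cube_adj A B],
      infix [:: A; B] (primed (stdcyc u es) j), infix [:: B; A] (primed (stdcyc u es) j)
    | (B == flip j A) && ((A \in take k.+1 (stdcyc u es)) || (B \in take k.+1 (stdcyc u es)))] =
  [&& A \in extended, B \in extended & cube_adj A B].
Proof.
rewrite primedE takec; set P := [seq q i | i <- _]; set T := [seq _ | i <- _].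
have sP : size P = k.+1 by rewrite size_map size_iota.
have nP i : i <= k -> nth set0 P i = q i.
  by move=> hi; rewrite (nth_map 0) ?size_iota // nth_iota.
have mT x : x \in T -> x \in extended /\ flip j x \in extended.
  case/mapP=> i; rewrite mem_iota => /= hi ->.
  by split; [apply/FF'/preF | exact: qF'].
have infF x y : infix [:: x; y] P -> [&& x \in extended, y \in extended & cube_adj x y].
  case/(infix2P set0) => i; rewrite sP => hi []; rewrite !nP //; last exact: ltnW.
  move=> <- <-; rewrite !qF' //=; last exact: ltnW.
  by rewrite -flipq // cube_adj_flip.
have newF x y : x \in extended -> x \notin F -> y \in extended -> cube_adj x y ->
    [|| infix [:: x; y] P, infix [:: y; x] P | (y == flip j x) && (y \in T)].
  case/extendedP=> [->//|[i hi ->]] _ yF /cube_adjP[e yE]; have [i0 ik] := andP hi.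
  have : e \in [:: j; nn i.-1; nn i] by apply: nbrs hi _; rewrite -yE.
  rewrite !inE => /or3P[] /eqP eE; rewrite yE eE.
  - have hT : u :+: pre es i \in T.
      by apply/mapP; exists i; rewrite // mem_iota /= ltnS ltnW.
    by apply/or3P; constructor 3; rewrite eqxx flipK.
  - apply/or3P; constructor 2; apply/(infix2P set0); exists i.-1; first by rewrite sP; lia.
    by rewrite prednK // !nP ?(ltnW ik) -1?{3}(prednK i0) ?flipqV //; lia.
  apply/or3P; constructor 1; apply/(infix2P set0); exists i; first by rewrite sP.
  by rewrite !nP ?(ltnW ik) // flipq.
apply/idP/idP.
  case/or4P=> [/and3P[aF bF ->]|/infF //|/infF/and3P[-> -> /=]|/andP[/eqP->]].
  - by rewrite !FF'.
  - by rewrite cube_sym.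
  rewrite cube_adj_flip andbT => /orP[/mT[-> ->] //|/mT[->]].
  by rewrite flipK => ->.
case/and3P=> aE bE ab.
have [aF|aF] := boolP (A \in F); last first.
  have /or3P[->|->|/andP[-> ->]] := newF A B aE aF bE ab; rewrite ?orbT //.
have [bF|bF] := boolP (B \in F); first by rewrite ab.
rewrite cube_sym in ab.
have /or3P[->|->|/andP[/eqP-> h]] := newF B A bE bF aE ab; rewrite ?orbT //.
by rewrite flipK eqxx h !orbT.
Qed.

Lemma residualE : residual_cycle (stdcyc u es) j = stdcyc (flip j u) es'.
Proof.
rewrite /residual_cycle primedE size_stdcyc doubleK ses.
have -> : drop k.+2 (stdcyc u es) = [seq u :+: post es i | i <- iota 1 k].
  rewrite drop_cat size_map size_iota ses ltnNge leqnSn /= subSnn.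
  by rewrite /= drop0.
rewrite subSS subn1 -map_take take_iota (minn_idPl (leq_pred k)).
rewrite -addn1 iotaD map_cat -catA; congr (_ ++ _).
  apply/eq_in_map=> i; rewrite mem_iota /= => hi.
  by rewrite flip_symdiffl -preE // ltnW.
rewrite -[in RHS](prednK (ltnW k2)) /= !add0n; congr cons.
  by rewrite qk flip_symdiffl -flip_symdiffr postE2.
apply/eq_in_map=> i; rewrite mem_iota => hi.
by rewrite flip_symdiffl -flip_symdiffr postE2 //; lia.
Qed.

End CycleExtension.

(** * Shattered pairs and minimal ladders *)

Section Ampleness.
Variable m : nat.
Local Notation point := {set 'I_m}.
Implicit Types (x y z u v w A B X Y : point) (F : {set point}) (e f a b : 'I_m).
Implicit Types (G H : sgraph point).

(** The geodesics from [u] to [w] and from [flip f u] to [flip f w] are to become the two sides of a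
    convex cycle, closed by the two [f]-edges. *)
Definition ladder F f u w : Prop :=
  [/\ f \notin u :+: w, [/\ u \in F, w \in F, flip f u \in F & flip f w \in F] &
      forall z, z \in F -> between u z w -> flip f z \in F -> z = u \/ z = w].

Section Ladder.
Variable F : {set point}.
Hypothesis iF : iso F.

Lemma ladder_flip f u w : ladder F f u w -> ladder F f (flip f u) (flip f w).
Proof.
case=> fuw [uF wF fuF fwF] mid; split.
- by rewrite flip_symdiffl flip_symdiffr flipK.
- by rewrite !flipK.
move=> z zF bz zF'; have bz' : between u (flip f z) w.
  by move: bz; rewrite /between !flip_symdiffl !flip_symdiffr flipK.
have := mid (flip f z) zF' bz'; rewrite flipK => /(_ zF).
by case=> <-; rewrite flipK; [left|right].
Qed.

(** A geodesic from [x] to [y] crosses the class [f] between [u] and [w], hence at [u] or at [w].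
    Where [x] and [y] agree it is constant, so [a] excludes [u] and [b] excludes [w]. *)
Lemma ladder_cross f u w x y a b : ladder F f u w -> x \in F -> between u x w ->
  y \in F -> between (flip f u) y (flip f w) -> a \in u :+: w -> b \in u :+: w ->
  a \in x :+: u -> b \notin x :+: u -> a \in y :+: flip f u -> b \notin y :+: flip f u -> False.
Proof.
move=> [fuw _ mid] xF /betweenP bx yF /betweenP by' auw buw ax bx' ay by1.
have fa : a != f by apply: contraNneq fuw => <-.
have fb : b != f by apply: contraNneq fuw => <-.
have fw : (f \in u) = (f \in w).
  by move: fuw; rewrite in_symdiff; case: (f \in u); case: (f \in w).
have fx := bx f fw.
have fy : (f \in y) = ~~ (f \in u).
  by have := by' f; rewrite !in_flip eqxx !addbT => -> //; rewrite fw.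
have fxy : f \in x :+: y by rewrite in_symdiff fx fy; case: (f \in u).
have [z [zF /betweenP bz fzF fz]] := iso_cross iF xF yF fxy.
move: ay by1; rewrite !flip_symdiffr !in_flip (negbTE fa) (negbTE fb) !addbF => ay by1.
have bw : between u z w.
  apply/betweenP=> e he; have [->|ef] := eqVneq e f; first by rewrite fz.
  have hx := bx e he; have hy := by' e; rewrite !in_flip (negbTE ef) !addbF in hy.
  by rewrite bz hx ?hy.
have [zu|zw] := mid z zF bw fzF.
  have := bz a; move: ax ay; rewrite zu !in_symdiff.
  by case: (a \in x); case: (a \in y); case: (a \in u) => //= _ _ /(_ erefl).
have := bz b; move: bx' by1 buw; rewrite zw !in_symdiff.
by case: (b \in x); case: (b \in y); case: (b \in u); case: (b \in w) => //= _ _ _ /(_ erefl).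
Qed.

(** Some vertex on the opposite side contains exactly one of [a] and [b], and [ladder_cross] applies
    to it with [x] or with [x']. As a result, the vertices between [u] and [w] are linearly
    ordered. *)
Lemma ladder_chain f u w x x' a b : ladder F f u w -> x \in F -> between u x w ->
  x' \in F -> between u x' w -> a \in u :+: w -> b \in u :+: w ->
  a \in x :+: u -> b \notin x :+: u -> a \notin x' :+: u -> b \in x' :+: u -> False.
Proof.
move=> lad xF bx x'F bx' auw buw ax bnx anx bx1.
have [fuw [uF wF fuF fwF] _] := lad.
have ab : a != b by apply: contraTneq ax => ->.
have e1 : flip f u :+: flip f w = u :+: w by rewrite flip_symdiffl flip_symdiffr flipK.
have [y yF [by' ny]] := @iso_cross2 _ F (flip f u) (flip f w) a b iF fuF fwF
  ltac:(by rewrite e1) ltac:(by rewrite e1) ab.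
rewrite !(symdiffC _ y) in ny.
have [ay|ay] := boolP (a \in y :+: flip f u).
  apply: (ladder_cross lad xF bx yF by' auw buw) => //.
  by move: ny; rewrite ay; case: (b \in _).
apply: (ladder_cross lad x'F bx' yF by' buw auw) => //.
by move: ny; rewrite (negbTE ay); case: (b \in _).
Qed.

(** A vertex [y] is taken on the opposite side, at the distance from [flip f u] that the antipode
    must have. If its difference set meets that of [x], [ladder_cross] makes it contain the
    complement; if not, it is contained in the complement. By cardinality it is the complement. *)
Lemma ladder_antipode f u w x : ladder F f u w -> x \in F -> between u x w ->
  x :+: (f |: (u :+: w)) \in F.
Proof.
move=> lad xF bx; have [fuw [uF wF fuF fwF] _] := lad.
have e1 : flip f u :+: flip f w = u :+: w by rewrite flip_symdiffl flip_symdiffr flipK.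
have hX : x :+: u \subset u :+: w by rewrite symdiffC.
have hn : #|(u :+: w) :\: (x :+: u)| <= #|flip f u :+: flip f w|.
  by rewrite e1; apply: subset_leq_card; exact: subsetDl.
have [y yF [by' ny]] := iso_dist iF fuF fwF hn.
have hZ : y :+: flip f u \subset u :+: w by move: by'; rewrite /between e1 symdiffC.
rewrite symdiffC in ny.
have ZE : y :+: flip f u = (u :+: w) :\: (x :+: u).
  have [disj|/set0Pn[a]] := eqVneq ((x :+: u) :&: (y :+: flip f u)) set0.
    apply/eqP; rewrite eqEcard ny leqnn andbT.
    apply/subsetP=> e ez; rewrite in_setD (subsetP hZ) // andbT.
    by apply: contraTN isT => ex; move/setP/(_ e): disj; rewrite in_setI ex ez in_set0.
  rewrite in_setI => /andP[ax az]; apply/eqP; rewrite eq_sym eqEcard ny leqnn andbT.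
  apply/subsetP=> b; rewrite in_setD => /andP[bx' buw]; apply: contraT => bz.
  case: (ladder_cross lad xF bx yF by' _ buw ax bx' az bz).
  exact: (subsetP hX).
suff -> : x :+: (f |: (u :+: w)) = y by [].
apply/setP=> e; move/setP/(_ e): ZE; have := subsetP hX e.
rewrite flip_symdiffr in_setD in_flip !in_symdiff in_setU1 in_symdiff.
have [->|ef] := eqVneq e f; last rewrite addbF /=.
  move: fuw; rewrite in_symdiff.
  by case: (f \in u); case: (f \in w); case: (f \in x); case: (f \in y) => //= _ /(_ isT).
by case: (e \in u); case: (e \in w); case: (e \in x); case: (e \in y) => //= /(_ isT).
Qed.

Lemma ladder_sides f u w z : ladder F f u w -> z :+: u \subset f |: (u :+: w) ->
  between u z w \/ between (flip f u) z (flip f w).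
Proof.
case=> fuw _ _ /subsetP h; have [fz|fz] := boolP (f \in z :+: u); [right|left].
  rewrite /between (flip_symdiffl f u (flip f w)) flip_symdiffr flipK.
  apply/subsetP=> e; rewrite flip_symdiffl in_flip symdiffC.
  have [->|ef] := eqVneq e f; first by rewrite fz.
  by rewrite addbF => /h; rewrite in_setU1 (negbTE ef).
apply/subsetP=> e; rewrite symdiffC => ez; move: (h e ez); rewrite in_setU1.
by case/predU1P=> // ef; rewrite -ef ez in fz.
Qed.

Lemma ladder_antipode_box f u w z : ladder F f u w -> z \in F ->
  z :+: u \subset f |: (u :+: w) -> z :+: (f |: (u :+: w)) \in F.
Proof.
move=> lad zF /(ladder_sides lad)[b|b]; first exact: ladder_antipode lad zF b.
have := ladder_antipode (ladder_flip lad) zF b.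
by rewrite flip_symdiffl flip_symdiffr flipK.
Qed.

(** For [a] and [b] other than [f], the equal patterns are realised by [u] and [w]. Each side has a
    vertex separating [a] from [b], and [ladder_cross] forbids the two to do it in the same way. *)
Lemma ladder_pairs f u w a b : ladder F f u w -> a \in f |: (u :+: w) ->
  b \in f |: (u :+: w) -> a != b -> forall p q, exists2 z, z \in F &
    [/\ z :+: u \subset f |: (u :+: w), (a \in z :+: u) = p & (b \in z :+: u) = q].
Proof.
move=> lad aD bD ab; have [fuw [uF wF fuF fwF] mid] := lad.
have sub0 z : between u z w -> z :+: u \subset f |: (u :+: w).
  by move=> h; rewrite symdiffC; apply: subset_trans h _; exact: subsetUr.
have e1 : flip f u :+: flip f w = u :+: w by rewrite flip_symdiffl flip_symdiffr flipK.
have sub1 z : between (flip f u) z (flip f w) -> z :+: u \subset f |: (u :+: w).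
  rewrite /between e1 => /subsetP h; apply/subsetP=> e; rewrite in_setU1 symdiffC.
  have [->//|ef] := eqVneq e f; move: (h e); rewrite flip_symdiffl in_flip (negbTE ef) addbF.
  by [].
have fstep c : c \in u :+: w -> forall p q, exists2 z, z \in F &
    [/\ z :+: u \subset f |: (u :+: w), (f \in z :+: u) = p & (c \in z :+: u) = q].
  move=> cuw; have cf : c != f by apply: contraNneq fuw => <-.
  have fwu : f \in w :+: u = false by rewrite symdiffC; exact: negbTE.
  have cwu : c \in w :+: u by rewrite symdiffC.
  move=> [] [].
  - exists (flip f w) => //; rewrite sub1 ?betweenxy // flip_symdiffl !in_flip eqxx.
    by rewrite (negbTE cf) fwu cwu.
  - exists (flip f u) => //; rewrite sub1 ?betweenxx // flip_rel !in_set1 eqxx.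
    by rewrite (negbTE cf).
  - by exists w => //; rewrite sub0 ?betweenxy.
  - by exists u => //; rewrite sub0 ?betweenxx // symdiffv !in_set0.
move: aD bD; rewrite !in_setU1 => /predU1P[aE|auw] /predU1P[bE|buw].
- by rewrite aE bE eqxx in ab.
- by rewrite aE => p q; exact: fstep.
- by rewrite bE => p q; have [z zF [h1 h2 h3]] := fstep a auw q p; exists z.
have [x xF [bx nx]] := iso_cross2 iF uF wF auw buw ab.
have [y yF [by' ny]] := @iso_cross2 _ F (flip f u) (flip f w) a b iF fuF fwF
  ltac:(by rewrite e1) ltac:(by rewrite e1) ab.
rewrite !(symdiffC _ x) in nx; rewrite !(symdiffC _ y) in ny.
have af : a != f by apply: contraNneq fuw => <-.
have bf : b != f by apply: contraNneq fuw => <-.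
have ya : (a \in y :+: flip f u) = (a \in y :+: u).
  by rewrite flip_symdiffr in_flip (negbTE af) addbF.
have yb : (b \in y :+: flip f u) = (b \in y :+: u).
  by rewrite flip_symdiffr in_flip (negbTE bf) addbF.
have hc1 : ~~ [&& a \in x :+: u, b \notin x :+: u, a \in y :+: u & b \notin y :+: u].
  apply/negP=> /and4P[h1 h2]; rewrite -ya -yb => h3 h4.
  exact: (ladder_cross lad xF bx yF by' auw buw h1 h2 h3 h4).
have hc2 : ~~ [&& b \in x :+: u, a \notin x :+: u, b \in y :+: u & a \notin y :+: u].
  apply/negP=> /and4P[h1 h2]; rewrite -ya -yb => h3 h4.
  exact: (ladder_cross lad xF bx yF by' buw auw h1 h2 h3 h4).
rewrite ya yb in ny.
have [sx sy] := (sub0 _ bx, sub1 _ by').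
move=> [] [].
- by exists w => //; rewrite sub0 ?betweenxy // symdiffC.
- case ax: (a \in x :+: u).
    by exists x => //; split => //; move: nx; rewrite ax; case: (b \in _).
  exists y => //; move: nx ny hc1 hc2; rewrite ax.
  by case: (b \in x :+: u); case: (a \in y :+: u); case: (b \in y :+: u).
- case ax: (a \in x :+: u); last first.
    by exists x => //; split => //; move: nx; rewrite ax; case: (b \in _).
  exists y => //; move: nx ny hc1 hc2; rewrite ax.
  by case: (b \in x :+: u); case: (a \in y :+: u); case: (b \in y :+: u).
by exists u => //; rewrite sub0 ?betweenxx // symdiffv !in_set0.
Qed.

Lemma ladder_good f u w : vc2 F -> (forall y A, 3 < #|A| -> ~ star F y A) ->
  ladder F f u w -> 1 < #|u :+: w| ->
  exists es, goodcycle F u es /\ size es = #|u :+: w|.+1.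
Proof.
move=> vF nostar lad cuw; have [fuw [uF wF _ _] _] := lad.
set D := f |: (u :+: w).
have cD : 2 < #|D| by rewrite /D cardsU1 fuw add1n ltnS.
have gates : forall x, x \in F -> u :+: ((x :+: u) :&: D) \in F.
  have anti z : z \in F -> z :+: u \subset D -> z :+: D \in F.
    exact: ladder_antipode_box lad.
  have prs := fun a b aD bD ab => @ladder_pairs f u w a b lad aD bD ab.
  by have [//|[y [A [cA st]]]] := gate_or_star iF vF cD anti prs; case: (nostar y A).
have [s [us sE sF]] := iso_path iF uF wF.
have fs : f \notin s by rewrite -in_setlist sE.
have ues : uniq (rcons s f) by rewrite rcons_uniq fs.
have ss : size s = #|u :+: w| by rewrite -sE card_es.
have DE : [set e in rcons s f] = D.
  by apply/setP=> e; rewrite in_setlist mem_rcons in_cons /D in_setU1 -sE in_setlist.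
have preE i : i <= size s -> pre (rcons s f) i = pre s i.
  by move=> hi; rewrite /pre -cats1 takel_cat.
have pre_between i : between u (u :+: pre s i) w.
  by rewrite /between symdiffKl -sE; exact: pre_sub.
(* By [ladder_chain], a vertex between [u] and [w] is determined by its distance from [u]. *)
have side x : x \in F -> between u x w -> exists2 i, i <= size s & x :+: u = pre s i.
  move=> xF bx; have hX : x :+: u \subset u :+: w by rewrite symdiffC.
  have hi : #|x :+: u| <= size s by rewrite ss; exact: subset_leq_card.
  exists #|x :+: u| => //; have hc := card_pre us hi.
  apply/eqP; rewrite eqEcard hc leqnn andbT; apply/subsetP=> a ax; apply: contraT => aP.
  have /subsetPn[b bP bX] : ~~ (pre s #|x :+: u| \subset x :+: u).
    apply: contra aP => sub; suff -> : pre s #|x :+: u| = x :+: u by [].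
    by apply/eqP; rewrite eqEcard sub hc leqnn.
  case: (@ladder_chain f u w x (u :+: pre s #|x :+: u|) a b lad xF bx) => //.
  - exact: (subsetP hX).
  - by rewrite -sE; apply: (subsetP (pre_sub s _)) bP.
  - by rewrite (symdiffC u) symdiffK.
  by rewrite (symdiffC u) symdiffK.
have preD i : i <= size s -> u :+: pre (rcons s f) i :+: D = u :+: post (rcons s f) i.
  by move=> hi; rewrite -symdiffA -DE -postE.
exists (rcons s f); rewrite size_rcons ss; split=> //; split=> //.
  move=> x /mem_stdcyc[i]; rewrite size_rcons ltnS => hi [->|->].
    by rewrite preE.
  rewrite -preD // preE //; exact: ladder_antipode lad (sF i) (pre_between i).
move=> x xF; have := gates x xF; set z := u :+: _ => zF.
have zu : z :+: u = (x :+: u) :&: D by rewrite /z (symdiffC u) symdiffK.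
have zD : z :+: u \subset D by rewrite zu subsetIr.
rewrite DE -zu size_rcons; clearbody z.
have [b|b] := ladder_sides lad zD.
  by have [i hi zE] := side z zF b; exists i; rewrite ?ltnS // preE //; left.
have b' : between u (z :+: D) w.
  rewrite /between; apply/subsetP=> e; rewrite symdiffC.
  have := subsetP b e; rewrite (flip_symdiffl f u (flip f w)) flip_symdiffr flipK.
  rewrite flip_symdiffl in_flip !in_symdiff in_setU1.
  have [->|ef] := eqVneq e f.
    move: fuw; rewrite in_symdiff.
    by case: (f \in u); case: (f \in w); case: (f \in z) => //= _ /(_ isT).
  rewrite /= in_symdiff addbF.
  by case: (e \in u); case: (e \in w); case: (e \in z).
have [i hi zE] := side _ (ladder_antipode_box lad zF zD) b'.
exists i; rewrite ?ltnS //; right.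
rewrite postE // DE preE // -zE.
by apply/setP=> e; rewrite !in_symdiff; case: (e \in z); case: (e \in u); case: (e \in D).
Qed.

End Ladder.

(** The base point may meet [X]: translation by [z :&: X] permutes the subsets of [X]. *)
Lemma strongly_shatteredP F X z : (forall X' : point, X' \subset X -> z :+: X' \in F) ->
  strongly_shattered F X.
Proof.
move=> h; apply/existsP; exists (z :\: X); apply/andP; split.
  by rewrite -setI_eq0; apply/eqP/setP=> e; rewrite !inE; case: (e \in X); rewrite ?andbF.
apply/forallP=> X'; apply/implyP=> sX.
suff -> : z :\: X :|: X' = z :+: (X' :+: (z :&: X)).
  apply: h; apply/subsetP=> e; rewrite in_symdiff in_setI.
  by have := subsetP sX e; case: (e \in X'); case: (e \in z); case: (e \in X) => //= /(_ isT).
apply/setP=> e; rewrite !in_symdiff !in_setU in_setD in_setI.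
by have := subsetP sX e; case: (e \in X'); case: (e \in z); case: (e \in X) => //= /(_ isT).
Qed.

Lemma ample_of_no_long_cycle G : partial_cube G -> vc2 (vset G) ->
  (forall y A, 3 < #|A| -> ~ star (vset G) y A) ->
  ~ (exists c, 6 <= size c /\ gated_cycle G c) -> ample (vset G).
Proof.
move=> /partial_cubeP[G0 cG iG] vG nostar nocyc X shX.
have cX : #|X| <= 2.
  have /VCdim_le2 := vG; apply: leq_trans.
  exact: (@leq_bigmax_cond _ (shattered (vset G)) (fun X : point => #|X|)).
have sh (X' : point) : X' \subset X -> exists2 A, A \in vset G & X :&: A = X'.
  move=> sX; have : X' \in powerset X by rewrite inE.
  by rewrite -(eqP shX) => /imsetP[A AG ->]; exists A.
case cE: #|X| cX => [|[|[|]]] // _.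
- have [z zG] := set0Pn _ G0; apply: (@strongly_shatteredP _ X z) => X'.
  by rewrite (cards0_eq cE) subset0 => /eqP->; rewrite symdiff0.
- have /eqP/cards1P[e XE] := cE.
  have [x xG xe] := sh set0 (sub0set _); have [y yG ye] := sh X (subxx _).
  have exy : e \in x :+: y.
    move/setP/(_ e): xe; move/setP/(_ e): ye.
    by rewrite in_symdiff !in_setI XE in_set1 in_set0 eqxx /= => -> ->.
  have [z [zG _ ez _]] := iso_cross iG xG yG exy.
  apply: (@strongly_shatteredP _ X z) => X'; rewrite XE subset1 => /orP[/eqP->|/eqP->].
    by rewrite -flipE.
  by rewrite symdiff0.
have /eqP/cards2P[e [f [ef XE]]] := cE.
have pt p q : exists2 A, A \in vset G & (e \in A) = p /\ (f \in A) = q.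
  have [|A AG hA] := sh [set g in X | (g == e) && p || (g == f) && q].
    by apply/subsetP=> g; rewrite inE => /andP[].
  exists A => //; move/setP: hA => hA; move: (hA e) (hA f).
  rewrite !inE XE !inE !eqxx (eq_sym f e) (negbTE ef) /= ?orbF ?orbT /=.
  by move=> -> ->.
have [A00 G00 [e00 f00]] := pt false false; have [A01 G01 [e01 f01]] := pt false true.
have [A10 G10 [e10 f10]] := pt true false; have [A11 G11 [e11 f11]] := pt true true.
have [u0 [u0G /betweenP bu u0f fu]] := iso_cross (f := f) iG G00 G01 ltac:(by rewrite in_symdiff f00 f01).
have [w0 [w0G /betweenP bw w0f fw]] := iso_cross (f := f) iG G10 G11 ltac:(by rewrite in_symdiff f10 f11).
(* Pairs of [f]-edges on the two sides of [e], each edge given by its end without [f]. *)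
pose P (p : point * point) := [&& p.1 \in vset G, p.2 \in vset G, flip f p.1 \in vset G,
  flip f p.2 \in vset G & [&& e \notin p.1, e \in p.2, f \notin p.1 & f \notin p.2]].
have P0 : P (u0, w0).
  by rewrite /P /= u0G w0G u0f w0f fu fw f00 f10 bu ?bw ?e00 ?e01 ?e10 ?e11.
have [[u w] /and5P[/= uG wG ufG wfG /and4P[eu ew fu' fw']] min] :=
  arg_minnP (fun p : point * point => #|p.1 :+: p.2|) P0.
have euw : e \in u :+: w by rewrite in_symdiff (negbTE eu) ew.
have [c1|c1] := leqP #|u :+: w| 1.
  have wE : w = flip e u.
    have /cards1P[g hg] : #|u :+: w| == 1.
      by rewrite eqn_leq c1 card_gt0; apply/set0Pn; exists e.
    move: euw; rewrite hg in_set1 => /eqP eg.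
    by rewrite flipE eg -hg symdiffKl.
  apply: (@strongly_shatteredP _ X u) => X' sX.
  have X'E : X' = [set g in X | (g == e) && (e \in X') || (g == f) && (f \in X')].
    apply/setP=> g; rewrite !inE; apply/idP/andP=> [gX|[_]].
      split; first exact: (subsetP sX).
      by have := subsetP sX g gX; rewrite XE !inE => /orP[/eqP ge|/eqP gf];
        rewrite -?ge -?gf ?eqxx gX ?orbT.
    by case/orP=> /andP[/eqP->].
  suff : [\/ u :+: X' = u, u :+: X' = flip e u, u :+: X' = flip f u | u :+: X' = flip f (flip e u)].
    by case=> ->; rewrite // -?wE.
  case eX: (e \in X'); case fX: (f \in X'); [constructor 4|constructor 2|constructor 3|constructor 1];
    apply/setP=> g; rewrite ?in_flip in_symdiff X'E inE XE !inE eX fX ?andbT ?andbF ?orbF;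
    have [->|_] := eqVneq g e; rewrite ?(negbTE ef) ?addbF //=;
    by case: (g == f); rewrite ?addbF ?addbT.
(* An [f]-edge at [z] can replace the one on the same side of [e], and by minimality coincides with
   it. *)
have lad : ladder (vset G) f u w.
  split=> //; first by rewrite in_symdiff (negbTE fu') (negbTE fw').
  move=> z zG /[dup] bz; rewrite dist_between => /eqP bd fz.
  have fz' : f \notin z.
    by have /betweenP/(_ f) := bz; rewrite (negbTE fu') (negbTE fw') => ->.
  have [ez|ez] := boolP (e \in z).
    right; have := min (u, z); rewrite /P /= uG zG ufG fz eu ez fu' fz' bd => /(_ isT) h.
    apply/eqP; rewrite -symdiff_eq0 -cards_eq0 -leqn0.
    by rewrite -(leq_add2l #|u :+: z|) addn0.
  left; have := min (z, w); rewrite /P /= wG zG wfG fz ew ez fw' fz' bd => /(_ isT) h.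
  apply/eqP; rewrite eq_sym -symdiff_eq0 -cards_eq0 -leqn0.
  by rewrite -(leq_add2r #|z :+: w|) add0n.
have [es [good ses]] := ladder_good iG vG nostar lad c1.
exfalso; apply: nocyc; exists (stdcyc u es); rewrite size_stdcyc ses; split.
  by rewrite (leq_double 3) ltnS.
by apply: good_gated => //; rewrite ses ltnS ltnW.
Qed.

End Ampleness.

(** * The invariant of the cycle completions and their termination *)

Section Completion.
Variable m : nat.
Local Notation point := {set 'I_m}.
Implicit Types (G H : sgraph point) (u : point) (c : seq point).

(** The threshold spares the stars with three directions: they are convex 6-cycles, still to be
    completed. *)
Definition starless G : Prop :=
  [/\ partial_cube G, vc2 (vset G) & forall y (A : point), 3 < #|A| -> ~ star (vset G) y A].

Lemma subgraph_trans G1 G2 G3 : subgraph G1 G2 -> subgraph G2 G3 -> subgraph G1 G3.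
Proof. by move=> [s1 h1] [s2 h2]; split=> [|x y /h1/h2 //]; exact: subset_trans s2. Qed.

Lemma post_rcons0 (es : seq 'I_m) j : uniq (rcons es j) ->
  post (rcons es j) 0 = flip j (pre (rcons es j) (size es)).
Proof.
move=> ues; rewrite postE // pre0 symdiffC symdiff0 -(pre_over (leqnn _)) size_rcons.
by rewrite (pre_S j) ?size_rcons // nth_rcons ltnn eqxx.
Qed.

Lemma cycle_extensionP G c j G' : partial_cube G -> cycle_extension G c j G' ->
  exists u es, [/\ c = stdcyc u (rcons es j), goodcycle (vset G) u (rcons es j), 1 < size es,
    vset G' = extended (vset G) u es j & cubical G'].
Proof.
move=> /partial_cubeP[_ cG iG] [k [[k3 sc] gc [_ th] vE aE]].
have [u [es0 [cE good]]] := gated_cycle_std cG iG gc.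
have ses0 : size es0 = k by have := sc; rewrite cE size_stdcyc => /double_inj.
case/lastP: es0 => [|es j0] in cE good ses0; first by rewrite -ses0 in k3.
have [ues sub _] := good.
have k2 : 1 < size es by move: k3; rewrite -ses0 size_rcons.
have kE : k = (size es).+1 by rewrite -ses0 size_rcons.
(* The edge from v_k to v_{k+1} of a standard cycle has the last direction, and [th] identifies it
   with [j]. *)
have jE : j = j0.
  move: th; rewrite /Theta kE /= => /andP[_ /eqP].
  have lt1 : size es < (size (rcons es j0)).*2 by rewrite size_rcons doubleS -addnn; lia.
  have lt2 : (size es).+1 < (size (rcons es j0)).*2 by rewrite size_rcons doubleS -addnn; lia.
  rewrite cE !nth_stdcyc // /cyc size_rcons ltnn ltnSn subnn post_rcons0 // flip_symdiffr symdiffC.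
  by rewrite flip_rel => /set1_inj ->.
rewrite jE in vE aE *; exists u, es.
have vE' : vset G' = extended (vset G) u es j0.
  by rewrite vE cE primedE.
split=> // x y; rewrite aE vE' -(extended_adj good k2) -cE -kE; congr [|| _, _, _ | _].
exact: cG.
Qed.

Lemma cycle_extension_starless G c j G' : starless G -> cycle_extension G c j G' ->
  [/\ starless G', subgraph G G' & #|vset G| < #|vset G'|].
Proof.
move=> [pG vG sG] ext; have [G0 cG iG] := iffLR (partial_cubeP G) pG.
have [k [_ _ _ vE aE]] := ext.
have [u [es [cE good k2 vE' cG']]] := cycle_extensionP pG ext.
split.
- split.
  + apply/partial_cubeP; split=> //; last by rewrite vE'; exact: extended_iso.
    have [x xG] := set0Pn _ G0; apply/set0Pn; exists x; by rewrite vE in_setU xG.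
  + by rewrite vE'; exact: extended_vc2.
  move=> y A cA st; apply: (sG y A cA); move: st; rewrite vE'; exact: extended_star.
- by split=> [|x y]; rewrite ?vE ?subsetUl // aE => ->.
by rewrite vE'; exact: extended_card.
Qed.

Lemma cycle_completion_starless G c G' : cycle_completion G c G' -> starless G ->
  [/\ starless G', subgraph G G' & 6 <= size c -> #|vset G| < #|vset G'|].
Proof.
elim=> {G c G'} [G c sc|G c d j G1 G2 sc cd ext _ IH] iG.
  by split=> //; rewrite leqNgt sc.
have [iG1 s1 lt1] := cycle_extension_starless iG ext; have [iG2 s2 _] := IH iG1.
split=> //; first exact: subgraph_trans s2.
by move=> _; apply: leq_trans lt1 _; apply: subset_leq_card; case: s2.
Qed.

(** The residual cycle is shorter by two and, by [extended_good], gated again, so the recursion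
    never gets stuck. *)
Lemma cycle_completion_exists G c : starless G -> gated_cycle G c ->
  exists G', cycle_completion G c G'.
Proof.
have [n] := ubnP (size c); elim: n G c => // n IH G c; rewrite ltnS => hn iG gc.
have [sc|sc] := ltnP (size c) 6; first by exists G; exact: CycleDone.
have [pG _ _] := iG; have [_ cG isoG] := iffLR (partial_cubeP G) pG.
have [u [es0 [cE good]]] := gated_cycle_std cG isoG gc.
have ses0 : size c = (size es0).*2 by rewrite cE size_stdcyc.
case/lastP: es0 => [|es j] in cE good ses0; first by rewrite ses0 in sc.
rewrite size_rcons in ses0.
have k2 : 1 < size es by move: sc; rewrite ses0 (leq_double 3).
have [ues sub _] := good.
pose G1 := induced (extended (vset G) u es j).
have ext : cycle_extension G c j G1.
  have nthG i : i < (size es).+1.*2 -> nth set0 c i \in vset G.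
    by move=> hi; apply: sub; rewrite -cE mem_nth // ses0.
  have lastE : post (rcons es j) (size es) = [set j].
    rewrite (post_S j) ?size_rcons // nth_rcons ltnn eqxx.
    apply/setP=> e; rewrite in_flip in_setlist drop_oversize ?size_rcons // in_nil.
    by rewrite in_set1.
  have lts i : i <= (size es).*2.+1 -> i < (size (rcons es j)).*2.
    by rewrite size_rcons doubleS ltnS.
  have esd : (size es).+1 <= (size es).*2.+1 by rewrite ltnS -addnn leq_addr.
  have lts' i : i <= (size es).*2.+1 -> i < (size es).+1.*2 by rewrite doubleS ltnS.
  exists (size es).+1; split.
  - by rewrite ses0.
  - exact: gc.
  - have h1 : nth set0 c (size es).+1.*2.-1 = flip j (nth set0 c 0).
      rewrite cE !nth_stdcyc ?lts ?doubleS //= /cyc size_rcons /= ltnS.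
      rewrite ltnNge -addnn leq_addr /= subSS addnK.
      by rewrite lastE pre0 symdiff0 -flipE.
    have h2 : nth set0 c (size es).+1 = flip j (nth set0 c (size es)).
      rewrite cE !nth_stdcyc ?lts // ?(ltnW esd) // /cyc size_rcons ltnn ltnSn subnn.
      by rewrite post_rcons0 // flip_symdiffr.
    have fs x : flip j x :+: x = [set j] by exact: flip_rel.
    split; rewrite /Theta cG.
    + by rewrite !nthG ?lts' ?doubleS //= h1 fs eqxx cube_sym cube_adj_flip.
    + by rewrite !nthG ?lts' ?(ltnW esd) //= h2 symdiffC fs eqxx cube_adj_flip.
  - by rewrite cE primedE.
  move=> x y; rewrite /= -(extended_adj good k2) -cE; congr [|| _, _, _ | _].
  by rewrite cG.
have [iG1 _ _] := cycle_extension_starless iG ext.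
have [pG1 _ _] := iG1; have [_ _ iso1] := iffLR (partial_cubeP G1) pG1.
have res : residual_cycle c j = stdcyc (flip j u) es by rewrite cE (residualE good k2).
have gc1 : gated_cycle G1 (residual_cycle c j).
  by rewrite res; apply: good_gated => //; exact: extended_good.
have [|G2 comp] := IH G1 (residual_cycle c j) _ iG1 gc1.
  by rewrite res size_stdcyc; apply: leq_trans hn; rewrite ses0 doubleS leqnSn.
exists G2; apply: (@CycleStep _ G c c j G1 G2) => //.
by exists 0; left; rewrite rot0.
Qed.

Lemma full_completion_exists G : starless G -> exists Gtop, full_cycle_completion G Gtop.
Proof.
have [n] := ubnP #|~: vset G|; elim: n G => // n IH G; rewrite ltnS => hn iG.
have [[c [sc gc]]|h] := classic (exists c, 6 <= size c /\ gated_cycle G c); last first.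
  by exists G; split=> //; exact: rt_refl.
have [G' comp] := cycle_completion_exists iG gc.
have [iG' _ /(_ sc) lt] := cycle_completion_starless comp iG.
have [|Gtop [r1 m1]] := IH G' _ iG'.
  apply: leq_trans hn; rewrite -(ltn_add2l #|vset G|) cardsC -(cardsC (vset G')).
  by rewrite ltn_add2r.
exists Gtop; split=> //; apply: rt_trans r1; apply: rt_step.
by exists c.
Qed.

Lemma completion_steps_starless G G' :
  clos_refl_trans _ (@cycle_completion_step m) G G' -> starless G ->
  starless G' /\ subgraph G G'.
Proof.
move=> /(clos_rt_rt1n _ _ _ _) r; elim: r => {G G'} [G|G G' G1 [c [sc gc comp]] _ IH] iG.
  by split=> //; split.
have [iG' s1 _] := cycle_completion_starless comp iG; have [iG1 s2] := IH iG'.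
by split=> //; exact: subgraph_trans s2.
Qed.

End Completion.

Theorem theorem35 (m : nat) (G : sgraph {set 'I_m})
    (G_partial_cube : partial_cube G) (G_dim : VCdim (vset G) <= 2) :
  (exists G1 : sgraph {set 'I_m}, canonical_one_completion G G1) /\
  (forall G1 : sgraph {set 'I_m}, canonical_one_completion G G1 ->
     (exists Gtop : sgraph {set 'I_m}, full_cycle_completion G1 Gtop) /\
     (forall Gtop : sgraph {set 'I_m}, full_cycle_completion G1 Gtop ->
        [/\ subgraph Gtop (cube m),
            subgraph G Gtop,
            partial_cube Gtop,
            ample (vset Gtop) &
            VCdim (vset Gtop) <= 2])).
Proof.
have vG := iffLR (VCdim_le2 _) G_dim.
split; first exact: canonical_exists.
move=> G1 [steps complete].
have [pG1 vG1 s1] := one_extensions_step G_partial_cube vG steps.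
have iG1 : starless G1 by split=> //; exact: no_star_of_complete.
split; first exact: full_completion_exists.
move=> Gtop [steps' nocyc].
have [[pT vT sT] s2] := completion_steps_starless steps' iG1.
have [_ cT _] := iffLR (partial_cubeP Gtop) pT.
split=> //.
- by split=> [|x y]; [exact: subsetT | rewrite cT => /and3P[]].
- exact: subgraph_trans s2.
- exact: ample_of_no_long_cycle.
exact/VCdim_le2.
Qed.
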